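(* Let $0<p<\infty$ and $g\in H(\mathbb{D})$. Then $T_{g}:\mathcal{D}^{p}_{p-1}\rightarrow F(p,p-1,1)$ is bounded if and only if $g\in\mathcal{B}$. Moreover, $$\|T_{g}\|_{\mathcal{D}^{p}_{p-1}\rightarrow F(p,p-1,1)}\approx\|g\|_{\mathcal{B}}.$$
   Context: $\mathbb{D}$ is the open unit disc of $\mathbb{C}$, $H(\mathbb{D})$ the space of analytic functions on $\mathbb{D}$, and $dA(z)=\frac1\pi\,dx\,dy$ the normalized area measure. Volterra type operator: $T_gf(z)=\int_0^z f(\xi)g'(\xi)\,d\xi$ for $f\in H(\mathbb{D})$, $z\in\mathbb{D}$. Bloch space: $\mathcal{B}$ is the set of $f\in H(\mathbb{D})$ with $\|f\|_{\mathcal{B}}=\sup_{z\in\mathbb{D}}(1-|z|^2)|f'(z)|<\infty$ (a semi-norm). Dirichlet type space: $\mathcal{D}^{p}_{p-1}$ is the set of $f\in H(\mathbb{D})$ with $$\|f\|_{\mathcal{D}^{p}_{p-1}}=\Big(|f(0)|^{p}+\int_{\mathbb{D}}|f'(z)|^{p}(1-|z|^{2})^{p-1}dA(z)\Big)^{1/p}<\infty.$$ $F(p,q,s)$ space ($0<p<\infty$, $q>-2$, $0<s<\infty$): the set of $f\in H(\mathbb{D})$ with $$\|f\|_{F(p,q,s)}^{p}=|f(0)|^{p}+\sup_{a\in\mathbb{D}}\int_{\mathbb{D}}|f'(z)|^{p}(1-|z|^{2})^{q}(1-|\sigma_{a}(z)|^{2})^{s}dA(z)<\infty,\qquad \sigma_a(z)=\frac{a-z}{1-\overline{a}z}.$$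 $\|T\|_{X\to Y}$ denotes the operator (quasi-)norm $\sup\{\|Tf\|_Y:\|f\|_X\le1\}$. $A\approx B$ means $C^{-1}B\le A\le CB$ for a constant $C>0$ depending only on $p$ (not on $g$). *)

(* Defs.v *)
From HB Require Import structures.
From mathcomp Require Import all_boot all_order all_algebra.
From mathcomp Require Import complex.
From mathcomp Require Import all_classical all_reals all_analysis.

Set Implicit Arguments.
Unset Strict Implicit.
Unset Printing Implicit Defensive.

Import Order.TTheory GRing.Theory Num.Theory.
Import numFieldNormedType.Exports.
Import Normc.

Local Open Scope classical_set_scope.
Local Open Scope complex_scope.
Local Open Scope ring_scope.

Section Definitions.
Context {R : realType}.
Local Notation C := R[i].
Implicit Types (a z : C) (f g h : C -> C) (p q s : R).

(* The norm `|z| of R[i] takes its values in R[i]; normc z is the same modulus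
   as an element of R. *)
Definition disc : set C := [set z | normc z < 1].

(* R[i]^o is R[i] as a normed module over itself: the increments tending to 0
   are complex, so these are complex differentiability and the complex
   derivative. *)
Definition cderivable f z : Prop := derivable (f : C^o -> C^o) z 1.

Definition cderiv f z : C := derive1 (f : C -> C^o) z.

(* A function on the disc is represented by a total function on R[i]; its values
   outside the disc are irrelevant. *)
Definition holo_disc : set (C -> C) :=
  [set f | forall z, disc z -> cderivable f z].

(* Integral over the disc against dA = dx dy / pi, with z = x + iy. *)
Definition integral_dA (F : C -> R) : \bar R :=
  (\int[(lebesgue_measure \x lebesgue_measure)%E]_(w in
      [set w : R * R | disc (w.1 +i* w.2)])
    (pi^-1 * F (w.1 +i* w.2))%:E)%E.

(* Path integral along the segment from 0 to z, parametrized by t |-> t z. *)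
Definition segment_integral h z : C :=
  (\int[lebesgue_measure]_(t in `[0, 1]) complex.Re (h (t%:C * z) * z)) +i*
  (\int[lebesgue_measure]_(t in `[0, 1]) complex.Im (h (t%:C * z) * z)).

Definition volterra g f : C -> C :=
  segment_integral (fun xi => f xi * cderiv g xi).

Definition mobius a z : C := (a - z) / (1 - a^*%C * z).

(* All (quasi-, semi-)norms take values in \bar R, and the spaces consist of the
   holomorphic functions for which they are finite. *)

Definition bloch_norm f : \bar R :=
  ereal_sup [set ((1 - normc z ^+ 2) * normc (cderiv f z))%:E | z in disc].

Definition bloch : set (C -> C) :=
  [set f | holo_disc f /\ (bloch_norm f < +oo)%E].

Definition dirichlet_norm p f : \bar R :=
  (((normc (f 0) `^ p)%:E +
    integral_dA (fun z =>
      normc (cderiv f z) `^ p * (1 - normc z ^+ 2) `^ (p - 1))%R) `^ p^-1)%E.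

Definition dirichlet p : set (C -> C) :=
  [set f | holo_disc f /\ (dirichlet_norm p f < +oo)%E].

Definition F_norm p q s f : \bar R :=
  (((normc (f 0) `^ p)%:E +
    ereal_sup [set integral_dA (fun z =>
      normc (cderiv f z) `^ p * (1 - normc z ^+ 2) `^ q *
      (1 - normc (mobius a z) ^+ 2) `^ s)%R | a in disc]) `^ p^-1)%E.

Definition F_space p q s : set (C -> C) :=
  [set f | holo_disc f /\ (F_norm p q s f < +oo)%E].

Definition bounded_operator (X : set (C -> C)) (normX : (C -> C) -> \bar R)
    (Y : set (C -> C)) (normY : (C -> C) -> \bar R)
    (T : (C -> C) -> (C -> C)) : Prop :=
  (forall f, X f -> Y (T f)) /\
  exists M : R, forall f, X f -> (normY (T f) <= M%:E * normX f)%E.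

(* Here normY is extended by +oo off the target space (as F_norm is, among
   holomorphic functions), so the supremum is +oo if T maps some f of the unit
   ball of X out of that space. *)
Definition operator_norm (X : set (C -> C)) (normX normY : (C -> C) -> \bar R)
    (T : (C -> C) -> (C -> C)) : \bar R :=
  ereal_sup [set normY (T f) | f in [set f | X f /\ (normX f <= 1)%E]].

End Definitions.

(* Main.v *)
(** Since [(1 - |z|^2) |g'(z)| <= ||g||_B] and
    [1 - |sigma_a(z)|^2 <= 2 (1 - |z|^2) / |1 - conj a z|], the upper bound reduces to the
    Carleson embedding
      [int |f|^p / |1 - conj a z| dA <= A (|f(0)|^p + int |f'|^p (1 - |w|^2)^(p-1) dA)]
    uniformly in [a].  Integrating [f'] along a radius and using the submean
    value property of [|f'|^p] bounds [|f(z) - f(0)|^p] by [(1 - |z|)^(-1/4)]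
    times an integral of [|f'(w)|^p (1 - |w|)^(p + 1/4 - 2)] over the points [w]
    whose square of side comparable to [1 - |w|] contains [z]; after exchanging
    the integrals, one integrates
    [(1 - |z|)^(-1/4) / |1 - conj a z|] over such a square.  Conversely, the
    functions [c (1 - |a|)^(n - 1/p) / (1 - conj a z)^n] with [n p >= 4] lie in the unit
    ball of the Dirichlet type space and are of maximal size near [a], where the
    submean value property of [|g'|^p] recovers [(1 - |a|) |g'(a)|]. *)
Require Import Defs.
From HB Require Import structures.
From mathcomp Require Import all_boot all_order all_algebra.
From mathcomp Require Import complex.
From mathcomp Require Import all_classical all_reals all_analysis.
From mathcomp Require Import measurable_realfun.
From mathcomp Require Import ring lra.

Set Implicit Arguments.
Unset Strict Implicit.
Unset Printing Implicit Defensive.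

Import Order.TTheory GRing.Theory Num.Theory.
Import numFieldNormedType.Exports.
Import Normc.

Local Open Scope classical_set_scope.
Local Open Scope complex_scope.
Local Open Scope ring_scope.

(** * Complex differentiability in terms of the real-valued modulus *)

Section ComplexBasics.
Context {R : realType}.
Local Notation C := R[i].
Implicit Types (z w : C).

(** The exponent [p] is any positive real, and for [p < 1] neither Minkowski's nor Hoelder's
    inequality controls the integral of [f'] along a radius. That integral is estimated instead
    through the supremum over [t] of [|f'(tz)| (1 - t|z|)^(1 + eta)] with [eta = 1 / (4 p)]: a
    single area integral bounds this quantity at every point of the radius, at the price of the
    factor [(1 - |z|)^(-1/4)]. The value 1/4 is tied to the way planar integrals are computed.
    Squares replace discs, because plane measure is a product on them, and [1 / |1 - conj a z|] is
    split into two factors of exponent 1/2, one for each coordinate; on a line the worst singularity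
    then has exponent 1/4 + 1/2 = 3/4 < 1. Squares also suit Cauchy's formula, which is established
    for rectangles by bisection and gives the submean value property up to a constant, without any
    recourse to subharmonicity. *)

Lemma normcE_norm z : `|z| = (normc z)%:C.
Proof. by case: z. Qed.

Lemma normc_ge0 z : 0 <= normc z.
Proof. by case: z => a b; exact: sqrtr_ge0. Qed.

Lemma normc_gt0 z : (0 < normc z) = (z != 0).
Proof.
rewrite lt0r normc_ge0 andbT; congr negb.
by apply/eqP/eqP => [/eq0_normc//|->]; rewrite normc0.
Qed.

Lemma normc_real (x : R) : normc x%:C = `|x|.
Proof. by rewrite /= expr0n addr0 sqrtr_sqr. Qed.

Lemma normcX z n : normc (z ^+ n) = normc z ^+ n.
Proof. by elim: n => [|n IH]; rewrite ?expr0 ?normc1// !exprS normcM IH. Qed.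

Lemma normcB z w : normc (z - w) = normc (w - z).
Proof. by rewrite -normcN opprB. Qed.

Lemma ler_normcB z w : normc z - normc w <= normc (z - w).
Proof. by rewrite lerBlDr (le_trans _ (le_normcD _ _))// subrK. Qed.

Lemma normc_Re z : `|complex.Re z| <= normc z.
Proof.
case: z => a b /=; rewrite -sqrtr_sqr ler_wsqrtr// lerDl sqr_ge0//.
Qed.

Lemma normc_Im z : `|complex.Im z| <= normc z.
Proof.
case: z => a b /=; rewrite -sqrtr_sqr ler_wsqrtr// lerDr sqr_ge0//.
Qed.

Lemma normc_le_ReIm z : normc z <= `|complex.Re z| + `|complex.Im z|.
Proof.
case: z => a b /=; rewrite -(@ger0_norm _ (`|a| + `|b|)) ?addr_ge0//.
rewrite -sqrtr_sqr ler_wsqrtr// sqrrD !real_normK ?num_real// addrAC lerDl.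
by rewrite mulrn_wge0// mulr_ge0.
Qed.

Lemma normc_sqr (x y : R) : normc (x +i* y) ^+ 2 = x ^+ 2 + y ^+ 2.
Proof. by rewrite sqr_sqrtr// addr_ge0// sqr_ge0. Qed.

Lemma normc_conj z : normc (z^*)%C = normc z.
Proof. by case: z => a b /=; rewrite sqrrN. Qed.

(* [cdiff] and [ccont] restate complex differentiability and continuity with real
   epsilon and delta: the order of [R[i]] itself is only partial. *)
Definition cdiff (f : C -> C) z (l : C) := forall e : R, 0 < e ->
  exists2 d, 0 < d & forall h, normc h < d ->
    normc (f (z + h) - f z - l * h) <= e * normc h.

Definition ccont (f : C -> C) z := forall e : R, 0 < e ->
  exists2 d, 0 < d & forall h, normc h < d -> normc (f (z + h) - f z) < e.

(** Comparable complex numbers have equal imaginary parts, so a positive radius or tolerance coming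
    from a complex filter is a real number in disguise. *)
Lemma complex_gt0 (e : C) : 0 < e -> e = (complex.Re e)%:C /\ 0 < complex.Re e.
Proof.
case: e => a b; rewrite ltcE /= => /andP[/eqP -> a0].
by split.
Qed.

Lemma cdiff_is_derive f z l : cdiff f z l ->
  is_derive (z : C^o) (1 : C^o) (f : C^o -> C^o) (l : C^o).
Proof.
move=> fl.
suff H : h^-1 *: (((f : C^o -> C^o) \o shift z) (h *: (1:C^o)) - f z) @[h --> (0:C^o)^'] --> (l : C^o).
  by apply: DeriveDef; [apply/cvg_ex; exists l | exact: cvg_lim H].
apply/cvgrPdist_le => e /complex_gt0[-> e0].
have [d d0 H] := fl _ e0.
apply/nbhs_ballP; exists d%:C; first by rewrite /= ltcR.
move=> h /=; rewrite /ball /= sub0r normrN normcE_norm ltcR => hd h0.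
rewrite normcE_norm lecR -(ler_pM2r (x := normc h)) ?normc_gt0//.
rewrite -normcM -normcN.
have -> : - ((l - h^-1 *: (f (h *: (1:C^o) + z) - f z)) * h) =
  f (z + h) - f z - l * h.
  rewrite [X in f (X + z)]mulr1 /GRing.scale/= (addrC h).
  by rewrite mulrBl mulrAC mulVf// mul1r opprB.
exact: H.
Qed.

Lemma derivable_cdiff f z : cderivable f z -> cdiff f z (cderiv f z).
Proof.
move=> fz; rewrite /cderiv derive1E.
set l := 'D_(_) _ _.
have : h^-1 *: (((f : C^o -> C^o) \o shift z) (h *: (1:C^o)) - f z) @[h --> (0:C^o)^'] --> (l : C^o).
  exact: fz.
move/cvgrPdist_le => H e e0.
have := H e%:C; rewrite ltcR => /(_ e0) /nbhs_ballP[d /complex_gt0[-> d0]] {}H.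
exists (complex.Re d) => // h hd.
have [->|h0] := eqVneq h 0.
  by rewrite addr0 subrr mulr0 subr0 normc0 mulr0.
have := H h; rewrite /ball /= sub0r normrN !normcE_norm ltcR hd lecR.
move=> /(_ isT h0); rewrite -(ler_pM2r (x := normc h)) ?normc_gt0//.
rewrite -normcM -normcN.
suff -> : - ((l - h^-1 *: (f (h *: (1:C^o) + z) - f z)) * h) =
  f (z + h) - f z - l * h by [].
rewrite [X in f (X + z)]mulr1 /GRing.scale/= (addrC h).
by rewrite mulrBl mulrAC mulVf// mul1r opprB.
Qed.

Lemma cdiff_derivable f z l : cdiff f z l -> cderivable f z.
Proof. by move=> /cdiff_is_derive []. Qed.

Lemma cdiff_cderiv f z l : cdiff f z l -> cderiv f z = l.
Proof. by move=> /cdiff_is_derive [_]; rewrite /cderiv derive1E. Qed.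

Lemma is_derive_cdiff f z l : is_derive (z : C^o) (1 : C^o) (f : C^o -> C^o) (l : C^o) -> cdiff f z l.
Proof.
move=> [fz <-]; have := derivable_cdiff fz.
by rewrite /cderiv derive1E.
Qed.

End ComplexBasics.

(** * Integrals of complex-valued functions over real segments *)

Section ComplexIntegral.
Context {R : realType}.
Local Notation C := R[i].
Local Notation mu := (@lebesgue_measure R).
Implicit Types (u v U : R -> C) (a b t : R).

Definition rcont u t := forall e : R, 0 < e ->
  exists2 d, 0 < d & forall h, `|h| < d -> normc (u (t + h) - u t) < e.

(** The parameter is real and the values are complex, as for the restriction of a holomorphic
    function to a side of a rectangle or to a radius. *)
Definition rdiff u t (l : C) := forall e : R, 0 < e ->
  exists2 d, 0 < d & forall h : R, `|h| < d ->
    normc (u (t + h) - u t - l * h%:C) <= e * `|h|.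

(** One argument serves [Re], [Im] and the modulus, all three being 1-Lipschitz. *)
Lemma rcont_lipschitz (phi : C -> R) u t : (forall z w, `|phi z - phi w| <= normc (z - w)) ->
  rcont u t -> {for t, continuous (phi \o u)}.
Proof.
move=> H1 uc; apply/cvgrPdist_lt => e e0; have [d d0 H] := uc _ e0.
apply/nbhs_ballP; exists d => // s /=; rewrite /ball /= distrC => hs.
rewrite distrC; apply: le_lt_trans (H _ hs).
by rewrite subrKC H1.
Qed.

Lemma rcont_Re u t : rcont u t -> {for t, continuous (@complex.Re R \o u)}.
Proof. by apply: rcont_lipschitz => z w; rewrite -raddfB normc_Re. Qed.

Lemma rcont_Im u t : rcont u t -> {for t, continuous (@complex.Im R \o u)}.
Proof. by apply: rcont_lipschitz => z w; rewrite -raddfB normc_Im. Qed.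

Lemma rcont_normc u t : rcont u t -> {for t, continuous (@normc R \o u)}.
Proof.
apply: rcont_lipschitz => z w; rewrite ler_norml lerNl opprB ler_normcB andbT.
by rewrite normcB ler_normcB.
Qed.

Lemma rdiff_is_derive (phi : C -> R) u t l :
  (forall z, `|phi z| <= normc z) -> (forall z w, phi (z - w) = phi z - phi w) ->
  (forall h : R, phi (l * h%:C) = phi l * h) ->
  rdiff u t l -> is_derive t 1 (phi \o u) (phi l).
Proof.
move=> phi1 phiB phiZ ul.
suff H : h^-1 *: ((phi \o u \o shift t) (h *: 1) - (phi \o u) t) @[h --> 0^'] --> phi l.
  by apply: DeriveDef; [apply/cvg_ex; exists (phi l) | exact: cvg_lim H].
apply/cvgrPdist_le => e e0; have [d d0 H] := ul _ e0.
apply/nbhs_ballP; exists d => // h /=; rewrite /ball /= sub0r normrN => hd h0.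
rewrite -(ler_pM2r (x := `|h|)) ?normr_gt0// -normrM; apply: le_trans (H _ hd).
apply: le_trans (phi1 _); rewrite -normrN le_eqVlt; apply/orP; left.
apply/eqP; congr (`| _ |); rewrite /GRing.scale/= mulr1 (addrC h).
by rewrite mulrBl mulrAC mulVf// mul1r opprB !phiB phiZ.
Qed.

Lemma rdiff_Re u t l : rdiff u t l -> is_derive t 1 (@complex.Re R \o u) (complex.Re l).
Proof.
apply: rdiff_is_derive => [|z w|h]; [exact: normc_Re|by rewrite raddfB|].
by case: l => x y /=; rewrite mulr0 subr0.
Qed.

Lemma rdiff_Im u t l : rdiff u t l -> is_derive t 1 (@complex.Im R \o u) (complex.Im l).
Proof.
apply: rdiff_is_derive => [|z w|h]; [exact: normc_Im|by rewrite raddfB|].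
by case: l => x y /=; rewrite mulr0 add0r.
Qed.

Lemma continuous_segment_integrable (f : R -> R) a b :
  (forall t, a <= t <= b -> {for t, continuous f}) ->
  mu.-integrable `[a, b] (EFin \o f).
Proof.
move=> fc; apply: continuous_compact_integrable; first exact: segment_compact.
apply: continuous_in_subspaceT => t; rewrite inE/= in_itv/= => tab.
exact: fc.
Qed.

(** Componentwise, as in [segment_integral]. There is no orientation: the interval is empty for
    [b < a], so the signs of contour pieces are written out. *)
Definition cint a b u : C :=
  (\int[mu]_(t in `[a, b]) complex.Re (u t)) +i*
  (\int[mu]_(t in `[a, b]) complex.Im (u t)).

Lemma eq_cint a b u v : (forall t, a <= t <= b -> u t = v t) ->
  cint a b u = cint a b v.
Proof.
by move=> uv; congr (_ +i* _); apply: eq_Rintegral => t;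
  rewrite inE/= in_itv/= => /uv ->.
Qed.

Definition seg_cont a b u := forall t, a <= t <= b -> rcont u t.

Lemma cintD a b u v : seg_cont a b u -> seg_cont a b v ->
  cint a b (fun t => u t + v t) = cint a b u + cint a b v.
Proof.
move=> uc vc; rewrite /cint /= -[RHS]/(_ +i* _).
under eq_Rintegral do rewrite raddfD/=.
under [X in _ +i* X]eq_Rintegral do rewrite raddfD/=.
congr (_ +i* _); rewrite RintegralD//=; apply: continuous_segment_integrable => t /[dup] /uc ? /vc ?;
  by [exact: rcont_Re|exact: rcont_Im].
Qed.

Lemma cintZ a b (c : C) u : seg_cont a b u ->
  cint a b (fun t => c * u t) = c * cint a b u.
Proof.
move=> uc; case: c => x y; rewrite /cint.
have iR : mu.-integrable `[a, b] (EFin \o (fun t => complex.Re (u t))).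
  by apply: continuous_segment_integrable => t /uc; exact: rcont_Re.
have iI : mu.-integrable `[a, b] (EFin \o (fun t => complex.Im (u t))).
  by apply: continuous_segment_integrable => t /uc; exact: rcont_Im.
have iZ (f : R -> R) (k : R) : mu.-integrable `[a, b] (EFin \o f) ->
    mu.-integrable `[a, b] (EFin \o (fun t => k * f t)).
  by move=> fi; apply: integrableZl fi; exact: measurable_itv.
rewrite -[RHS]/((_ - _) +i* (_ + _)) /=; congr (_ +i* _).
  rewrite -!RintegralZl// -RintegralB//; [|exact: iZ..].
  by apply: eq_Rintegral => t _; case: (u t).
rewrite -!RintegralZl// -RintegralD//; [|exact: iZ..].
by apply: eq_Rintegral => t _; case: (u t).
Qed.

(** Real and imaginary parts are bounded separately; the resulting factor 2 is harmless, since all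
    estimates are up to constants. *)
Lemma cint_normc a b u : seg_cont a b u ->
  normc (cint a b u) <= 2 * \int[mu]_(t in `[a, b]) normc (u t).
Proof.
move=> uc; apply: le_trans (normc_le_ReIm _) _; rewrite mulr_natl mulr2n /=.
have iN : mu.-integrable `[a, b] (EFin \o (@normc R \o u)).
  by apply: continuous_segment_integrable => t /uc; exact: rcont_normc.
have iR : mu.-integrable `[a, b] (EFin \o (@complex.Re R \o u)).
  by apply: continuous_segment_integrable => t /uc; exact: rcont_Re.
have iI : mu.-integrable `[a, b] (EFin \o (@complex.Im R \o u)).
  by apply: continuous_segment_integrable => t /uc; exact: rcont_Im.
apply: lerD.
  apply: (le_trans (le_normr_Rintegral _ iR)) => //.
  by apply: le_Rintegral => //; [exact: integrable_abse iR|move=> t _; exact: normc_Re].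
apply: (le_trans (le_normr_Rintegral _ iI)) => //.
by apply: le_Rintegral => //; [exact: integrable_abse iI|move=> t _; exact: normc_Im].
Qed.

Lemma cint_bound a b u M : a <= b -> seg_cont a b u ->
  (forall t, a <= t <= b -> normc (u t) <= M) ->
  normc (cint a b u) <= 2 * M * (b - a).
Proof.
move=> ab uc uM; apply: le_trans (cint_normc uc) _; rewrite -mulrA ler_pM2l//.
have -> : M * (b - a) = \int[mu]_(t in `[a, b]) M.
  rewrite Rintegral_cst//; congr (_ * _).
  have /= -> := lebesgue_measure_itv `[a, b]; rewrite lte_fin.
  by case: ltgtP ab => // <-; rewrite subrr.
apply: le_Rintegral => //.
- by apply: continuous_segment_integrable => t /uc; exact: rcont_normc.
- by apply: continuous_segment_integrable => t _; exact: cst_continuous.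
Qed.

Lemma cint_split a c b u : a <= c <= b -> seg_cont a b u ->
  cint a b u = cint a c u + cint c b u.
Proof.
move=> /andP[ac cb] uc; rewrite /cint -[RHS]/(_ +i* _) /=.
have iR : mu.-integrable `[a, b] (EFin \o (fun t => complex.Re (u t))).
  by apply: continuous_segment_integrable => t /uc; exact: rcont_Re.
have iI : mu.-integrable `[a, b] (EFin \o (fun t => complex.Im (u t))).
  by apply: continuous_segment_integrable => t /uc; exact: rcont_Im.
have sub : `]c, b] `<=` `[a, b]%classic.
  by move=> t /=; rewrite !in_itv/= => /andP[/ltW ct ->]; rewrite (le_trans ac ct).
congr (_ +i* _).
  rewrite -(Rintegral_itv_obnd_cbnd (r := c)).
    by rewrite -(Rintegral_itvB (x := c) iR) ?bnd_simp// addrC subrK.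
  exact: integrableS iR.
rewrite -(Rintegral_itv_obnd_cbnd (r := c)).
  by rewrite -(Rintegral_itvB (x := c) iI) ?bnd_simp// addrC subrK.
exact: integrableS iI.
Qed.

Lemma Rintegral_ftc (f F : R -> R) a b : a <= b ->
  (forall t, a <= t <= b -> {for t, continuous f}) ->
  (forall t, a <= t <= b -> is_derive t 1 F (f t)) ->
  \int[mu]_(t in `[a, b]) f t = F b - F a.
Proof.
rewrite le_eqVlt => /predU1P[<- _ _|ab fc Fd].
  by rewrite set_itv1 Rintegral_set1 subrr.
have Fcont t : a <= t <= b -> {for t, continuous F}.
  by move=> /Fd [+ _] => /derivable1_diffP/differentiable_continuous.
rewrite /Rintegral (continuous_FTC2 (F := F))//.
- apply: continuous_in_subspaceT => t; rewrite inE/= in_itv/=; exact: fc.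
- split.
  + move=> t /=; rewrite in_itv/= => /andP[/ltW at_ /ltW tb].
    by have [] := Fd t; rewrite ?at_ ?tb.
  + by apply: cvg_at_right_filter; apply: Fcont; rewrite lexx ltW.
  + by apply: cvg_at_left_filter; apply: Fcont; rewrite lexx ltW.
- move=> t; rewrite in_itv/= => /andP[/ltW at_ /ltW tb].
  by rewrite derive1E; have [] := Fd t; rewrite ?at_ ?tb.
Qed.

Lemma cint_ftc u U a b : a <= b -> seg_cont a b u ->
  (forall t, a <= t <= b -> rdiff U t (u t)) ->
  cint a b u = U b - U a.
Proof.
move=> ab uc Ud; rewrite /cint.
have -> : \int[mu]_(t in `[a, b]) complex.Re (u t) =
    complex.Re (U b) - complex.Re (U a).
  apply: (@Rintegral_ftc (@complex.Re R \o u) (@complex.Re R \o U)) => // t.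
    by move/uc; exact: rcont_Re.
  by move/Ud; exact: rdiff_Re.
have -> : \int[mu]_(t in `[a, b]) complex.Im (u t) =
    complex.Im (U b) - complex.Im (U a).
  apply: (@Rintegral_ftc (@complex.Im R \o u) (@complex.Im R \o U)) => // t.
    by move/uc; exact: rcont_Im.
  by move/Ud; exact: rdiff_Im.
by case: (U b) => ? ?; case: (U a).
Qed.

End ComplexIntegral.

(** * Cauchy's theorem and formula on rectangles *)

Section BoxInduction.
Context {R : realType}.

Lemma nested_intervals (x y : nat -> R) :
  (forall n, x n <= x n.+1) -> (forall n, y n.+1 <= y n) ->
  (forall n, x n <= y n) -> exists c, forall n, x n <= c <= y n.
Proof.
move=> xS yS xy.
have xnd n m : (n <= m)%N -> x n <= x m.
  by elim: m => [|m IH]; [rewrite leqn0 => /eqP ->|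
    rewrite leq_eqVlt => /predU1P[->//|/IH] /le_trans; apply].
have yni n m : (n <= m)%N -> y m <= y n.
  elim: m => [|m IH]; first by rewrite leqn0 => /eqP ->.
  by rewrite leq_eqVlt => /predU1P[->//|/IH]; apply: le_trans.
have xym n m : x n <= y m.
  apply: (le_trans (xnd _ _ (leq_maxl n m))).
  exact: (le_trans (xy _) (yni _ _ (leq_maxr n m))).
have ubx m : ubound (range x) (y m) by move=> _ [n _ <-].
exists (sup (range x)) => n; apply/andP; split.
  by apply: sup_upper_bound; [split; [exists (x 0%N), 0%N|exists (y 0%N)]|exists n].
by apply: ge_sup; [exists (x 0%N), 0%N|exact: ubx].
Qed.

Lemma expr_half_lt (w d : R) : 0 < d -> exists N, forall n, (N <= n)%N -> w / 2 ^+ n < d.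
Proof.
move=> d0; have [w0|w0] := leP w 0.
  exists 0%N => n _; apply: le_lt_trans d0.
  by rewrite pmulr_lle0 ?invr_gt0 ?exprn_gt0.
exists (Num.truncn (w / d)).+1 => n Nn.
rewrite ltr_pdivrMr ?exprn_gt0// mulrC -ltr_pdivrMr//.
apply: (lt_le_trans (truncnS_gt _)); apply: (@le_trans _ _ n%:R).
  by rewrite ler_nat.
by rewrite -natrX ler_nat ltnW// ltn_expl.
Qed.

(** Compactness of a closed rectangle as an induction principle. If [P] failed on the whole box it
    would fail on some quarter of each successive bad box; these boxes shrink to a point [(a, b)],
    where the local hypothesis applies. It serves both Goursat's theorem and the boundedness of
    continuous functions. *)
Lemma box_induction (P : R -> R -> R -> R -> Prop) (X1 X2 Y1 Y2 : R) :
  X1 <= X2 -> Y1 <= Y2 ->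
  (forall x1 x2 y1 y2, X1 <= x1 -> x1 <= x2 -> x2 <= X2 ->
     Y1 <= y1 -> y1 <= y2 -> y2 <= Y2 ->
     let mx := (x1 + x2) / 2 in let my := (y1 + y2) / 2 in
     P x1 mx y1 my -> P mx x2 y1 my -> P x1 mx my y2 -> P mx x2 my y2 ->
     P x1 x2 y1 y2) ->
  (forall a b, X1 <= a <= X2 -> Y1 <= b <= Y2 -> exists2 d, 0 < d &
     forall x1 x2 y1 y2, X1 <= x1 <= a -> a <= x2 <= X2 ->
       Y1 <= y1 <= b -> b <= y2 <= Y2 -> x2 - x1 < d -> y2 - y1 < d ->
       P x1 x2 y1 y2) ->
  P X1 X2 Y1 Y2.
Proof.
move=> X12 Y12 Psplit Ploc; apply: contrapT => nP.
pose good (B : R * R * R * R) := let: (x1, x2, y1, y2) := B in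
  [/\ X1 <= x1, x1 <= x2, x2 <= X2 & [/\ Y1 <= y1, y1 <= y2, y2 <= Y2 &
    ~ P x1 x2 y1 y2]].
pose x1 (B : R * R * R * R) := B.1.1.1.
pose x2 (B : R * R * R * R) := B.1.1.2.
pose y1 (B : R * R * R * R) := B.1.2.
pose y2 (B : R * R * R * R) := B.2.
pose rel (B B' : R * R * R * R) :=
  [/\ x1 B <= x1 B', x2 B' <= x2 B, x2 B' - x1 B' = (x2 B - x1 B) / 2 &
   [/\ y1 B <= y1 B', y2 B' <= y2 B & y2 B' - y1 B' = (y2 B - y1 B) / 2]].
(* Badness travels with the box in a sigma type, so that the choice of a bad quarter can be
   iterated. *)
have next (B : {B | good B}) : {B' : {B | good B} | rel (sval B) (sval B')}.
  apply: cid; case: B => -[[[a b] c] d] /= [Xa ab bX [Yc cd dY nPB]].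
  pose mx := (a + b) / 2; pose my := (c + d) / 2.
  have [? ?] : a <= mx /\ mx <= b by rewrite /mx; split; lra.
  have [? ?] : c <= my /\ my <= d by rewrite /my; split; lra.
  have [P1|P1] := pselect (P a mx c my); last first.
    have G : good (a, mx, c, my) by split=> //; [lra|split=> //; lra].
    by exists (exist _ _ G); rewrite /rel /x1 /x2 /y1 /y2 /mx /my /=; split=> //; [lra|split => //; lra].
  have [P2|P2] := pselect (P mx b c my); last first.
    have G : good (mx, b, c, my) by split=> //; [lra|split=> //; lra].
    by exists (exist _ _ G); rewrite /rel /x1 /x2 /y1 /y2 /mx /my /=; split=> //; [lra|split => //; lra].
  have [P3|P3] := pselect (P a mx my d); last first.
    have G : good (a, mx, my, d) by split=> //; [lra|split=> //; lra].
    by exists (exist _ _ G); rewrite /rel /x1 /x2 /y1 /y2 /mx /my /=; split=> //; [lra|split => //; lra].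
  have [P4|P4] := pselect (P mx b my d); last first.
    have G : good (mx, b, my, d) by split=> //; [lra|split=> //; lra].
    by exists (exist _ _ G); rewrite /rel /x1 /x2 /y1 /y2 /mx /my /=; split=> //; [lra|split => //; lra].
  by exfalso; apply/nPB/Psplit.
have G0 : good (X1, X2, Y1, Y2) by split.
pose s n := sval (iter n (fun B => sval (next B)) (exist _ _ G0)).
have sS n : rel (s n) (s n.+1) by rewrite /s /=; exact: (svalP (next _)).
have sG n : [/\ X1 <= x1 (s n), x1 (s n) <= x2 (s n), x2 (s n) <= X2 &
    [/\ Y1 <= y1 (s n), y1 (s n) <= y2 (s n), y2 (s n) <= Y2 &
    ~ P (x1 (s n)) (x2 (s n)) (y1 (s n)) (y2 (s n))]].
  by have := svalP (iter n (fun B => sval (next B)) (exist _ _ G0));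
    rewrite -/(s n) /good; case: (s n) => [[[? ?] ?] ?].
have xw n : x2 (s n) - x1 (s n) = (X2 - X1) / 2 ^+ n.
  elim: n => [|n IH]; first by rewrite expr0 divr1.
  by have [_ _ -> _] := sS n; rewrite IH exprSr invfM mulrA.
have yw n : y2 (s n) - y1 (s n) = (Y2 - Y1) / 2 ^+ n.
  elim: n => [|n IH]; first by rewrite expr0 divr1.
  by have [_ _ _ [_ _ ->]] := sS n; rewrite IH exprSr invfM mulrA.
have [a aP] : exists a, forall n, x1 (s n) <= a <= x2 (s n).
  by apply: nested_intervals => n; [have [] := sS n|have [] := sS n|have [] := sG n].
have [b bP] : exists b, forall n, y1 (s n) <= b <= y2 (s n).
  by apply: nested_intervals => n; [have [_ _ _ []] := sS n|have [_ _ _ []] := sS n|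
    have [_ _ _ []] := sG n].
have [d d0 H] := Ploc a b (aP 0%N) (bP 0%N).
have [N1 HN1] := expr_half_lt (X2 - X1) d0.
have [N2 HN2] := expr_half_lt (Y2 - Y1) d0.
pose n := maxn N1 N2.
have [? _ ? [? _ ? nPn]] := sG n.
have /andP[? ?] := aP n; have /andP[? ?] := bP n.
apply/nPn/H; rewrite ?xw ?yw.
- by apply/andP.
- by apply/andP.
- by apply/andP.
- by apply/andP.
- by apply: HN1; exact: leq_maxl.
- by apply: HN2; exact: leq_maxr.
Qed.

End BoxInduction.

(** * Contour integrals along boundaries of rectangles *)

Section Rectangles.
Context {R : realType}.
Local Notation C := R[i].
Local Notation mu := (@lebesgue_measure R).
Implicit Types (h F : C -> C) (x y : R) (z w : C).

Definition rect x1 x2 y1 y2 : set C :=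
  [set z | x1 <= complex.Re z <= x2 /\ y1 <= complex.Im z <= y2].

(** Continuity of integrands is asked on the boundary alone, because the Cauchy kernel is singular
    inside the rectangle. *)
Definition frame x1 x2 y1 y2 : set C :=
  [set z | rect x1 x2 y1 y2 z /\ [\/ complex.Re z = x1, complex.Re z = x2,
     complex.Im z = y1 | complex.Im z = y2]].

(** The counterclockwise contour integral: bottom, right, top and left side, with [dz = i dt] on the
    vertical ones. *)
Definition rint h x1 x2 y1 y2 : C :=
  cint x1 x2 (fun t => h (t +i* y1)) + 'i * cint y1 y2 (fun t => h (x2 +i* t))
  - cint x1 x2 (fun t => h (t +i* y2)) - 'i * cint y1 y2 (fun t => h (x1 +i* t)).

Lemma cdiff_ccont h z l : cdiff h z l -> ccont h z.
Proof.
move=> hl e e0; have [d d0 H] := hl _ (@ltr01 R).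
have B0 : 0 < 1 + normc l by rewrite ltr_pwDl// normc_ge0.
exists (Num.min d (e / (1 + normc l))).
  by rewrite lt_min d0 divr_gt0.
move=> k; rewrite lt_min => /andP[kd ke].
have -> : h (z + k) - h z = (h (z + k) - h z - l * k) + l * k by rewrite subrK.
apply: le_lt_trans (le_normcD _ _) _.
apply: (@le_lt_trans _ _ ((1 + normc l) * normc k)).
  by rewrite mulrDl normcM lerD2r H.
by rewrite mulrC -ltr_pdivlMr.
Qed.

Lemma ccont_h h x y : ccont h (x +i* y) -> rcont (fun t => h (t +i* y)) x.
Proof.
move=> hc e /hc[d d0 H]; exists d => // k kd.
have -> : (x + k) +i* y = (x +i* y) + k%:C by rewrite /real_complex_def; apply/eqP; rewrite eq_complex/= addr0 !eqxx.
by apply: H; rewrite normc_real.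
Qed.

Lemma normc_i k : normc ('i * k%:C) = `|k| :> R.
Proof.
rewrite normcM normc_real [X in X * _](_ : _ = 1) ?mul1r//.
by rewrite /= expr0n /= add0r expr1n sqrtr1.
Qed.

Lemma ccont_v h x y : ccont h (x +i* y) -> rcont (fun t => h (x +i* t)) y.
Proof.
move=> hc e /hc[d d0 H]; exists d => // k kd.
have -> : x +i* (y + k) = (x +i* y) + 'i * k%:C.
  by apply/eqP; rewrite eq_complex/= !(mulr0,mul0r,mul1r,subr0,addr0,add0r) !eqxx.
by apply: H; rewrite normc_i.
Qed.

Lemma cdiff_h h x y l : cdiff h (x +i* y) l -> rdiff (fun t => h (t +i* y)) x l.
Proof.
move=> hc e /hc[d d0 H]; exists d => // k kd.
have -> : (x + k) +i* y = (x +i* y) + k%:C by apply/eqP; rewrite eq_complex/= addr0 !eqxx.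
by rewrite -(normc_real k); apply: H; rewrite normc_real.
Qed.

Lemma cdiff_v h x y l : cdiff h (x +i* y) l ->
  rdiff (fun t => h (x +i* t)) y ('i * l).
Proof.
move=> hc e /hc[d d0 H]; exists d => // k kd.
have -> : x +i* (y + k) = (x +i* y) + 'i * k%:C.
  by apply/eqP; rewrite eq_complex/= !(mulr0,mul0r,mul1r,subr0,addr0,add0r) !eqxx.
rewrite -(normc_i k) (_ : 'i * l * _ = l * ('i * k%:C)); last by rewrite mulrCA mulrA.
by apply: H; rewrite normc_i.
Qed.

Section RectangleSides.
Variables (h : C -> C) (x1 x2 y1 y2 : R).
Hypotheses (x12 : x1 <= x2) (y12 : y1 <= y2).
Hypothesis hc : forall z, frame x1 x2 y1 y2 z -> ccont h z.

Lemma frame_b t : x1 <= t <= x2 -> frame x1 x2 y1 y2 (t +i* y1).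
Proof. by move=> ?; split; [split; rewrite //= lexx|apply: Or43]. Qed.
Lemma frame_t t : x1 <= t <= x2 -> frame x1 x2 y1 y2 (t +i* y2).
Proof. by move=> ?; split; [split; rewrite //= lexx andbT|apply: Or44]. Qed.
Lemma frame_l t : y1 <= t <= y2 -> frame x1 x2 y1 y2 (x1 +i* t).
Proof. by move=> ?; split; [split; rewrite //= lexx|apply: Or41]. Qed.
Lemma frame_r t : y1 <= t <= y2 -> frame x1 x2 y1 y2 (x2 +i* t).
Proof. by move=> ?; split; [split; rewrite //= lexx andbT|apply: Or42]. Qed.

Lemma seg_cont_b : seg_cont x1 x2 (fun t => h (t +i* y1)).
Proof. by move=> t tx; apply/ccont_h/hc/frame_b. Qed.
Lemma seg_cont_t : seg_cont x1 x2 (fun t => h (t +i* y2)).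
Proof. by move=> t tx; apply/ccont_h/hc/frame_t. Qed.
Lemma seg_cont_l : seg_cont y1 y2 (fun t => h (x1 +i* t)).
Proof. by move=> t tx; apply/ccont_v/hc/frame_l. Qed.
Lemma seg_cont_r : seg_cont y1 y2 (fun t => h (x2 +i* t)).
Proof. by move=> t tx; apply/ccont_v/hc/frame_r. Qed.

Lemma normc_iM z : normc ('i * z) = normc z.
Proof. by rewrite normcM [X in X * _](_ : _ = 1) ?mul1r//= expr0n /= add0r expr1n sqrtr1. Qed.

Lemma rint_bound M : (forall z, frame x1 x2 y1 y2 z -> normc (h z) <= M) ->
  normc (rint h x1 x2 y1 y2) <= 4 * M * ((x2 - x1) + (y2 - y1)).
Proof.
move=> hM; rewrite /rint.
have Bb := cint_bound x12 seg_cont_b (fun t tx => hM _ (frame_b tx)).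
have Bt := cint_bound x12 seg_cont_t (fun t tx => hM _ (frame_t tx)).
have Bl := cint_bound y12 seg_cont_l (fun t tx => hM _ (frame_l tx)).
have Br := cint_bound y12 seg_cont_r (fun t tx => hM _ (frame_r tx)).
set A1 := cint _ _ _ in Bb *; set A2 := cint y1 y2 _ in Br *.
set A3 := cint x1 x2 _ in Bt *; set A4 := cint y1 y2 _ in Bl *.
have H1 := le_normcD (A1 + 'i * A2 - A3) (- ('i * A4)).
have H2 := le_normcD (A1 + 'i * A2) (- A3).
have H3 := le_normcD A1 ('i * A2).
rewrite !normcN !normc_iM in H1 H2 H3.
by nra.
Qed.

Lemma rintZ c : rint (fun z => c * h z) x1 x2 y1 y2 = c * rint h x1 x2 y1 y2.
Proof.
rewrite /rint !cintZ; try solve [exact: seg_cont_b|exact: seg_cont_t|exact: seg_cont_l|exact: seg_cont_r].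
by ring.
Qed.

(** By the fundamental theorem of calculus on each side, every corner value of [H] occurs twice,
    with opposite signs. *)
Lemma rint_primitive H : (forall z, frame x1 x2 y1 y2 z -> cdiff H z (h z)) ->
  rint h x1 x2 y1 y2 = 0.
Proof.
move=> HD; rewrite /rint.
have iS (u : R -> C) a b : seg_cont a b u -> seg_cont a b (fun t => 'i * u t).
  move=> uc t /uc ut e /ut[d d0 Hd]; exists d => // k /Hd.
  by rewrite -mulrBr normc_iM.
rewrite -!cintZ; try solve [exact: seg_cont_b|exact: seg_cont_t|exact: seg_cont_l|exact: seg_cont_r].
rewrite (cint_ftc x12 seg_cont_b (fun t tx => cdiff_h (HD _ (frame_b tx)))).
rewrite (cint_ftc x12 seg_cont_t (fun t tx => cdiff_h (HD _ (frame_t tx)))).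
rewrite (cint_ftc y12 (iS _ _ _ seg_cont_l) (fun t tx => cdiff_v (HD _ (frame_l tx)))).
rewrite (cint_ftc y12 (iS _ _ _ seg_cont_r) (fun t tx => cdiff_v (HD _ (frame_r tx)))).
by ring.
Qed.

End RectangleSides.

Lemma rintD h1 h2 x1 x2 y1 y2 : x1 <= x2 -> y1 <= y2 ->
  (forall z, frame x1 x2 y1 y2 z -> ccont h1 z) ->
  (forall z, frame x1 x2 y1 y2 z -> ccont h2 z) ->
  rint (fun z => h1 z + h2 z) x1 x2 y1 y2 =
  rint h1 x1 x2 y1 y2 + rint h2 x1 x2 y1 y2.
Proof.
move=> x12 y12 c1 c2; rewrite /rint !cintD;
  try solve [exact: seg_cont_b|exact: seg_cont_t|exact: seg_cont_l|exact: seg_cont_r].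
  by ring.
all: by [exact: (seg_cont_b y12 c1)|exact: (seg_cont_b y12 c2)|exact: (seg_cont_t y12 c1)|exact: (seg_cont_t y12 c2)|exact: (seg_cont_l x12 c1)|exact: (seg_cont_l x12 c2)|exact: (seg_cont_r x12 c1)|exact: (seg_cont_r x12 c2)].
Qed.

Lemma eq_rint h1 h2 x1 x2 y1 y2 : x1 <= x2 -> y1 <= y2 ->
  (forall z, frame x1 x2 y1 y2 z -> h1 z = h2 z) ->
  rint h1 x1 x2 y1 y2 = rint h2 x1 x2 y1 y2.
Proof.
move=> x12 y12 E; rewrite /rint; congr (_ + 'i * _ - _ - 'i * _);
  apply: eq_cint => t tx; apply/E.
- exact: frame_b.
- exact: frame_r.
- exact: frame_t.
- exact: frame_l.
Qed.

Lemma rint_splitx h x1 m x2 y1 y2 : x1 <= m <= x2 -> y1 <= y2 ->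
  (forall z, frame x1 x2 y1 y2 z -> ccont h z) ->
  rint h x1 x2 y1 y2 = rint h x1 m y1 y2 + rint h m x2 y1 y2.
Proof.
move=> xm y12 hc; rewrite /rint (cint_split xm (seg_cont_b y12 hc))//.
by rewrite (cint_split xm (seg_cont_t y12 hc))//; ring.
Qed.

Lemma rint_splity h x1 x2 y1 m y2 : x1 <= x2 -> y1 <= m <= y2 ->
  (forall z, frame x1 x2 y1 y2 z -> ccont h z) ->
  rint h x1 x2 y1 y2 = rint h x1 x2 y1 m + rint h x1 x2 m y2.
Proof.
move=> x12 ym hc; rewrite /rint (cint_split ym (seg_cont_l x12 hc))//.
by rewrite (cint_split ym (seg_cont_r x12 hc))//; ring.
Qed.

Lemma rectS x1 x2 y1 y2 a1 a2 b1 b2 : x1 <= a1 -> a2 <= x2 -> y1 <= b1 -> b2 <= y2 ->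
  rect a1 a2 b1 b2 `<=` rect x1 x2 y1 y2.
Proof.
move=> ? ? ? ? z [/andP[? ?] /andP[? ?]]; split; apply/andP; split; lra.
Qed.

End Rectangles.

(** * Goursat's theorem and deformation of rectangles *)

Section Goursat.
Context {R : realType}.
Local Notation C := R[i].
Local Notation mu := (@lebesgue_measure R).
Implicit Types (h F : C -> C) (x y : R) (z w : C).

(** Derivatives computed by hand come with a quadratic remainder bound. The constant [B] may have
    any sign, whence [|B| + 1] in the choice of the radius. *)
Lemma cdiff_quad F z l d B : 0 < d -> (forall k, normc k < d ->
    normc (F (z + k) - F z - l * k) <= B * normc k ^+ 2) -> cdiff F z l.
Proof.
move=> d0 H e e0; have B0 : 0 < `|B| + 1 by rewrite ltr_wpDl.
exists (Num.min d (e / (`|B| + 1))); first by rewrite lt_min d0 divr_gt0.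
move=> k; rewrite lt_min => /andP[kd]; rewrite ltr_pdivlMr// => ke.
apply: le_trans (H _ kd) _; rewrite expr2 mulrA ler_wpM2r ?normc_ge0//.
apply: le_trans (ltW ke); rewrite mulrC ler_wpM2l ?normc_ge0//.
by rewrite (le_trans (ler_norm _))// lerDl.
Qed.

Lemma ccontD F1 F2 z : ccont F1 z -> ccont F2 z -> ccont (fun w => F1 w + F2 w) z.
Proof.
move=> c1 c2 e e0; have e2 : 0 < e / 2 by rewrite divr_gt0.
have [d1 d10 H1] := c1 _ e2; have [d2 d20 H2] := c2 _ e2.
exists (Num.min d1 d2); first by rewrite lt_min d10.
move=> k; rewrite lt_min => /andP[/H1 k1 /H2 k2].
have -> : F1 (z + k) + F2 (z + k) - (F1 z + F2 z) =
  (F1 (z + k) - F1 z) + (F2 (z + k) - F2 z) by ring.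
by apply: le_lt_trans (le_normcD _ _) _; lra.
Qed.

Lemma ccontZ c F z : ccont F z -> ccont (fun w => c * F w) z.
Proof.
move=> cF e e0; have c0 : 0 < normc c + 1 by rewrite ltr_wpDl// normc_ge0.
have [d d0 H] := cF _ (divr_gt0 e0 c0).
exists d => // k /H; rewrite -mulrBr normcM ltr_pdivlMr// => Hk.
apply: le_lt_trans Hk; rewrite mulrC ler_wpM2l ?normc_ge0//.
by rewrite lerDl.
Qed.

Lemma ccontM F1 F2 z : ccont F1 z -> ccont F2 z -> ccont (fun w => F1 w * F2 w) z.
Proof.
move=> c1 c2 e e0.
have n1 : 0 < normc (F1 z) + normc (F2 z) + 1.
  by rewrite ltr_wpDl// addr_ge0// normc_ge0.
pose e' := Num.min 1 (e / 2 / (normc (F1 z) + normc (F2 z) + 1)).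
have e'0 : 0 < e' by rewrite lt_min ltr01 divr_gt0// divr_gt0.
have e'1 : e' <= 1 by rewrite ge_min lexx.
have e'2 : e' * (normc (F1 z) + normc (F2 z) + 1) <= e / 2.
  by rewrite -ler_pdivlMr// ge_min lexx orbT.
have [d1 d10 H1] := c1 _ e'0; have [d2 d20 H2] := c2 _ e'0.
exists (Num.min d1 d2); first by rewrite lt_min d10.
move=> k; rewrite lt_min => /andP[/H1 k1 /H2 k2].
have -> : F1 (z + k) * F2 (z + k) - F1 z * F2 z =
  (F1 (z + k) - F1 z) * (F2 (z + k) - F2 z) +
  (F1 z * (F2 (z + k) - F2 z) + (F1 (z + k) - F1 z) * F2 z) by ring.
apply: le_lt_trans (le_normcD _ _) _; rewrite normcM.
have := le_normcD (F1 z * (F2 (z + k) - F2 z)) ((F1 (z + k) - F1 z) * F2 z).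
rewrite !normcM.
move: (normc_ge0 (F1 z)) (normc_ge0 (F2 z)) (normc_ge0 (F1 (z + k) - F1 z))
 (normc_ge0 (F2 (z + k) - F2 z)) => p1 p2 p3 p4 H.
nra.
Qed.

Lemma cdiff_affine_primitive (c0 l c z : C) :
  cdiff (fun w => c0 * w + l / 2 * (w - c) ^+ 2) z (c0 + l * (z - c)).
Proof.
apply: (@cdiff_quad _ _ _ 1 (normc (l / 2))) => // k _.
rewrite -normcX -normcM le_eqVlt; apply/orP; left; apply/eqP; congr normc.
by field.
Qed.

Lemma ccont_affine (c0 l c z : C) : ccont (fun w => c0 + l * (w - c)) z.
Proof.
apply: (@cdiff_ccont _ _ _ l); apply: (@cdiff_quad _ _ _ 1 0) => // k _.
by rewrite mul0r [X in normc X](_ : _ = 0) ?normc0//; ring.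
Qed.

(** An affine function has an explicit quadratic primitive; this case of Cauchy's theorem is the
    local input to Goursat's. *)
Lemma rint_affine (c0 l c : C) x1 x2 y1 y2 : x1 <= x2 -> y1 <= y2 ->
  rint (fun w => c0 + l * (w - c)) x1 x2 y1 y2 = 0.
Proof.
move=> x12 y12; apply: (rint_primitive x12 y12).
  by move=> z _; exact: ccont_affine.
by move=> z _; exact: cdiff_affine_primitive.
Qed.

Lemma normc_rect_le x1 x2 y1 y2 z w : rect x1 x2 y1 y2 z -> rect x1 x2 y1 y2 w ->
  normc (z - w) <= (x2 - x1) + (y2 - y1).
Proof.
move=> [/andP[? ?] /andP[? ?]] [/andP[? ?] /andP[? ?]].
apply: le_trans (normc_le_ReIm _) _; rewrite !raddfB/=.
by apply: lerD; rewrite ler_norml; apply/andP; split; lra.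
Qed.

(** The bound [e * (width^2 + height^2)] is proved for each [e > 0] by bisection. Near a point [c]
    the affine part of [h] integrates to zero, and the rest is at most a small multiple of
    [|z - c|]. *)
Lemma goursat h x1 x2 y1 y2 : x1 <= x2 -> y1 <= y2 ->
  (forall z, rect x1 x2 y1 y2 z -> exists l, cdiff h z l) ->
  rint h x1 x2 y1 y2 = 0.
Proof.
move=> x12 y12 hd.
have hc z : rect x1 x2 y1 y2 z -> ccont h z by move=> /hd[l /cdiff_ccont].
suff H e : 0 < e -> normc (rint h x1 x2 y1 y2) <= e * ((x2 - x1) ^+ 2 + (y2 - y1) ^+ 2).
  apply: eq0_normc; apply/eqP; rewrite eq_le normc_ge0 andbT.
  apply/ler_addgt0Pr => e e0; rewrite add0r.
  have S0 : 0 < (x2 - x1) ^+ 2 + (y2 - y1) ^+ 2 + 1.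
    by rewrite ltr_wpDl// addr_ge0// sqr_ge0.
  apply: le_trans (H _ (divr_gt0 e0 S0)) _.
  by rewrite mulrAC ler_pdivrMr// ler_wpM2l ?lerDl// ltW.
move=> e0.
(* The right-hand side is additive when a box is cut into four equal quarters, which makes the bound
   pass from the quarters to the box. *)
pose P a1 a2 b1 b2 := normc (rint h a1 a2 b1 b2) <= e * ((a2 - a1) ^+ 2 + (b2 - b1) ^+ 2).
apply: (@box_induction _ P) => //.
  move=> a1 a2 b1 b2 xa a12 ax yb b12 by_ mx my.
  have [? ?] : a1 <= mx /\ mx <= a2 by rewrite /mx; split; lra.
  have [? ?] : b1 <= my /\ my <= b2 by rewrite /my; split; lra.
  rewrite /P => P1 P2 P3 P4.
  rewrite (@rint_splity _ _ _ _ _ my)//; last 2 first.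
  - by apply/andP.
  - by move=> z [zr _]; apply/hc/(rectS _ _ _ _ zr).
  rewrite !(@rint_splitx _ h a1 mx a2)//; last first.
  - by move=> z [zr _]; apply/hc/(rectS _ _ _ _ zr) => //; lra.
  - by apply/andP.
  - by move=> z [zr _]; apply/hc/(rectS _ _ _ _ zr) => //; lra.
  - by apply/andP.
  have -> : e * ((a2 - a1) ^+ 2 + (b2 - b1) ^+ 2) =
   (e * ((mx - a1) ^+ 2 + (my - b1) ^+ 2) + e * ((a2 - mx) ^+ 2 + (my - b1) ^+ 2)) +
   (e * ((mx - a1) ^+ 2 + (b2 - my) ^+ 2) + e * ((a2 - mx) ^+ 2 + (b2 - my) ^+ 2)).
    by rewrite /mx /my; field.
  apply: le_trans (le_normcD _ _) _; apply: lerD;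
    apply: le_trans (le_normcD _ _) _; exact: lerD.
move=> a b xab yab.
have rc : rect x1 x2 y1 y2 (a +i* b) by [].
have [l hl] := hd _ rc.
(* With [s] the sum of the two sides, the boundary estimate gives
   [4 * (e / 8 * s) * s = e * s^2 / 2], and [s^2 / 2] is at most the sum of the squared sides. *)
have e8 : 0 < e / 8 by rewrite divr_gt0.
have [d d0 Hd] := hl _ e8.
exists (d / 2); first by rewrite divr_gt0.
move=> a1 a2 b1 b2 /andP[? a1a] /andP[aa2 ?] /andP[? b1b] /andP[bb2 ?] da db.
have a12 := le_trans a1a aa2; have b12 := le_trans b1b bb2.
pose c := a +i* b.
have cr : rect a1 a2 b1 b2 c by split; apply/andP.
have affc z : ccont (fun w => h c + l * (w - c)) z by exact: ccont_affine.
have hfc z : frame a1 a2 b1 b2 z -> ccont h z.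
  by move=> [zr _]; apply/hc/(rectS _ _ _ _ zr).
have remc z : frame a1 a2 b1 b2 z -> ccont (fun w => h w + (-1) * (h c + l * (w - c))) z.
  by move=> fz; apply: ccontD; [exact: hfc|exact: ccontZ].
rewrite /P (@eq_rint _ _ (fun w => (h w + (-1) * (h c + l * (w - c))) + (h c + l * (w - c))))//; last first.
  by move=> z _; ring.
rewrite rintD// rint_affine// addr0.
pose s := (a2 - a1) + (b2 - b1).
apply: (@le_trans _ _ (4 * (e / 8 * s) * s)); last first.
  have -> : 4 * (e / 8 * s) * s = e * (s ^+ 2 / 2) by field.
  rewrite ler_pM2l// -subr_ge0.
  have -> : (a2 - a1) ^+ 2 + (b2 - b1) ^+ 2 - s ^+ 2 / 2 =
    ((a2 - a1) - (b2 - b1)) ^+ 2 / 2 by rewrite /s; field.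
  by rewrite divr_ge0 ?sqr_ge0.
apply: rint_bound => // z [zr _].
have zs : normc (z - c) <= s by exact: normc_rect_le.
have zd : normc (z - c) < d by apply: le_lt_trans zs _; rewrite /s; lra.
apply: (@le_trans _ _ (e / 8 * normc (z - c))); last by rewrite ler_pM2l.
have := Hd _ zd; rewrite (addrC (a +i* b)) subrK -/c.
by rewrite mulN1r opprD addrA.
Qed.

(** The left and right strips are cut off over the full height, then the pieces below and above the
    inner rectangle; Goursat's theorem applies to these four. *)
Lemma rint_deform h X1 X2 Y1 Y2 x1 x2 y1 y2 :
  X1 <= x1 -> x1 <= x2 -> x2 <= X2 -> Y1 <= y1 -> y1 <= y2 -> y2 <= Y2 ->
  (forall z, rect X1 X2 Y1 Y2 z ->
    ~ (x1 < complex.Re z < x2 /\ y1 < complex.Im z < y2) -> exists l, cdiff h z l) ->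
  rint h X1 X2 Y1 Y2 = rint h x1 x2 y1 y2.
Proof.
move=> Xx x12 xX Yy y12 yY hd.
have hc z : rect X1 X2 Y1 Y2 z ->
    ~ (x1 < complex.Re z < x2 /\ y1 < complex.Im z < y2) -> ccont h z.
  by move=> zr /(hd _ zr)[l /cdiff_ccont].
(* All cuts lie on lines carrying sides of the inner rectangle, so no boundary of a piece enters its
   interior, where [h] may be singular. *)
have fR a1 a2 b1 b2 z : X1 <= a1 -> a2 <= X2 -> Y1 <= b1 -> b2 <= Y2 ->
    (a1 <= x1 \/ x2 <= a1) -> (a2 <= x1 \/ x2 <= a2) ->
    (b1 <= y1 \/ y2 <= b1) -> (b2 <= y1 \/ y2 <= b2) ->
    frame a1 a2 b1 b2 z -> ccont h z.
  move=> ? ? ? ? H1 H2 H3 H4 [zr zf]; apply: hc; first exact: rectS zr.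
  by move=> [/andP[? ?] /andP[? ?]]; case: zf => E; lra.
rewrite (@rint_splitx _ _ _ x1)//; [|by apply/andP; split; lra|lra|
  by move=> z; apply: fR; lra].
rewrite (@rint_splitx _ _ x1 x2)//; [|by apply/andP; split; lra|lra|
  by move=> z; apply: fR; lra].
rewrite (@rint_splity _ _ x1 x2 _ y1)//; [|by apply/andP; split; lra|
  by move=> z; apply: fR; lra].
rewrite (@rint_splity _ _ x1 x2 y1 y2)//; [|by apply/andP; split; lra|
  by move=> z; apply: fR; lra].
rewrite (@goursat _ X1 x1)//; [|lra|]; last first.
  move=> z zr; apply: hd; first by apply: (rectS _ _ _ _ zr) => //; lra.
  by case: zr => /andP[? ?] _ [/andP[? ?] _]; lra.
rewrite (@goursat _ x2 X2)//; [|lra|]; last first.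
  move=> z zr; apply: hd; first by apply: (rectS _ _ _ _ zr) => //; lra.
  by case: zr => /andP[? ?] _ [/andP[? ?] _]; lra.
rewrite (@goursat _ x1 x2 Y1 y1)//; last first.
  move=> z zr; apply: hd; first by apply: (rectS _ _ _ _ zr) => //; lra.
  by case: zr => _ /andP[? ?] [_ /andP[? ?]]; lra.
rewrite (@goursat _ x1 x2 y2 Y2)//; last first.
  move=> z zr; apply: hd; first by apply: (rectS _ _ _ _ zr) => //; lra.
  by case: zr => _ /andP[? ?] [_ /andP[? ?]]; lra.
by rewrite !add0r !addr0.
Qed.

End Goursat.

(** * Winding number of a square and Cauchy's formula *)

Section RectangleCauchyFormula.
Context {R : realType}.
Local Notation C := R[i].
Local Notation mu := (@lebesgue_measure R).
Implicit Types (h F : C -> C) (x y : R) (z w : C).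

Lemma cdiffM F G z l m : cdiff F z l -> cdiff G z m ->
  cdiff (fun w => F w * G w) z (F z * m + l * G z).
Proof.
move=> /cdiff_is_derive Fl /cdiff_is_derive Gm.
have := is_derive_cdiff (@is_deriveM _ _ _ _ _ _ _ _ Fl Gm).
by rewrite /GRing.scale/= (mulrC (G z)).
Qed.

(** The remainder equals [k^2 / ((u + k) u^2)], and [|u + k| >= |u| / 2] on the chosen ball. *)
Lemma cdiff_inv (u : C) : u != 0 -> cdiff (fun w => w^-1) u (- u ^- 2).
Proof.
move=> u0; have nu : 0 < normc u by rewrite normc_gt0.
apply: (@cdiff_quad _ _ _ _ (normc u / 2) (2 / normc u ^+ 3)).
  by rewrite divr_gt0.
move=> k kd.
have nuk : normc u / 2 <= normc (u + k).
  have := ler_normcB u (- k); rewrite normcN opprK; lra.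
have uk0 : u + k != 0.
  by rewrite -normc_gt0 (lt_le_trans _ nuk)// divr_gt0.
have -> : (u + k)^-1 - u^-1 - - u ^- 2 * k = k ^+ 2 * ((u + k)^-1 * u ^- 2).
  by field; rewrite uk0 u0.
rewrite normcM normcX mulrC ler_wpM2r ?sqr_ge0// normcM !normcV normcX.
have -> : 2 / normc u ^+ 3 = (normc u / 2)^-1 * normc u ^- 2.
  by field; rewrite gt_eqF.
rewrite ler_wpM2r ?invr_ge0 ?exprn_ge0 ?normc_ge0//.
by rewrite lef_pV2 ?posrE ?divr_gt0// normc_gt0.
Qed.

Lemma cdiff_shift F z c l : cdiff F (z - c) l -> cdiff (fun w => F (w - c)) z l.
Proof.
move=> H e e0; have [d d0 Hd] := H _ e0; exists d => // k kd.
by rewrite (_ : z + k - c = z - c + k); [exact: Hd|ring].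
Qed.

Lemma cdiff_cauchy_kernel z w : w != z ->
  cdiff (fun v => (v - z)^-1) w (- (w - z) ^- 2).
Proof.
by move=> wz; apply: cdiff_shift; apply: cdiff_inv; rewrite subr_eq0.
Qed.

(** The primitive is an arctangent. The formula gives the winding number of a square and, later, the
    mass of the kernels [poisson]. *)
Lemma Rintegral_poisson (c r lo hi : R) : 0 < r -> lo <= hi ->
  \int[mu]_(t in `[lo, hi]) (r / ((t - c) ^+ 2 + r ^+ 2)) =
  atan ((hi - c) / r) - atan ((lo - c) / r).
Proof.
move=> r0 lohi.
have rc (t : R) : (t - c) ^+ 2 + r ^+ 2 != 0.
  by rewrite gt_eqF// ltr_wpDl ?sqr_ge0// exprn_gt0.
apply: (@Rintegral_ftc _ _ (fun t => atan ((t - c) / r))) => //.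
- move=> t _; apply: continuousM; first exact: cst_continuous.
  apply: continuousV => //; apply: differentiable_continuous.
  by apply/derivable1_diffP.
- move=> t _.
  have D : is_derive t 1 (fun t => (t - c) / r) r^-1.
    by apply: is_derive_eq; rewrite /GRing.scale/=; ring.
  have := @is_derive1_comp _ atan (fun t => (t - c) / r) t _ _ (is_derive1_atan _) D.
  congr (is_derive _ _ _ _); field.
  by rewrite rc gt_eqF.
Qed.

(** On a square centred at [z] opposite sides can be paired. The real parts of the kernel combine to
    zero, and each pair contributes [i] times an arctangent integral equal to [pi]. *)
Lemma rint_inv (z : C) (r : R) : 0 < r ->
  rint (fun w => (w - z)^-1) (complex.Re z - r) (complex.Re z + r)
    (complex.Im z - r) (complex.Im z + r) = 0 +i* (2 * pi).
Proof.
case: z => a b /= r0.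
have ab : a - r <= a + r by lra.
have bb : b - r <= b + r by lra.
pose f c t := 2 * (r / ((t - c) ^+ 2 + r ^+ 2)).
have fI c : \int[mu]_(t in `[c - r, c + r]) f c t = pi.
  rewrite RintegralZl//.
    rewrite Rintegral_poisson//; last by lra.
    have -> : (c + r - c) / r = 1 by rewrite addrAC subrr add0r divff// gt_eqF.
    have -> : (c - r - c) / r = - 1.
      by rewrite addrAC subrr add0r mulNr divff// gt_eqF.
    by rewrite atanN atan1; field.
  apply: (@continuous_segment_integrable _ (fun t => r / ((t - c) ^+ 2 + r ^+ 2))) => t _.
  apply: continuousM; first exact: cst_continuous.
  apply: continuousV; first by rewrite gt_eqF// ltr_wpDl ?sqr_ge0// exprn_gt0.
  by apply: differentiable_continuous; apply/derivable1_diffP.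
have kc w : frame (a - r) (a + r) (b - r) (b + r) w -> ccont (fun v => (v - (a +i* b))^-1) w.
  move=> [_ fw]; apply: cdiff_ccont; apply: cdiff_cauchy_kernel.
  by apply/eqP => E; move: fw; rewrite E /=; case; lra.
have nkc w : frame (a - r) (a + r) (b - r) (b + r) w -> ccont (fun v => -1 * (v - (a +i* b))^-1) w.
  by move=> /kc; exact: ccontZ.
have D0 (s : R) : s ^+ 2 + r ^+ 2 != 0.
  by rewrite gt_eqF// ltr_wpDl ?sqr_ge0// exprn_gt0.
have D1 (s : R) : r ^+ 2 + s ^+ 2 != 0 by rewrite addrC.
rewrite /rint.
have -> (A B D E : C) : A + 'i * B - D - 'i * E = (A + -1 * D) + 'i * (B + -1 * E) by ring.
rewrite -!cintZ; [|exact: (seg_cont_l ab kc)|exact: (seg_cont_t bb kc)].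
rewrite -(cintD (seg_cont_b bb kc) (seg_cont_t bb nkc)).
rewrite -(cintD (seg_cont_r ab kc) (seg_cont_l ab nkc)).
rewrite (@eq_cint _ (a - r) _ _ (fun t => 0 +i* f a t)); last first.
  move=> t _; apply/eqP; rewrite eq_complex /=; apply/andP; split; apply/eqP.
    have -> : b - r - b = - r by ring.
    have -> : b + r - b = r by ring.
    by rewrite sqrrN; field; exact: D0.
  have -> : b - r - b = - r by ring.
  have -> : b + r - b = r by ring.
  by rewrite /f sqrrN; field; exact: D0.
rewrite (@eq_cint _ (b - r) _ _ (fun t => f b t +i* 0)); last first.
  move=> t _; apply/eqP; rewrite eq_complex /=; apply/andP; split; apply/eqP.
    have -> : a - r - a = - r by ring.
    have -> : a + r - a = r by ring.
    by rewrite /f sqrrN; field; rewrite ?D0 ?D1.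
  have -> : a - r - a = - r by ring.
  have -> : a + r - a = r by ring.
  by rewrite sqrrN; field; rewrite ?D0 ?D1.
have Z (c : R) : \int[mu]_(t in `[c - r, c + r]) (0 : R) = 0.
  by rewrite Rintegral_cst ?mul0r.
rewrite /cint /= !fI !Z.
by apply/eqP; rewrite eq_complex /=; apply/andP; split; apply/eqP; ring.
Qed.

Lemma normc_lipschitz_at F z l : cdiff F z l ->
  exists2 d, 0 < d & forall w, normc (w - z) < d ->
    normc (F w - F z) <= (normc l + 1) * normc (w - z).
Proof.
move=> /(_ _ ltr01)[d d0 H]; exists d => // w /H.
rewrite subrKC mul1r => Hw.
have -> : F w - F z = (F w - F z - l * (w - z)) + l * (w - z) by ring.
by apply: le_trans (le_normcD _ _) _; rewrite normcM; lra.
Qed.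

(** The contour is deformed to a small square about [z]. There [F w / (w - z)] is [F z / (w - z)],
    integrated by [rint_inv], plus a difference quotient that stays bounded while the perimeter
    tends to zero. *)
Lemma cauchy_formula F X1 X2 Y1 Y2 z :
  X1 < complex.Re z < X2 -> Y1 < complex.Im z < Y2 ->
  (forall w, rect X1 X2 Y1 Y2 w -> exists l, cdiff F w l) ->
  rint (fun w => F w * (w - z)^-1) X1 X2 Y1 Y2 = F z * (0 +i* (2 * pi)).
Proof.
move=> /andP[Xz zX] /andP[Yz zY] Fd.
have zr : rect X1 X2 Y1 Y2 z by split; apply/andP; split; exact: ltW.
have [l Fl] := Fd _ zr.
have [d d0 Fz] := normc_lipschitz_at Fl.
pose B := normc l + 1.
have B0 : 0 < B by rewrite /B ltr_wpDl// normc_ge0.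
apply/eqP; rewrite -subr_eq0; apply/eqP/eq0_normc/eqP.
rewrite eq_le normc_ge0 andbT; apply/ler_addgt0Pr => e e0; rewrite add0r.
set a := complex.Re z in Xz zX; set b := complex.Im z in Yz zY.
(* [d / 4] keeps the small square inside the ball of the Lipschitz bound at [z], [e / (16 * B)]
   makes the error [4 * B * 4 r] at most [e], and the remaining terms keep the square inside the
   rectangle. *)
pose r := Num.min (Num.min (d / 4) (e / (16 * B)))
  (Num.min (Num.min (a - X1) (X2 - a)) (Num.min (b - Y1) (Y2 - b))).
have r0 : 0 < r by rewrite !lt_min !subr_gt0 Xz zX Yz zY !divr_gt0// mulr_gt0.
have rd : r <= d / 4 by rewrite /r !ge_min lexx.
have re : r <= e / (16 * B) by rewrite /r !ge_min lexx orbT.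
have [rX1 rX2] : r <= a - X1 /\ r <= X2 - a by rewrite /r !ge_min !lexx !orbT.
have [rY1 rY2] : r <= b - Y1 /\ r <= Y2 - b by rewrite /r !ge_min !lexx !orbT.
have wz w : rect X1 X2 Y1 Y2 w ->
   ~ (a - r < complex.Re w < a + r /\ b - r < complex.Im w < b + r) -> w != z.
  move=> _ nw; apply/eqP => E; apply: nw; rewrite E -/a -/b.
  by split; apply/andP; split; lra.
rewrite (@rint_deform _ _ _ _ _ _ (a - r) (a + r) (b - r) (b + r)); try lra; last first.
  move=> w wr nw; have [m Fm] := Fd _ wr.
  by eexists; apply: cdiffM Fm (cdiff_cauchy_kernel (wz _ wr nw)).
have frw w : frame (a - r) (a + r) (b - r) (b + r) w ->
    rect X1 X2 Y1 Y2 w /\ ~ (a - r < complex.Re w < a + r /\ b - r < complex.Im w < b + r).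
  move=> [wr fw]; split; first by apply: (rectS _ _ _ _ wr); lra.
  by move=> [/andP[? ?] /andP[? ?]]; case: fw; lra.
have kc w : frame (a - r) (a + r) (b - r) (b + r) w -> ccont (fun w => (w - z)^-1) w.
  by move=> /frw[wr /(wz _ wr) nz]; apply: cdiff_ccont (cdiff_cauchy_kernel nz).
have ab : a - r <= a + r by lra.
have bb : b - r <= b + r by lra.
pose Fk w := (F w + -1 * F z) * (w - z)^-1.
have Fkc w : frame (a - r) (a + r) (b - r) (b + r) w -> ccont Fk w.
  move=> fw; apply: ccontM (kc _ fw); apply: ccontD.
    by have [wr _] := frw _ fw; have [m /cdiff_ccont] := Fd _ wr.
  by move=> e1 e10; exists 1 => // k _; rewrite subrr normc0.
rewrite (@eq_rint _ _ (fun w => Fk w + F z * (w - z)^-1))//; last first.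
  by move=> w _; rewrite /Fk; ring.
rewrite rintD//; last by move=> w /kc; exact: ccontZ.
rewrite (rintZ ab bb kc) rint_inv// addrK.
apply: (@le_trans _ _ (4 * B * ((a + r - (a - r)) + (b + r - (b - r))))).
  apply: rint_bound => // w fw.
  have [wr nw] := frw _ fw; have /(_ wr nw) nz := wz w.
  have n0 : 0 < normc (w - z) by rewrite normc_gt0 subr_eq0.
  rewrite /Fk normcM normcV ler_pdivrMr// mulN1r; apply: Fz.
  apply: le_lt_trans (normc_le_ReIm _) _; rewrite !raddfB/= -/a -/b.
  have [[/andP[? ?] /andP[? ?]] _] := fw.
  have : `|complex.Re w - a| <= r by rewrite ler_norml; apply/andP; split; lra.
  have : `|complex.Im w - b| <= r by rewrite ler_norml; apply/andP; split; lra.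
  by lra.
have -> : 4 * B * ((a + r - (a - r)) + (b + r - (b - r))) = r * (16 * B) by ring.
by rewrite -ler_pdivlMr// mulr_gt0.
Qed.

End RectangleCauchyFormula.

(** * Local bounds and differentiability of the derivative *)

Section Regularity.
Context {R : realType}.
Local Notation C := R[i].
Implicit Types (h F : C -> C) (x y : R) (z w : C).

(** Bisection for the property of being bounded on the part of a box that lies in the closed disc. A
    centre outside the closed disc has a small box missing it, where the property is vacuous. *)
Lemma disc_bounded F (rho : R) : (forall w, normc w <= rho -> ccont F w) ->
  exists M, forall w, normc w <= rho -> normc (F w) <= M.
Proof.
move=> Fc; have [rho0|rho0] := ltP rho 0.
  by exists 0 => w /le_lt_trans /(_ rho0); rewrite ltNge normc_ge0.
pose P x1 x2 y1 y2 := exists M, forall w, rect x1 x2 y1 y2 w ->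
  normc w <= rho -> normc (F w) <= M.
have : P (- rho) rho (- rho) rho.
  apply: box_induction; try lra.
    move=> x1 x2 y1 y2 _ x12 _ _ y12 _ mx my [M1 H1] [M2 H2] [M3 H3] [M4 H4].
    exists (Num.max (Num.max M1 M2) (Num.max M3 M4)) => w [/andP[? ?] /andP[? ?]] wr.
    rewrite !le_max.
    have [xm|xm] := leP (complex.Re w) mx; have [ym|ym] := leP (complex.Im w) my.
    - by rewrite H1//; split; apply/andP; split; lra.
    - by rewrite H3 ?orbT//; split; apply/andP; split; lra.
    - by rewrite H2 ?orbT//; split; apply/andP; split; lra.
    - by rewrite H4 ?orbT//; split; apply/andP; split; lra.
  move=> a b _ _; pose c := a +i* b.
  have [cr|cr] := leP (normc c) rho.
    have [d d0 Hd] := Fc _ cr _ ltr01.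
    exists (d / 2); first by rewrite divr_gt0.
    move=> x1 x2 y1 y2 /andP[_ ?] /andP[? _] /andP[_ ?] /andP[? _] xd yd.
    exists (normc (F c) + 1) => w wr _.
    have cR : rect x1 x2 y1 y2 c by split; apply/andP.
    have wc := normc_rect_le wr cR.
    have /ltW : normc (F (c + (w - c)) - F c) < 1.
      by apply: Hd; apply: le_lt_trans wc _; lra.
    rewrite subrKC; have := ler_normcB (F w) (F c); lra.
  exists ((normc c - rho) / 2); first by rewrite divr_gt0// subr_gt0.
  move=> x1 x2 y1 y2 /andP[_ ?] /andP[? _] /andP[_ ?] /andP[? _] xd yd.
  exists 0 => w wr wrho.
  have cR : rect x1 x2 y1 y2 c by split; apply/andP.
  have wc := normc_rect_le wr cR.
  have := ler_normcB c w; rewrite normcB; lra.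
case=> M HM; exists M => w wr; apply: HM => //.
have := normc_Re w; have := normc_Im w; rewrite !ler_norml => /andP[? ?] /andP[? ?].
by split; apply/andP; split; lra.
Qed.

Definition square z d := rect (complex.Re z - d) (complex.Re z + d)
  (complex.Im z - d) (complex.Im z + d).

Definition sframe z d := frame (complex.Re z - d) (complex.Re z + d)
  (complex.Im z - d) (complex.Im z + d).

Definition sint h z d := rint h (complex.Re z - d) (complex.Re z + d)
  (complex.Im z - d) (complex.Im z + d).

Lemma squareP z d w : square z d w <->
  `|complex.Re (w - z)| <= d /\ `|complex.Im (w - z)| <= d.
Proof.
rewrite !raddfB/= !ler_norml; split=> -[/andP[? ?] /andP[? ?]];
  by split; apply/andP; split; lra.
Qed.

Lemma square_normc z d w : square z d w -> normc (w - z) <= 2 * d.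
Proof. by move=> /squareP[? ?]; apply: le_trans (normc_le_ReIm _) _; lra. Qed.

Lemma normc_square z d w : normc (w - z) <= d -> square z d w.
Proof.
by move=> h; apply/squareP; split;
  [apply: le_trans (normc_Re _) h|apply: le_trans (normc_Im _) h].
Qed.

Lemma sframe_normc z d w : 0 <= d -> sframe z d w -> d <= normc (w - z).
Proof.
move=> d0 [_ fw].
have [E|E] : `|complex.Re (w - z)| = d \/ `|complex.Im (w - z)| = d.
  rewrite !raddfB/=; case: fw => ->; [left|left|right|right].
  - by rewrite addrAC subrr add0r normrN ger0_norm.
  - by rewrite addrAC subrr add0r ger0_norm.
  - by rewrite addrAC subrr add0r normrN ger0_norm.
  - by rewrite addrAC subrr add0r ger0_norm.
- by rewrite -{1}E; exact: normc_Re.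
- by rewrite -{1}E; exact: normc_Im.
Qed.

Let tpi : C := 0 +i* (2 * pi).

Lemma normc_tpi : normc tpi = 2 * pi.
Proof.
rewrite /= expr0n /= add0r sqrtr_sqr ger0_norm//.
by rewrite mulr_ge0// pi_ge0.
Qed.

Lemma normc_tpiV : normc (tpi^-1) <= 1.
Proof.
rewrite normcV normc_tpi invf_le1 ?mulr_gt0 ?pi_gt0//.
by have := pi_ge2 R; lra.
Qed.

Lemma tpi0 : tpi != 0.
Proof. by rewrite -normc_gt0 normc_tpi mulr_gt0// pi_gt0. Qed.

Section SquareCauchyIntegral.
Variables (F : C -> C) (zeta : C) (d M : R).
Hypotheses (d0 : 0 < d) (Fd : forall w, square zeta d w -> exists l, cdiff F w l)
  (FM : forall w, square zeta d w -> normc (F w) <= M).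

Let Fc w : sframe zeta d w -> ccont F w.
Proof. by move=> [/Fd[l /cdiff_ccont]]. Qed.

Let ab : complex.Re zeta - d <= complex.Re zeta + d.
Proof. by move: d0 => ?; lra. Qed.
Let bb : complex.Im zeta - d <= complex.Im zeta + d.
Proof. by move: d0 => ?; lra. Qed.

(** Differentiation of a Cauchy integral in its parameter reduces to a uniform estimate of the
    remainder of the kernel along the contour. It is applied to the first and then to the second
    power of the kernel. *)
Lemma sint_kernel_diff (A B D : C -> C) k E :
  (forall w, sframe zeta d w -> [/\ ccont A w, ccont B w & ccont D w]) ->
  (forall w, sframe zeta d w -> normc (A w - B w - k * D w) <= E) ->
  normc (sint (fun w => F w * A w) zeta d - sint (fun w => F w * B w) zeta d
     - k * sint (fun w => F w * D w) zeta d) <= 16 * (M * E) * d.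
Proof.
move=> cABD HE.
have cFA w : sframe zeta d w -> ccont (fun w => F w * A w) w.
  by move=> /[dup] /Fc cF /cABD[? _ _]; exact: ccontM.
have cFB w : sframe zeta d w -> ccont (fun w => -1 * (F w * B w)) w.
  by move=> /[dup] /Fc cF /cABD[_ ? _]; apply/ccontZ/ccontM.
have cFD w : sframe zeta d w -> ccont (fun w => - k * (F w * D w)) w.
  by move=> /[dup] /Fc cF /cABD[_ _ ?]; apply/ccontZ/ccontM.
have -> : sint (fun w => F w * A w) zeta d - sint (fun w => F w * B w) zeta d
     - k * sint (fun w => F w * D w) zeta d =
  sint (fun w => F w * A w + -1 * (F w * B w) + - k * (F w * D w)) zeta d.
  rewrite /sint (rintD ab bb _ cFD); last first.
    by move=> w fw; apply: ccontD; [exact: cFA|exact: cFB].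
  rewrite (rintD ab bb cFA cFB) !rintZ//; first by rewrite mulN1r mulNr.
    by move=> w /[dup] /Fc cF /cABD[_ _ ?]; apply/ccontM.
  by move=> w /[dup] /Fc cF /cABD[_ ? _]; apply/ccontM.
have -> : 16 * (M * E) * d = 4 * (M * E) * ((complex.Re zeta + d - (complex.Re zeta - d)) +
  (complex.Im zeta + d - (complex.Im zeta - d))) by ring.
apply: rint_bound => //.
  move=> w fw; apply: ccontD; last exact: cFD.
  by apply: ccontD; [exact: cFA|exact: cFB].
move=> w fw.
have -> : F w * A w + -1 * (F w * B w) + - k * (F w * D w) =
  F w * (A w - B w - k * D w) by ring.
rewrite normcM; apply: ler_pM; rewrite ?normc_ge0//; last exact: HE.
by apply: FM; case: fw.
Qed.

Lemma kernel_ccont z w : w != z -> ccont (fun w => (w - z)^-1) w.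
Proof. by move=> wz; apply: cdiff_ccont (cdiff_cauchy_kernel wz). Qed.

(** Cauchy's integral for [F']. The contour about [zeta] stays fixed while [z] moves, so that this
    integral can be differentiated in turn. *)
Definition cauchy_deriv z := tpi^-1 * sint (fun w => F w * ((w - z)^-1) ^+ 2) zeta d.

Lemma cauchy_square z : normc (z - zeta) <= d / 2 ->
  F z = tpi^-1 * sint (fun w => F w * (w - z)^-1) zeta d.
Proof.
have d0' := d0.
move=> zd; rewrite /sint cauchy_formula//; last 2 first.
- have := normc_Re (z - zeta); rewrite raddfB/= ler_norml => /andP[? ?].
  by apply/andP; split; lra.
- have := normc_Im (z - zeta); rewrite raddfB/= ler_norml => /andP[? ?].
  by apply/andP; split; lra.
by rewrite mulrC mulfK// tpi0.
Qed.

Lemma sframe_dist z w : sframe zeta d w -> normc (z - zeta) <= d / 2 ->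
  (w != z) /\ normc (w - z)^-1 <= 2 / d.
Proof.
have d0' := d0.
move=> /(sframe_normc (ltW d0)) wd zd.
have H : d / 2 <= normc (w - z).
  have := le_normcD (w - z) (z - zeta).
  by rewrite (_ : w - z + (z - zeta) = w - zeta); [lra|ring].
split; first by rewrite -subr_eq0 -normc_gt0; lra.
rewrite normcV -[2 / d]invf_div lef_pV2 ?posrE//; last by lra.
by lra.
Qed.

(** The kernel has remainder [k^2 / ((w - z)^2 (w - z - k))], and both points are at distance at
    least [d / 2] from the contour; [16 * (2 / d)^3 * d] is the constant [128 / d^2]. *)
Lemma cauchy_deriv_quad z k : normc (z - zeta) <= d / 4 -> normc k <= d / 4 ->
  normc (F (z + k) - F z - cauchy_deriv z * k) <= 128 * M / d ^+ 2 * normc k ^+ 2.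
Proof.
have d0' := d0.
move=> zd kd.
have zk : normc (z + k - zeta) <= d / 2.
  by rewrite addrAC; apply: le_trans (le_normcD _ _) _; lra.
rewrite (cauchy_square zk) (@cauchy_square z); last by lra.
rewrite /cauchy_deriv.
have -> (t A B D : C) : t * A - t * B - t * D * k = t * (A - B - k * D) by ring.
rewrite normcM.
set X := normc (_ - _ - _).
suff HX : X <= 128 * M / d ^+ 2 * normc k ^+ 2.
  by rewrite -[leRHS]mul1r ler_pM ?normc_ge0 ?normc_tpiV.
have -> : 128 * M / d ^+ 2 * normc k ^+ 2 =
   16 * (M * (normc k ^+ 2 * ((2 / d) ^+ 2 * (2 / d)))) * d.
  by field; rewrite gt_eqF.
apply: sint_kernel_diff => w fw.
  have [wz _] := @sframe_dist z w fw ltac:(lra).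
  have [wk _] := sframe_dist fw zk.
  by split; [exact: kernel_ccont|exact: kernel_ccont|apply: ccontM; exact: kernel_ccont].
have [wz wzd] := @sframe_dist z w fw ltac:(lra).
have [wk wkd] := sframe_dist fw zk.
have -> : (w - (z + k))^-1 - (w - z)^-1 - k * (w - z)^-1 ^+ 2 =
  k ^+ 2 * ((w - z)^-1 ^+ 2 * (w - (z + k))^-1).
  by field; rewrite !subr_eq0 wz wk.
rewrite normcM normcX ler_wpM2l ?sqr_ge0// normcM.
by rewrite ler_pM ?sqr_ge0 ?normc_ge0// normcX lerXn2r ?nnegrE ?normc_ge0// divr_ge0// ltW.
Qed.

Lemma cauchy_deriv_cdiff z : normc (z - zeta) <= d / 4 -> cdiff F z (cauchy_deriv z).
Proof.
move=> zd; apply: (@cdiff_quad _ _ _ _ (d / 4)); first by rewrite divr_gt0.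
by move=> k /ltW kd; apply: cauchy_deriv_quad.
Qed.

Lemma cauchy_deriv_diff : exists l, cdiff cauchy_deriv zeta l.
Proof.
have d0' := d0.
exists (tpi^-1 * sint (fun w => F w * (2 * (w - zeta)^-1 ^+ 3)) zeta d).
apply: (@cdiff_quad _ _ _ _ (d / 4) (16 * (M * (3 * ((2 / d) ^+ 2 * (2 / d) ^+ 2) +
    2 * (d / 4) * ((2 / d) ^+ 3 * (2 / d) ^+ 2))) * d)).
  by rewrite divr_gt0.
move=> k /ltW kd.
have zd : normc (zeta - zeta) <= d / 2 by rewrite subrr normc0; lra.
have zk : normc (zeta + k - zeta) <= d / 2 by rewrite addrAC subrr add0r; lra.
rewrite /cauchy_deriv.
have -> (t A B D : C) : t * A - t * B - t * D * k = t * (A - B - k * D) by ring.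
rewrite normcM.
set X := normc (_ - _ - _); set Y := leRHS.
suff HX : X <= Y.
  by rewrite -[leRHS]mul1r ler_pM ?normc_ge0 ?normc_tpiV.
set c1 := 3 * _ + _ in Y *.
have -> : Y = 16 * (M * (normc k ^+ 2 * c1)) * d by rewrite /Y; ring.
apply: sint_kernel_diff => w fw.
  have [wz _] := sframe_dist fw zd.
  have [wk _] := sframe_dist fw zk.
  have c z' : w != z' -> ccont (fun w => (w - z')^-1 ^+ 2) w.
    by move=> wz'; apply: ccontM; exact: kernel_ccont.
  split; [exact: c|exact: c|apply: ccontZ; apply: ccontM (c _ wz); exact: kernel_ccont].
have [wz wzd] := sframe_dist fw zd.
have [wk wkd] := sframe_dist fw zk.
set a := (w - zeta)^-1 in wzd *; set b := (w - (zeta + k))^-1 in wkd *.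
(* With [b - a = k * a * b] the remainder of the squared kernel acquires the factor [k^2]. *)
have -> : b ^+ 2 - a ^+ 2 - k * (2 * a ^+ 3) =
  k ^+ 2 * (3%:R%:C * (a ^+ 2 * b ^+ 2) + - (2%:R%:C * k * (a ^+ 3 * b ^+ 2))).
  rewrite !rmorph_nat /a /b; field; rewrite !subr_eq0 wz wk.
  by [].
have e0 : 0 <= 2 / d by rewrite divr_ge0// ltW.
rewrite normcM normcX ler_wpM2l ?sqr_ge0//.
apply: le_trans (le_normcD _ _) _; apply: lerD.
  rewrite normcM normc_real ger0_norm// ler_wpM2l// normcM !normcX.
  by rewrite ler_pM ?sqr_ge0// lerXn2r ?nnegrE ?normc_ge0.
rewrite normcN normcM; apply: ler_pM; rewrite ?normc_ge0//.
  by rewrite normcM normc_real ger0_norm// ler_wpM2l.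
rewrite normcM !normcX ler_pM ?exprn_ge0 ?normc_ge0//.
  by rewrite lerXn2r ?nnegrE ?normc_ge0.
by rewrite lerXn2r ?nnegrE ?normc_ge0.
Qed.

End SquareCauchyIntegral.

Lemma square_disc (z : C) d rho w : normc z + 2 * d <= rho -> square z d w -> normc w <= rho.
Proof.
move=> zr /square_normc wd; have := le_normcD (w - z) z; rewrite subrK; lra.
Qed.

Lemma holo_discP F z : holo_disc F -> disc z -> cdiff F z (cderiv F z).
Proof. by move=> FH /FH /derivable_cdiff. Qed.

Lemma holo_ccont F z : holo_disc F -> disc z -> ccont F z.
Proof. by move=> FH /(holo_discP FH) /cdiff_ccont. Qed.

(** The remainder must be uniform in [z]: it is integrated along a segment in the proof that
    [segment_integral] is a primitive. *)
Lemma cderiv_unif_quad F rho : holo_disc F -> rho < 1 ->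
  exists B, exists2 d, 0 < d & forall z k, normc z <= rho -> normc k <= d ->
    normc (F (z + k) - F z - cderiv F z * k) <= B * normc k ^+ 2.
Proof.
move=> FH rho1.
have [M HM] : exists M, forall w, normc w <= (1 + rho) / 2 -> normc (F w) <= M.
  apply: disc_bounded => w wr; apply: holo_ccont => //.
  by rewrite /disc /=; lra.
(* Squares of half-side [d] about points of modulus at most [rho] stay in the disc of radius
   [(1 + rho) / 2], where [F] is bounded. *)
pose d := (1 - rho) / 4.
have d0 : 0 < d by rewrite divr_gt0// subr_gt0.
exists (128 * M / d ^+ 2); exists (d / 4); first by rewrite divr_gt0.
move=> z k zr kd.
have inD w : square z d w -> normc w <= (1 + rho) / 2.
  by apply: square_disc; rewrite /d; lra.
have Fd w : square z d w -> exists l, cdiff F w l.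
  move=> /inD wr; exists (cderiv F w); apply: holo_discP => //.
  by rewrite /disc /=; lra.
have FM w : square z d w -> normc (F w) <= M by move=> /inD; exact: HM.
have zz : normc (z - z) <= d / 4 by rewrite subrr normc0 divr_ge0// ltW.
rewrite (cdiff_cderiv (cauchy_deriv_cdiff d0 Fd FM zz)).
exact: cauchy_deriv_quad.
Qed.

(** Near [z] the derivative coincides with the Cauchy integral [cauchy_deriv] over a fixed contour
    about [z], which is differentiable at the centre. *)
Lemma holo_cderiv F : holo_disc F -> holo_disc (cderiv F).
Proof.
move=> FH z; rewrite /disc /= => z1.
pose rho := (1 + normc z) / 2.
have rho1 : rho < 1 by rewrite /rho; lra.
have [M HM] : exists M, forall w, normc w <= rho -> normc (F w) <= M.
  apply: disc_bounded => w wr; apply: holo_ccont => //.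
  by rewrite /disc /=; lra.
pose d := (1 - normc z) / 4.
have d0 : 0 < d by rewrite divr_gt0// subr_gt0.
have inD w : square z d w -> normc w <= rho.
  by apply: square_disc; rewrite /d /rho; lra.
have Fd w : square z d w -> exists l, cdiff F w l.
  move=> /inD wr; exists (cderiv F w); apply: holo_discP => //.
  by rewrite /disc /=; lra.
have FM w : square z d w -> normc (F w) <= M by move=> /inD; exact: HM.
have [l Hl] := cauchy_deriv_diff d0 Fd FM.
apply: (@cdiff_derivable _ _ _ l) => e e0; have [d1 d10 H1] := Hl _ e0.
exists (Num.min d1 (d / 4)); first by rewrite lt_min d10 divr_gt0.
move=> k; rewrite lt_min => /andP[/H1 k1 /ltW k4].
rewrite (cdiff_cderiv (cauchy_deriv_cdiff d0 Fd FM _)); last first.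
  by rewrite addrAC subrr add0r.
rewrite (cdiff_cderiv (cauchy_deriv_cdiff d0 Fd FM _))//.
by rewrite subrr normc0 divr_ge0// ltW.
Qed.

End Regularity.

(** * Volterra operator and radial growth *)

Section Volterra.
Context {R : realType}.
Local Notation C := R[i].
Local Notation mu := (@lebesgue_measure R).
Implicit Types (f g h F : C -> C) (x y t : R) (z w : C).

Lemma cdiff_scale h w z l : cdiff h (w * z) l -> cdiff (fun v => h (v * z)) w (l * z).
Proof.
move=> H e e0; have z0 : 0 < normc z + 1 by rewrite ltr_wpDl// normc_ge0.
have [d d0 Hd] := H _ (divr_gt0 e0 z0).
exists (d / (normc z + 1)); first exact: divr_gt0.
move=> k; rewrite ltr_pdivlMr// => kd; rewrite mulrDl -mulrA (mulrC z).
have kz : normc (k * z) <= normc k * (normc z + 1).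
  by rewrite normcM ler_wpM2l ?normc_ge0// lerDl.
apply: le_trans (Hd _ (le_lt_trans kz kd)) _.
by rewrite mulrAC ler_pdivrMr// -mulrA ler_pM2l.
Qed.

Lemma cdiff_rdiff h t l : cdiff h t%:C l -> rdiff (fun s => h s%:C) t l.
Proof. exact: (@cdiff_h _ h t 0). Qed.

Lemma ccont_rcont h t : ccont h t%:C -> rcont (fun s => h s%:C) t.
Proof. exact: (@ccont_h _ h t 0). Qed.

Lemma disc_scale t z (rho : R) : 0 <= t <= 1 -> normc z <= rho -> normc (t%:C * z) <= rho.
Proof.
move=> /andP[t0 t1] zr; rewrite normcM normc_real ger0_norm//.
by apply: le_trans zr; rewrite ler_piMl ?normc_ge0.
Qed.

Lemma disc_scale_lt t z : 0 <= t <= 1 -> disc z -> disc (t%:C * z).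
Proof. by move=> t01; rewrite /disc /= => z1; apply: le_lt_trans z1; exact: disc_scale. Qed.

Lemma cdiff_id z : cdiff (fun w => w) z 1.
Proof.
apply: (@cdiff_quad _ _ _ _ 1 0) => // k _.
by rewrite mul0r [X in normc X](_ : _ = 0) ?normc0//; ring.
Qed.

Lemma cdiff_cst c z : cdiff (fun=> c) z 0.
Proof.
apply: (@cdiff_quad _ _ _ _ 1 0) => // k _.
by rewrite [X in normc X](_ : _ = 0) ?normc0 ?mul0r//; ring.
Qed.

(** Differentiation under the integral: the derivative of [z * h(tz)] in [z] and that of [t * h(tz)]
    in [t] are the same function, whose integral over [0 <= t <= 1] is [h z]. No comparison of paths
    is involved. *)
Lemma segment_cdiff h z : holo_disc h -> disc z -> cdiff (segment_integral h) z (h z).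
Proof.
move=> hh; rewrite /disc /= => z1.
have hd := holo_cderiv hh.
pose rho := (1 + normc z) / 2.
have [rho1 zrho] : rho < 1 /\ normc z <= rho by rewrite /rho; split; lra.
have [B [d d0 HB]] := cderiv_unif_quad hh rho1.
have [M HM] : exists M, forall w, normc w <= rho -> normc (cderiv h w) <= M.
  by apply: disc_bounded => w wr; apply: holo_ccont => //; rewrite /disc /=; lra.
(* The bound 1 gives [|z + k| <= |z| + 1], and [rho - |z|] keeps the segment to [z + k] where the
   uniform estimates hold. *)
pose d1 := Num.min d (Num.min 1 (rho - normc z)).
have d10 : 0 < d1 by rewrite !lt_min d0 ltr01 subr_gt0 /rho; lra.
apply: (@cdiff_quad _ _ _ _ d1 (2 * ((normc z + 1) * `|B| + M) * (1 - 0))) => // k.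
rewrite !lt_min => /and3P[/ltW kd /ltW k1 kr].
have zk : normc (z + k) <= rho by apply: le_trans (le_normcD _ _) _; lra.
have cw v t : normc v <= rho -> 0 <= t <= 1 -> disc (t%:C * v).
  by move=> vr t01; apply: le_lt_trans (disc_scale t01 vr) rho1.
have hcc v t : normc v <= rho -> 0 <= t <= 1 -> ccont (fun w => h (w * v)) t%:C.
  by move=> vr t01; apply: cdiff_ccont (cdiff_scale (holo_discP hh (cw _ _ vr t01))).
have hcont v (c : C) : normc v <= rho -> seg_cont 0 1 (fun t => c * h (t%:C * v)).
  move=> vr t t01; apply: (@ccont_rcont (fun w => c * h (w * v))).
  exact/ccontZ/hcc.
pose U w := h (w * z) + w * (cderiv h (w * z) * z).
pose u t := U t%:C.
have Uc t : 0 <= t <= 1 -> ccont U t%:C.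
  move=> t01; apply: ccontD; first exact: hcc.
  apply: ccontM; first exact: cdiff_ccont (cdiff_id _).
  apply: ccontM; last exact: cdiff_ccont (cdiff_cst _ _).
  exact: cdiff_ccont (cdiff_scale (holo_discP hd (cw _ _ zrho t01))).
have ucont (c : C) : seg_cont 0 1 (fun t => c * u t).
  by move=> t t01; apply: (@ccont_rcont (fun w => c * U w)); exact/ccontZ/Uc.
have hz : h z = cint 0 1 u.
  rewrite (@cint_ftc _ _ (fun t => t%:C * h (t%:C * z)))//.
  - by rewrite mul1r mul0r subr0 mul1r.
  - by move=> t /(ucont 1) /=; under eq_fun do rewrite mul1r.
  - move=> t t01; have := cdiffM (cdiff_id t%:C) (cdiff_scale (holo_discP hh (cw _ _ zrho t01))).
    by move=> /cdiff_rdiff; rewrite /u /U mul1r [X in _ X -> _]addrC.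
have segE v : normc v <= rho -> segment_integral h v = cint 0 1 (fun t => v * h (t%:C * v)).
  by move=> vr; rewrite /segment_integral /cint; congr (_ +i* _);
    apply: eq_Rintegral => t _; rewrite mulrC.
have -> : segment_integral h (z + k) - segment_integral h z - h z * k =
  cint 0 1 (fun t => (z + k) * h (t%:C * (z + k)) + (- z * h (t%:C * z) + - k * u t)).
  have c2 : seg_cont 0 1 (fun t => - z * h (t%:C * z) + - k * u t).
    move=> t t01; apply: (@ccont_rcont (fun w => - z * h (w * z) + - k * U w)).
    by apply: ccontD; [exact/ccontZ/hcc|exact/ccontZ/Uc].
  rewrite (cintD (hcont _ _ zk) c2) (cintD (hcont _ _ zrho) (ucont _)).
  rewrite !segE// hz.
  have uc1 : seg_cont 0 1 u.
    by move=> t /(ucont 1) /=; under eq_fun do rewrite mul1r.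
  have hc1 v : normc v <= rho -> seg_cont 0 1 (fun t => h (t%:C * v)).
    by move=> vr t /(hcont _ 1 vr) /=; under eq_fun do rewrite mul1r.
  by rewrite (cintZ _ uc1) (cintZ _ (hc1 _ zrho)) (cintZ _ (hc1 _ zrho)) (cintZ _ (hc1 _ zk)); ring.
have -> : 2 * ((normc z + 1) * `|B| + M) * (1 - 0) * normc k ^+ 2 =
  2 * (((normc z + 1) * `|B| + M) * normc k ^+ 2) * (1 - 0) by ring.
apply: cint_bound => //.
  move=> t t01; apply: (@ccont_rcont (fun w => (z + k) * h (w * (z + k)) + (- z * h (w * z) + - k * U w))).
  by apply: ccontD; [exact/ccontZ/hcc|apply: ccontD; [exact/ccontZ/hcc|exact/ccontZ/Uc]].
move=> t t01; rewrite /u /U.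
have tk : normc (t%:C * k) <= normc k by exact: disc_scale.
have E := HB (t%:C * z) (t%:C * k) (disc_scale t01 zrho) (le_trans tk kd).
set E1 := h _ - _ - _ in E.
(* Apart from the Taylor remainder [E1] of [h] at [tz], only the product of [k] with the first-order
   term [k * t * h'(tz)] survives. *)
have -> : (z + k) * h (t%:C * (z + k)) + (- z * h (t%:C * z) +
    - k * (h (t%:C * z) + t%:C * (cderiv h (t%:C * z) * z))) =
   (z + k) * E1 + k ^+ 2 * (t%:C * cderiv h (t%:C * z)).
  by rewrite /E1 -mulrDr; ring.
apply: le_trans (le_normcD _ _) _; rewrite [leRHS]mulrDl; apply: lerD.
  rewrite normcM -mulrA; apply: ler_pM; rewrite ?normc_ge0//.
    by apply: le_trans (le_normcD _ _) _; lra.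
  apply: le_trans E _; apply: (@le_trans _ _ (`|B| * normc (t%:C * k) ^+ 2)).
    by rewrite ler_wpM2r ?sqr_ge0// ler_norm.
  by rewrite ler_wpM2l// lerXn2r ?nnegrE ?normc_ge0.
rewrite normcM normcX mulrC ler_wpM2r ?sqr_ge0//.
by rewrite normcM normc_real; have /andP[t0 t1] := t01;
  rewrite ger0_norm// -[M]mul1r ler_pM ?normc_ge0// HM// disc_scale.
Qed.

Lemma holo_mul f g : holo_disc f -> holo_disc g -> holo_disc (fun w => f w * g w).
Proof.
move=> fh gh z zd.
exact: cdiff_derivable (cdiffM (holo_discP fh zd) (holo_discP gh zd)).
Qed.

Lemma volterra_cdiff f g z : holo_disc f -> holo_disc g -> disc z ->
  cdiff (volterra g f) z (f z * cderiv g z).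
Proof.
move=> fh gh zd; rewrite /volterra.
exact: segment_cdiff (holo_mul fh (holo_cderiv gh)) zd.
Qed.

Lemma volterra_holo f g : holo_disc f -> holo_disc g -> holo_disc (volterra g f).
Proof. by move=> fh gh z zd; exact: cdiff_derivable (volterra_cdiff fh gh zd). Qed.

Lemma volterra0 f g : volterra g f 0 = 0.
Proof.
rewrite /volterra /segment_integral; under eq_Rintegral do rewrite mulr0 /=.
under [X in _ +i* X]eq_Rintegral do rewrite mulr0 /=.
by rewrite !Rintegral_cst// !mul0r.
Qed.

(** The hypothesis bounds [|f'(tz)| |z|] by [M |z| (1 - t|z|)^(-1 - eta)], which is the
    [t]-derivative of [M / eta * (1 - t|z|)^(-eta)]. As [eta > 0], the primitive is a power rather
    than a logarithm. *)
Lemma radial_growth f z (eta M : R) : holo_disc f -> disc z -> 0 < eta ->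
  (forall t, 0 <= t <= 1 ->
    normc (cderiv f (t%:C * z)) * (1 - t * normc z) `^ (1 + eta) <= M) ->
  normc (f z - f 0) <= 2 * M / eta * (1 - normc z) `^ (- eta).
Proof.
move=> fh zd eta0 HM.
have fd := holo_cderiv fh.
have M0 : 0 <= M.
  apply: le_trans (HM 0 _); last by rewrite lexx ler01.
  by rewrite mulr_ge0 ?normc_ge0 ?powR_ge0.
have uc : seg_cont 0 1 (fun t => cderiv f (t%:C * z) * z).
  move=> t t01; apply: (@ccont_rcont (fun w => cderiv f (w * z) * z)).
  apply: ccontM; last exact: cdiff_ccont (cdiff_cst _ _).
  by apply: cdiff_ccont (cdiff_scale (holo_discP fd _)); exact: disc_scale_lt.
have -> : f z - f 0 = cint 0 1 (fun t => cderiv f (t%:C * z) * z).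
  rewrite (@cint_ftc _ _ (fun t => f (t%:C * z)))//; first by rewrite mul1r mul0r.
  move=> t t01; apply: (@cdiff_rdiff (fun w => f (w * z))).
  by apply: cdiff_scale; apply: holo_discP => //; exact: disc_scale_lt.
apply: le_trans (cint_normc uc) _; rewrite -!mulrA ler_pM2l//.
have pos t : 0 <= t <= 1 -> 0 < 1 - t * normc z.
  move=> t01; rewrite subr_gt0; have := disc_scale_lt t01 zd.
  by rewrite /disc /= normcM normc_real ger0_norm//; case/andP: t01.
pose b t := M * (normc z * (1 - t * normc z) `^ (- eta - 1)).
have dlin t : is_derive t 1 (fun t => 1 - t * normc z) (- normc z).
  by apply: is_derive_eq; rewrite /GRing.scale/=; ring.
have dpow (a : R) t : 0 <= t <= 1 -> is_derive t 1 (fun t => (1 - t * normc z) `^ a)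
    (a * (1 - t * normc z) `^ (a - 1) * - normc z).
  move=> t01.
  apply: is_derive_eq (@is_derive1_comp _ (fun x : R => x `^ a) (fun t => 1 - t * normc z) t _ _
    (is_derive1_powR _ (pos _ t01)) (dlin t)) _.
  by [].
have bcont t : 0 <= t <= 1 -> {for t, continuous b}.
  move=> t01; apply: continuousM; first exact: cst_continuous.
  apply: continuousM; first exact: cst_continuous.
  by have [+ _] := dpow (- eta - 1) t t01 => /derivable1_diffP/differentiable_continuous.
have bI : \int[mu]_(t in `[0, 1]) b t =
   M / eta * (1 - normc z) `^ (- eta) - M / eta * 1.
  transitivity (M / eta * (1 - 1 * normc z) `^ (- eta) - M / eta * (1 - 0 * normc z) `^ (- eta)); last first.
    by rewrite mul1r mul0r subr0 powR1.
  apply: (@Rintegral_ftc _ _ (fun t => M / eta * (1 - t * normc z) `^ (- eta))) => // t t01.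
  have H := is_deriveZ (M / eta) (dpow (- eta) t t01).
  apply: is_derive_eq; rewrite /GRing.scale /= /b.
  by field; rewrite gt_eqF.
apply: (@le_trans _ _ (\int[mu]_(t in `[0, 1]) b t)).
  apply: le_Rintegral => //.
  - by apply: continuous_segment_integrable => t /uc; exact: rcont_normc.
  - exact: continuous_segment_integrable.
  - move=> t /=; rewrite in_itv/= => t01; rewrite normcM /b.
    rewrite [leRHS](_ : _ = M * (1 - t * normc z) `^ (- eta - 1) * normc z); last by ring.
    rewrite ler_wpM2r ?normc_ge0// -opprD powRN (addrC eta) ler_pdivlMr ?powR_gt0 ?pos//.
    exact: HM.
rewrite bI -!mulrA mulr1 mulrA lerBlDr lerDl.
by rewrite divr_ge0// ltW.
Qed.

End Volterra.

#[local] Arguments normc : simpl never.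

(** * Submean value property *)

Section MeasureTools.
Context {R : realType}.
Local Notation C := R[i].
Local Notation mu := (@lebesgue_measure R).
Local Notation mu2 := (mu \x mu)%E.
Local Notation R2 := (measurableTypeR R * measurableTypeR R)%type.

(** The integral of a nonnegative function is a supremum over the simple functions below its
    extension by zero, a family that grows with the integrand and with the domain. Domains such as
    [cone z] are compared in this way. *)
Lemma le_integral_ge0 d (T : measurableType d) (nu : {measure set T -> \bar R})
    (A B : set T) (f g : T -> \bar R) : A `<=` B ->
  (forall x, A x -> 0 <= f x)%E -> (forall x, B x -> 0 <= g x)%E ->
  (forall x, A x -> f x <= g x)%E ->
  (\int[nu]_(x in A) f x <= \int[nu]_(x in B) g x)%E.
Proof.
move=> AB f0 g0 fg; rewrite !ge0_integralE//.
apply: le_ereal_sup => _ [h hf <-]; exists h => // x.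
apply: le_trans (hf x) _; rewrite !patchE; case: ifPn => [|_].
  by rewrite inE => /[dup] Ax /AB Bx; rewrite mem_set// fg.
by case: ifPn => [|//]; rewrite inE => /g0.
Qed.

Definition cpt (w : R2) : C := w.1 +i* w.2.
Arguments cpt : simpl never.

(** An open set is the union of the countably many boxes with rational corners that it contains. *)
Lemma open_box_measurable (U : set R2) :
  (forall w, U w -> exists2 d, 0 < d & forall v : R2,
    `|v.1 - w.1| < d -> `|v.2 - w.2| < d -> U v) -> measurable U.
Proof.
move=> Uo.
pose bx (q : (rat * rat) * (rat * rat)) : set R2 :=
  `](ratr q.1.1 : R), ratr q.1.2[%classic `*` `](ratr q.2.1 : R), ratr q.2.2[%classic.
pose F q : set R2 := if `[< bx q `<=` U >] then bx q else set0.
have -> : U = \bigcup_q F q.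
  apply/seteqP; split=> [w Uw|w [q _]]; last first.
    by rewrite /F; case: asboolP => [sub|_ []//]; exact: sub.
  have [d d0 Hd] := Uo _ Uw.
  have lt1 (x : R) : x - d < x by lra.
  have lt2 (x : R) : x < x + d by lra.
  have /rat_in_itvoo[a1] := lt1 w.1; rewrite in_itv/= => /andP[a11 a12].
  have /rat_in_itvoo[b1] := lt2 w.1; rewrite in_itv/= => /andP[b11 b12].
  have /rat_in_itvoo[a2] := lt1 w.2; rewrite in_itv/= => /andP[a21 a22].
  have /rat_in_itvoo[b2] := lt2 w.2; rewrite in_itv/= => /andP[b21 b22].
  have sub : bx ((a1, b1), (a2, b2)) `<=` U.
    case=> v1 v2 [/=]; rewrite !in_itv/= => /andP[? ?] /andP[? ?].
    by apply: Hd => /=; rewrite ltr_norml; apply/andP; split; lra.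
  exists ((a1, b1), (a2, b2)) => //; rewrite /F asboolT//.
  by split; rewrite /= in_itv/=; apply/andP.
apply: countable_bigcupT_measurable => // q.
rewrite /F; case: ifP => // _.
by apply: measurableX; exact: measurable_itv.
Qed.

Definition D2 : set R2 := [set w | disc (cpt w)].

Lemma normc_cpt_lt (v w : R2) (d : R) : `|v.1 - w.1| < d / 2 -> `|v.2 - w.2| < d / 2 ->
  normc (cpt v - cpt w) < d.
Proof.
case: v w => [a b] [x y] h1 h2; apply: le_lt_trans (normc_le_ReIm _) _.
by move: h1 h2 => /=; lra.
Qed.

Lemma measurable_D2 : measurable D2.
Proof.
apply: open_box_measurable => w w1; rewrite /D2 /disc /= in w1.
exists ((1 - normc (cpt w)) / 2); first by rewrite divr_gt0// subr_gt0.
move=> v h1 h2; have := normc_cpt_lt h1 h2.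
have := ler_normcB (cpt v) (cpt w); rewrite /D2 /disc /=; lra.
Qed.

Lemma disc_cont_measurable (f : C -> R) (U : set R2) : measurable U -> U `<=` D2 ->
  (forall z, disc z -> forall e : R, 0 < e -> exists2 d, 0 < d &
    forall h, normc h < d -> `|f (z + h) - f z| < e) ->
  measurable_fun U (f \o cpt : R2 -> R).
Proof.
move=> mU UD fc.
apply: (measurable_funS (E := D2)) => //; first exact: measurable_D2.
apply: (measurability _ (measurable_realfun.RGenOInfty.measurableE R)) => /= _ [_ [a ->] <-].
apply: open_box_measurable => w [Dw /=]; rewrite in_itv/= andbT => aw.
have aw' : 0 < f (cpt w) - a by rewrite subr_gt0.
have [d d0 Hd] := fc _ Dw _ aw'.
pose d' := Num.min (d / 2) ((1 - normc (cpt w)) / 2).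
exists d'.
  by rewrite lt_min !divr_gt0// subr_gt0.
move=> v; rewrite !lt_min => /andP[h1 h1'] /andP[h2 h2']; split.
  have := normc_cpt_lt h1' h2'; rewrite /D2 /disc /=.
  have := ler_normcB (cpt v) (cpt w); lra.
rewrite /= in_itv/= andbT.
have := Hd _ (normc_cpt_lt h1 h2); rewrite subrKC ltr_norml => /andP[+ _]; lra.
Qed.

Definition sq2 (z : C) (d : R) : set R2 :=
  `[complex.Re z - d, complex.Re z + d]%classic `*`
  `[complex.Im z - d, complex.Im z + d]%classic.

Lemma sq2P z d (w : R2) : sq2 z d w <-> square z d (cpt w).
Proof. by rewrite /sq2 /square /rect /= !in_itv/=. Qed.

Lemma measurable_sq2 z d : measurable (sq2 z d).
Proof. by apply: measurableX; exact: measurable_itv. Qed.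

Lemma sq2_disc z d : normc z + 2 * d < 1 -> sq2 z d `<=` D2.
Proof.
move=> zd w /sq2P /square_normc; rewrite /D2 /disc /=.
by have := ler_normcB (cpt w) z; lra.
Qed.

Lemma ccont_normc (F : C -> C) z : ccont F z -> forall e : R, 0 < e -> exists2 d, 0 < d &
    forall h, normc h < d -> `|normc (F (z + h)) - normc (F z)| < e.
Proof.
move=> Fc e /Fc[d d0 Hd]; exists d => // h /Hd; apply: le_lt_trans.
rewrite ler_norml lerNl opprB; apply/andP; split; last exact: ler_normcB.
by rewrite normcB; exact: ler_normcB.
Qed.

Lemma holo_measurable (F : C -> C) (U : set R2) : holo_disc F -> measurable U -> U `<=` D2 ->
  measurable_fun U (fun w : R2 => normc (F (cpt w))).
Proof.
move=> Fh mU UD; apply: (@disc_cont_measurable (fun z => normc (F z))) => // z zd.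
by apply: ccont_normc; exact: holo_ccont.
Qed.

Lemma lebesgue_itvcc (a b : R) : a <= b -> mu `[a, b]%classic = (b - a)%:E.
Proof.
move=> ab; have /= -> := lebesgue_measure_itv `[a, b]; rewrite lte_fin.
by case: ltgtP ab => // <-; rewrite subrr.
Qed.

(** This selects a line on which a section integral does not exceed its average. *)
Lemma exists_le_average (A : R -> \bar R) (lo hi c : R) :
  0 <= c -> lo <= hi -> (forall t, 0 <= A t)%E ->
  (\int[mu]_(t in `[lo, hi]) A t < (c * (hi - lo))%:E)%E ->
  exists2 t, lo <= t <= hi & (A t <= c%:E)%E.
Proof.
move=> c0 lohi A0 HA; apply: contrapT => H.
move: HA; rewrite ltNge => /negP; apply.
have -> : (c * (hi - lo))%:E = (\int[mu]_(t in `[lo, hi]) c%:E)%E.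
  by rewrite integral_cst//= lebesgue_itvcc.
apply: le_integral_ge0 => //.
move=> t /=; rewrite in_itv/= => tl; rewrite leNgt; apply/negP => /ltW h.
by apply: H; exists t.
Qed.

Lemma cint_normc_e (a b : R) (u : R -> C) : seg_cont a b u ->
  ((normc (cint a b u))%:E <= 2%:E * \int[mu]_(t in `[a, b]) (normc (u t))%:E)%E.
Proof.
move=> uc; have iN : mu.-integrable `[a, b] (EFin \o (@normc R \o u)).
  by apply: continuous_segment_integrable => t /uc; exact: rcont_normc.
rewrite -(@fineK _ (\int[mu]_(t in `[a, b]) _)%E).
  by rewrite -EFinM lee_fin; exact: cint_normc.
exact: integrable_fin_num.
Qed.

End MeasureTools.

Section TonelliRectangle.
Context d1 d2 (T1 : measurableType d1) (T2 : measurableType d2) (R : realType).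
Variables (m1 : {sigma_finite_measure set T1 -> \bar R})
  (m2 : {sigma_finite_measure set T2 -> \bar R}).
Variables (X : set T1) (Y : set T2) (f : T1 * T2 -> \bar R).
Hypotheses (mX : measurable X) (mY : measurable Y)
  (mf : measurable_fun (X `*` Y) f) (f0 : forall w, (X `*` Y) w -> (0 <= f w)%E).

(** Tonelli's theorem for an integrand known to be measurable on the rectangle only: it is extended
    by zero. *)
Lemma integral_setX1 :
  (\int[m1 \x m2]_(w in X `*` Y) f w = \int[m1]_(x in X) \int[m2]_(y in Y) f (x, y))%E.
Proof.
have mXY : measurable (X `*` Y) by exact: measurableX.
rewrite integral_mkcond fubini_tonelli1; last 2 first.
- exact/(measurable_restrictT _ mXY).
- by move=> w; apply: erestrict_ge0.
rewrite [RHS]integral_mkcond; apply: eq_integral => x _.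
rewrite /fubini_F [RHS]patchE; case: ifPn => xX.
  rewrite [RHS]integral_mkcond; apply: eq_integral => y _.
  by rewrite !patchE in_setX xX.
by rewrite integral0_eq// => y _; rewrite patchE in_setX (negbTE xX).
Qed.

Lemma integral_setX2 :
  (\int[m1 \x m2]_(w in X `*` Y) f w = \int[m2]_(y in Y) \int[m1]_(x in X) f (x, y))%E.
Proof.
have mXY : measurable (X `*` Y) by exact: measurableX.
rewrite integral_mkcond fubini_tonelli2; last 2 first.
- exact/(measurable_restrictT _ mXY).
- by move=> w; apply: erestrict_ge0.
rewrite [RHS]integral_mkcond; apply: eq_integral => y _.
rewrite /fubini_G [RHS]patchE; case: ifPn => yY.
  rewrite [RHS]integral_mkcond; apply: eq_integral => x _.
  by rewrite !patchE in_setX yY andbT.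
by rewrite integral0_eq// => x _; rewrite patchE in_setX (negbTE yY) andbF.
Qed.

End TonelliRectangle.

Section Submean.
Context {R : realType}.
Local Notation C := R[i].
Local Notation mu := (@lebesgue_measure R).
Local Notation mu2 := (mu \x mu)%E.
Local Notation R2 := (measurableTypeR R * measurableTypeR R)%type.

Lemma normc_le_rint (h : C -> C) (x1 x2 y1 y2 b : R) : x1 <= x2 -> y1 <= y2 ->
  (forall z, frame x1 x2 y1 y2 z -> ccont h z) ->
  (\int[mu]_(t in `[x1, x2]) (normc (h (t +i* y1)))%:E <= b%:E)%E ->
  (\int[mu]_(t in `[x1, x2]) (normc (h (t +i* y2)))%:E <= b%:E)%E ->
  (\int[mu]_(t in `[y1, y2]) (normc (h (x1 +i* t)))%:E <= b%:E)%E ->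
  (\int[mu]_(t in `[y1, y2]) (normc (h (x2 +i* t)))%:E <= b%:E)%E ->
  normc (rint h x1 x2 y1 y2) <= 8 * b.
Proof.
move=> x12 y12 hc Hb Ht Hl Hr; rewrite /rint.
have le2 (u : R -> C) a1 a2 : seg_cont a1 a2 u ->
    (\int[mu]_(t in `[a1, a2]) (normc (u t))%:E <= b%:E)%E ->
    normc (cint a1 a2 u) <= 2 * b.
  move=> /cint_normc_e H H'; rewrite -lee_fin; apply: le_trans H _.
  by rewrite EFinM lee_pmul2l.
have Bb := le2 _ _ _ (seg_cont_b y12 hc) Hb.
have Bt := le2 _ _ _ (seg_cont_t y12 hc) Ht.
have Bl := le2 _ _ _ (seg_cont_l x12 hc) Hl.
have Br := le2 _ _ _ (seg_cont_r x12 hc) Hr.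
set A1 := cint _ _ _ in Bb *; set A2 := cint y1 y2 _ in Br *.
set A3 := cint x1 x2 _ in Bt *; set A4 := cint y1 y2 _ in Bl *.
have H1 := le_normcD (A1 + 'i * A2 - A3) (- ('i * A4)).
have H2 := le_normcD (A1 + 'i * A2) (- A3).
have H3 := le_normcD A1 ('i * A2).
rewrite !normcN !normc_iM in H1 H2 H3.
by lra.
Qed.

(** Cauchy's formula on a rectangle whose four sides are chosen in the outer strips of the square.
    On each side the line integral of [|F|] is at most its average over the strip, and the kernel is
    at most [2 / s]. *)
Lemma submean1 (F : C -> C) (z : C) (s : R) : holo_disc F -> 0 < s ->
  normc z + 2 * s < 1 ->
  ((normc (F z))%:E <= (64 / s ^+ 2)%:E *
     \int[mu2]_(w in sq2 z s) (normc (F (cpt w)))%:E)%E.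
Proof.
move=> Fh s0 zs.
have s2 : 0 < 64 / s ^+ 2 by rewrite divr_gt0// exprn_gt0.
set J := (\int[mu2]_(_ in _) _)%E.
have J0 : (0 <= J)%E by apply: integral_ge0 => w _; rewrite lee_fin normc_ge0.
have [Jy|Jfin] := eqVneq J +oo%E.
  by rewrite Jy gt0_muley ?lte_fin// leey.
have {}Jfin : J \is a fin_num by rewrite ge0_fin_numE// ltey.
set j := fine J; have JE : J = j%:E by rewrite /j fineK.
have j0 : 0 <= j by rewrite -lee_fin -JE.
rewrite JE -EFinM lee_fin; apply/ler_addgt0Pr => e e0.
pose e' := e * s ^+ 2 / 64.
have e'0 : 0 < e' by rewrite divr_gt0// mulr_gt0// exprn_gt0.
have -> : 64 / s ^+ 2 * j + e = 64 / s ^+ 2 * (j + e').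
  by rewrite /e'; field; rewrite gt_eqF.
set a := complex.Re z; set b := complex.Im z.
(* The strips have width [s / 2], so [c] is the average that an integral of [j + e'] would have; the
   excess [e'] provides the strict inequality demanded by [exists_le_average]. *)
pose c := 2 / s * (j + e').
have c0 : 0 <= c.
  by rewrite /c mulr_ge0 ?divr_ge0 ?(ltW s0)// addr_ge0 ?(ltW e'0).
have inD w : square z s w -> disc w.
  by move=> /square_normc; rewrite /disc /=; have := ler_normcB w z; lra.
have mF : measurable_fun (sq2 z s) (fun w : R2 => (normc (F (cpt w)))%:E).
  apply/measurable_EFinP; apply: holo_measurable => //; first exact: measurable_sq2.
  exact: sq2_disc.
pose A y := (\int[mu]_(x in `[(a - s)%R, (a + s)%R]) (normc (F (x +i* y)))%:E)%E.
pose B x := (\int[mu]_(y in `[(b - s)%R, (b + s)%R]) (normc (F (x +i* y)))%:E)%E.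
have A0 y : (0 <= A y)%E by apply: integral_ge0 => ? _; rewrite lee_fin normc_ge0.
have B0 y : (0 <= B y)%E by apply: integral_ge0 => ? _; rewrite lee_fin normc_ge0.
have JA : J = (\int[mu]_(y in `[(b - s)%R, (b + s)%R]) A y)%E.
  rewrite /J /sq2 integral_setX2//; try exact: measurable_itv.
  by move=> w _; rewrite lee_fin normc_ge0.
have JB : J = (\int[mu]_(x in `[(a - s)%R, (a + s)%R]) B x)%E.
  rewrite /J /sq2 integral_setX1//; try exact: measurable_itv.
  by move=> w _; rewrite lee_fin normc_ge0.
have pick (G : R -> \bar R) (m lo hi : R) : (forall t, 0 <= G t)%E ->
    J = (\int[mu]_(y in `[(m - s)%R, (m + s)%R]) G y)%E ->
    m - s <= lo -> hi <= m + s -> hi - lo = s / 2 ->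
    exists2 t, lo <= t <= hi & (G t <= c%:E)%E.
  move=> G0 JG mlo him hl; apply: exists_le_average => //; first by lra.
  rewrite hl (_ : c * (s / 2) = j + e'); last first.
    by rewrite /c; field; rewrite gt_eqF.
  apply: (@le_lt_trans _ _ J); last by rewrite JE lte_fin ltrDl.
  rewrite JG; apply: le_integral_ge0 => // t /=; rewrite !in_itv/=.
  by move=> /andP[lt th]; rewrite (le_trans mlo lt) (le_trans th him).
(* Each side lies between [s / 2] and [s] away from the centre: far enough for the kernel, and still
   within the square. *)
have [y1 /andP[y1l y1h] Ay1] := pick A b (b - s) (b - s / 2) A0 JA ltac:(clear -s0; lra) ltac:(clear -s0; lra) ltac:(clear; lra).
have [y2 /andP[y2l y2h] Ay2] := pick A b (b + s / 2) (b + s) A0 JA ltac:(clear -s0; lra) ltac:(clear -s0; lra) ltac:(clear; lra).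
have [x1 /andP[x1l x1h] Bx1] := pick B a (a - s) (a - s / 2) B0 JB ltac:(clear -s0; lra) ltac:(clear -s0; lra) ltac:(clear; lra).
have [x2 /andP[x2l x2h] Bx2] := pick B a (a + s / 2) (a + s) B0 JB ltac:(clear -s0; lra) ltac:(clear -s0; lra) ltac:(clear; lra).
have [x12 y12] : x1 <= x2 /\ y1 <= y2 by clear -s0 x1h x2l y1h y2l; split; lra.
have rsq w : rect x1 x2 y1 y2 w -> square z s w.
  by apply: rectS; rewrite -/a -/b; clear -s0 x1l x1h x2l x2h y1l y1h y2l y2h; lra.
have Fd w : rect x1 x2 y1 y2 w -> exists l, cdiff F w l.
  by move=> /rsq /inD wd; exists (cderiv F w); exact: holo_discP.
have := @cauchy_formula _ F x1 x2 y1 y2 z.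
rewrite -/a -/b.
have aI : x1 < a < x2 by apply/andP; split; clear -s0 x1h x2l; lra.
have bI : y1 < b < y2 by apply/andP; split; clear -s0 y1h y2l; lra.
move=> /(_ aI bI Fd) CF.
have frw w : frame x1 x2 y1 y2 w -> w != z /\ normc (w - z)^-1 <= 2 / s.
  move=> [_ fw].
  have H : s / 2 <= normc (w - z).
    have [E|E] : s / 2 <= `|complex.Re (w - z)| \/ s / 2 <= `|complex.Im (w - z)|.
      rewrite !raddfB/= -/a -/b !ler_normr.
      case: fw => ->; [left|left|right|right]; apply/orP;
        clear -s0 x1h x2l y1h y2l; first [by left; lra|by right; lra].
    - exact: le_trans E (normc_Re _).
    - exact: le_trans E (normc_Im _).
  split; first by rewrite -subr_eq0 -normc_gt0 (lt_le_trans _ H)// divr_gt0.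
  by rewrite normcV -[2 / s]invf_div lef_pV2 ?posrE ?divr_gt0// (lt_le_trans _ H)// divr_gt0.
have kc w : frame x1 x2 y1 y2 w -> ccont (fun v => F v * (v - z)^-1) w.
  move=> fw; apply: ccontM.
    by have [/Fd[l /cdiff_ccont]] := fw.
  by apply: kernel_ccont; have [] := frw _ fw.
have side (U : R -> C) lo hi lo' hi' : lo' <= lo -> hi <= hi' ->
    (forall t, lo <= t <= hi -> frame x1 x2 y1 y2 (U t)) ->
    (forall t, lo' <= t <= hi' -> disc (U t)) ->
    measurable_fun `[lo', hi'] (fun t => normc (F (U t))) ->
    (\int[mu]_(t in `[lo', hi']) (normc (F (U t)))%:E <= c%:E)%E ->
    (\int[mu]_(t in `[lo, hi]) (normc (F (U t) * (U t - z)^-1))%:E <= (2 / s * c)%R%:E)%E.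
  move=> lolo hihi fU dU mU Hc.
  have s20 : 0 <= 2 / s by rewrite divr_ge0// ltW.
  apply: (@le_trans _ _ (\int[mu]_(t in `[lo', hi']) ((2 / s)%R%:E * (normc (F (U t)))%:E))%E).
    apply: le_integral_ge0.
    - by move=> t /=; rewrite !in_itv/= => /andP[lt th]; rewrite (le_trans lolo lt) (le_trans th hihi).
    - by move=> t _; rewrite lee_fin normc_ge0.
    - by move=> t _; rewrite -EFinM lee_fin mulr_ge0// normc_ge0.
    - move=> t /=; rewrite in_itv/= => /fU /frw[_ H].
      by rewrite -EFinM lee_fin normcM mulrC ler_wpM2r ?normc_ge0.
  rewrite ge0_integralZl//.
  - by rewrite (EFinM (2 / s) c) lee_wpmul2l.
  - exact/measurable_EFinP.
  - by move=> t _; rewrite lee_fin normc_ge0.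
have mh y : b - s <= y <= b + s -> measurable_fun `[a - s, a + s] (fun t => normc (F (t +i* y))).
  move=> yb; apply: subspace_continuous_measurable_fun => //.
  apply: continuous_in_subspaceT => t; rewrite inE/= in_itv/= => ta.
  by apply: (@rcont_normc _ (fun t => F (t +i* y)) t); apply/ccont_h/holo_ccont => //; apply: inD.
have mv x : a - s <= x <= a + s -> measurable_fun `[b - s, b + s] (fun t => normc (F (x +i* t))).
  move=> xa; apply: subspace_continuous_measurable_fun => //.
  apply: continuous_in_subspaceT => t; rewrite inE/= in_itv/= => tb.
  by apply: (@rcont_normc _ (fun t => F (x +i* t)) t); apply/ccont_v/holo_ccont => //; apply: inD.
have Hx1 : a - s <= x1 <= a + s by apply/andP; split; clear -s0 x1l x1h; lra.
have Hx2 : a - s <= x2 <= a + s by apply/andP; split; clear -s0 x2l x2h; lra.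
have Hy1 : b - s <= y1 <= b + s by apply/andP; split; clear -s0 y1l y1h; lra.
have Hy2 : b - s <= y2 <= b + s by apply/andP; split; clear -s0 y2l y2h; lra.
have H : normc (F z * (0 +i* (2 * pi))) <= 8 * (2 / s * c).
  rewrite -CF; apply: normc_le_rint => //.
  - apply: (side (fun t => t +i* y1)) (mh _ Hy1) Ay1; [clear -s0 x1l x1h x2l x2h y1l y1h y2l y2h; lra|clear -s0 x1l x1h x2l x2h y1l y1h y2l y2h; lra| |].
      by move=> t ?; exact: frame_b.
    by move=> t ?; apply: inD; split.
  - apply: (side (fun t => t +i* y2)) (mh _ Hy2) Ay2; [clear -s0 x1l x1h x2l x2h y1l y1h y2l y2h; lra|clear -s0 x1l x1h x2l x2h y1l y1h y2l y2h; lra| |].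
      by move=> t ?; exact: frame_t.
    by move=> t ?; apply: inD; split.
  - apply: (side (fun t => x1 +i* t)) (mv _ Hx1) Bx1; [clear -s0 x1l x1h x2l x2h y1l y1h y2l y2h; lra|clear -s0 x1l x1h x2l x2h y1l y1h y2l y2h; lra| |].
      by move=> t ?; exact: frame_l.
    by move=> t ?; apply: inD; split.
  - apply: (side (fun t => x2 +i* t)) (mv _ Hx2) Bx2; [clear -s0 x1l x1h x2l x2h y1l y1h y2l y2h; lra|clear -s0 x1l x1h x2l x2h y1l y1h y2l y2h; lra| |].
      by move=> t ?; exact: frame_r.
    by move=> t ?; apply: inD; split.
rewrite normcM normc_tpi in H.
have pi2 := pi_ge2 R.
have -> : 64 / s ^+ 2 * (j + e') = 8 * (2 / s * c) * 2.
  by rewrite /c; field; rewrite gt_eqF.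
by move: (normc_ge0 (F z)) H; clear -pi2; nra.
Qed.

End Submean.

Section SubmeanPower.
Context {R : realType}.
Local Notation C := R[i].
Local Notation mu := (@lebesgue_measure R).
Local Notation mu2 := (mu \x mu)%E.
Local Notation R2 := (measurableTypeR R * measurableTypeR R)%type.
Implicit Types (F : C -> C) (z w : C) (p s : R).

Lemma gt0_powRD (x r t : R) : 0 < x -> x `^ (r + t) = x `^ r * x `^ t.
Proof. by move=> x0; rewrite powRD// (gt_eqF x0) implybT. Qed.

Lemma mu2_sq2 z s : 0 <= s -> mu2 (sq2 z s) = (4 * s ^+ 2)%:E.
Proof.
move=> s0; have -> : mu2 (sq2 z s) = (mu `[(complex.Re z - s)%R, (complex.Re z + s)%R]%classic *
    mu `[(complex.Im z - s)%R, (complex.Im z + s)%R]%classic)%E.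
  by apply: product_measure1E; exact: measurable_itv.
rewrite lebesgue_itvcc; last by lra.
rewrite lebesgue_itvcc; last by lra.
by rewrite -EFinM; congr EFin; ring.
Qed.

Lemma holo_measurable_powR F (U : set R2) p : holo_disc F -> measurable U -> U `<=` D2 ->
  measurable_fun U (fun w : R2 => normc (F (cpt w)) `^ p).
Proof.
move=> Fh mU UD.
exact: (measurableT_comp (measurable_powR p) (holo_measurable Fh mU UD)).
Qed.

(** The integral is not divided by the area of the square; the factor [s^(-2)] appears in the
    submean inequalities. *)
Definition pmean F z s p : \bar R := (\int[mu2]_(w in sq2 z s) (normc (F (cpt w)) `^ p)%:E)%E.

(* Convexity enters through [x <= l + l^(1 - p) x^p] for all [l > 0]. *)
Lemma submean_ge1 F z s p : 1 <= p -> holo_disc F -> 0 < s -> normc z + 2 * s < 1 ->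
  ((normc (F z) `^ p)%:E <= ((8 * 64) `^ p / s ^+ 2)%:E * pmean F z s p)%E.
Proof.
move=> p1 Fh s0 zs; have p0 : 0 < p by apply: lt_le_trans p1.
have K0 : 0 < (8 * 64) `^ p / s ^+ 2 by rewrite divr_gt0 ?powR_gt0 ?exprn_gt0.
have J0 : (0 <= pmean F z s p)%E by apply: integral_ge0 => w _; rewrite lee_fin powR_ge0.
have [Jy|Jfin] := eqVneq (pmean F z s p) +oo%E.
  by rewrite Jy gt0_muley ?lte_fin// leey.
have {}Jfin : pmean F z s p \is a fin_num by rewrite ge0_fin_numE// ltey.
have := submean1 Fh s0 zs.
set j := fine (pmean F z s p); have JE : pmean F z s p = j%:E by rewrite /j fineK.
have [->|Fz0] := eqVneq (normc (F z)) 0.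
  by move=> _; rewrite powR0 ?gt_eqF// mule_ge0// lee_fin ltW.
have {}Fz0 : 0 < normc (F z) by rewrite lt_def Fz0 normc_ge0.
(* With this value the term [l] contributes exactly [|F z| / 2] to the bound of [submean1], and is
   absorbed on the left. *)
pose l := normc (F z) / (8 * 64).
have l0 : 0 < l by rewrite divr_gt0.
have mFp := holo_measurable_powR p Fh (measurable_sq2 z s) (sq2_disc zs).
have I1 : (\int[mu2]_(w in sq2 z s) (normc (F (cpt w)))%:E <=
    (l * (4 * s ^+ 2) + l `^ (1 - p) * j)%:E)%E.
  apply: (@le_trans _ _ (\int[mu2]_(w in sq2 z s) (l%:E + (l `^ (1 - p))%:E * (normc (F (cpt w)) `^ p)%:E))%E).
    apply: le_integral_ge0 => //.
    - by move=> w _; rewrite lee_fin normc_ge0.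
    - by move=> w _; rewrite -EFinM -EFinD lee_fin addr_ge0 ?mulr_ge0 ?powR_ge0// ltW.
    - move=> w _; rewrite -EFinM -EFinD lee_fin.
      set x := normc _; have x0 : 0 <= x by exact: normc_ge0.
      have [xl|lx] := leP x l; first by rewrite ler_wpDr// mulr_ge0 ?powR_ge0.
      have x1 : 0 < x by exact: lt_trans lx.
      apply: ler_wpDl; first exact: ltW.
      have E : x = x `^ p * x `^ (1 - p).
        by rewrite -gt0_powRD// subrKC powRr1.
      rewrite [leLHS]E mulrC ler_wpM2r ?powR_ge0//.
      rewrite -(opprB p) !powRN lef_pV2 ?posrE ?powR_gt0//.
      by apply: ge0_ler_powR; rewrite ?nnegrE ?subr_ge0// ltW.
  rewrite ge0_integralD//=; try solve
    [ exact: measurable_sq2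
    | by move=> w _; rewrite lee_fin ltW
    | by move=> w _; rewrite -EFinM lee_fin mulr_ge0 ?powR_ge0
    | by apply: measurable_funeM; exact/measurable_EFinP].
  rewrite integral_cst//; last exact: measurable_sq2.
  rewrite [X in (_ * X + _)%E](_ : _ = (4 * s ^+ 2)%:E); last exact: mu2_sq2 (ltW s0).
  rewrite ge0_integralZl//; try solve
    [ exact: measurable_sq2 | exact/measurable_EFinP | by rewrite lee_fin powR_ge0
    | by move=> w' _; rewrite lee_fin powR_ge0].
  by rewrite -/(pmean F z s p) JE.
move=> H; have s20 : 0 < s ^+ 2 by rewrite exprn_gt0.
have {}H : normc (F z) <= 64 / s ^+ 2 * (l * (4 * s ^+ 2) + l `^ (1 - p) * j).
  rewrite -lee_fin; apply: le_trans H _; rewrite (EFinM (64 / s ^+ 2)) lee_wpmul2l// lee_fin.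
  by rewrite divr_ge0// ltW.
have {}H : normc (F z) / 2 <= 64 / s ^+ 2 * (l `^ (1 - p) * j).
  rewrite mulrDr in H.
  have E : 64 / s ^+ 2 * (l * (4 * s ^+ 2)) = normc (F z) / 2.
    by rewrite /l; field; rewrite gt_eqF.
  lra.
have lE : l = l `^ p * l `^ (1 - p).
  by rewrite -gt0_powRD// subrKC powRr1// ltW.
have FzE : normc (F z) = (8 * 64) * l by rewrite /l; field.
have lp : l `^ p <= j / s ^+ 2.
  rewrite -(ler_pM2r (x := (4 * 64) * l `^ (1 - p))) ?mulr_gt0 ?powR_gt0//.
  rewrite mulrCA -lE (le_trans (y := normc (F z) / 2))//; first by rewrite FzE; lra.
  apply: le_trans H _.
  rewrite [leRHS](_ : _ = 4 * (64 / s ^+ 2 * (l `^ (1 - p) * j))); last by ring.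
  apply: ler_peMl; last by lra.
  have j0 : 0 <= j by rewrite -lee_fin -JE.
  apply: mulr_ge0; first by rewrite divr_ge0// ltW.
  by rewrite mulr_ge0 ?powR_ge0.
rewrite JE -EFinM lee_fin FzE (@powRM _ (8 * 64) l) ?(ltW l0)//.
rewrite [leRHS](_ : _ = (8 * 64) `^ p * (j / s ^+ 2)); last by ring.
by rewrite ler_wpM2l ?powR_ge0.
Qed.

(* With [dd w] the sup-norm distance from [w] to the boundary of the square, [submean1]
   on the square of half-side [dd w / 2] and the splitting [|F| = |F|^(1 - p) |F|^p] give
   [M <= c M^(1 - p) j] for the supremum [M] of [dd^(2 / p) |F|]. *)
Lemma submean_lt1 F z s p : 0 < p < 1 -> holo_disc F -> 0 < s -> normc z + 2 * s < 1 ->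
  ((normc (F z) `^ p)%:E <= (2 `^ (2 / p) * 64 / s ^+ 2)%:E * pmean F z s p)%E.
Proof.
move=> /andP[p0 p1] Fh s0 zs.
have K0 : 0 < 2 `^ (2 / p) * 64 / s ^+ 2.
  by rewrite divr_gt0 ?mulr_gt0 ?powR_gt0 ?exprn_gt0.
have J0 : (0 <= pmean F z s p)%E by apply: integral_ge0 => w _; rewrite lee_fin powR_ge0.
have [Jy|Jfin] := eqVneq (pmean F z s p) +oo%E.
  by rewrite Jy gt0_muley ?lte_fin// leey.
have {}Jfin : pmean F z s p \is a fin_num by rewrite ge0_fin_numE// ltey.
set j := fine (pmean F z s p); have JE : pmean F z s p = j%:E by rewrite /j fineK.
have j0 : 0 <= j by rewrite -lee_fin -JE.
have q0 : 0 <= 2 / p by rewrite divr_ge0// ltW.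
pose dd w := s - Num.max `|complex.Re (w - z)| `|complex.Im (w - z)|.
have ddle w : dd w <= s by rewrite /dd gerDl oppr_le0 le_max normr_ge0.
have ddz : dd z = s by rewrite /dd subrr /= normr0 maxxx subr0.
have ddP w d : d <= dd w <-> `|complex.Re (w - z)| <= s - d /\ `|complex.Im (w - z)| <= s - d.
  rewrite /dd lerBrDl addrC -lerBrDl ge_max; split; first by move=> /andP[].
  by move=> [-> ->].
have [B HB] : exists B, forall w, square z s w -> normc (F w) <= B.
  have [B HB] := @disc_bounded _ F (normc z + 2 * s) (fun w wr => holo_ccont Fh (le_lt_trans wr zs)).
  by exists B => w /(square_disc (lexx _)); exact: HB.
pose S := [set dd w `^ (2 / p) * normc (F w) | w in square z s].
have zS : square z s z by apply: normc_square; rewrite subrr normc0 ltW.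
have ddsq w : square z s w -> 0 <= dd w.
  by move=> /squareP[? ?]; apply/ddP; rewrite subr0.
have hS : has_sup S.
  split; first by exists (dd z `^ (2 / p) * normc (F z)); exists z.
  exists (s `^ (2 / p) * B) => _ [w wsq <-].
  apply: ler_pM; rewrite ?powR_ge0 ?normc_ge0 ?HB//.
  by apply: ge0_ler_powR; rewrite ?nnegrE ?ddsq ?(ltW s0).
pose M := sup S.
have MS w : square z s w -> dd w `^ (2 / p) * normc (F w) <= M.
  by move=> wsq; apply: sup_upper_bound => //; exists w.
have Mz := MS _ zS; rewrite ddz in Mz.
have M0 : 0 <= M by apply: le_trans Mz; rewrite mulr_ge0 ?powR_ge0 ?normc_ge0.
have main w : square z s w ->
    dd w `^ (2 / p) * normc (F w) <= 2 `^ (2 / p) * 64 * (M `^ (1 - p) * j).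
  move=> wsq; have := ddsq _ wsq; rewrite le_eqVlt => /predU1P[<-|dw0].
    by rewrite powR0 ?mul0r ?mulr_ge0 ?powR_ge0// gt_eqF// divr_gt0.
  pose d := dd w / 2.
  have d0 : 0 < d by rewrite divr_gt0.
  have [wr wi] : `|complex.Re (w - z)| <= s - dd w /\ `|complex.Im (w - z)| <= s - dd w.
    exact/ddP.
  have wd : normc w + 2 * d < 1.
    have := le_normcD (w - z) z; rewrite subrK; have := normc_le_ReIm (w - z).
    by rewrite /d in d0 *; lra.
  have ddv v : square w d v -> d <= dd v.
    move=> /squareP[vr vi]; apply/ddP.
    have -> : v - z = (v - w) + (w - z) by ring.
    rewrite (raddfD (@complex.Re R) (v - w)) (raddfD (@complex.Im R) (v - w)).
    have := ler_normD (complex.Re (v - w)) (complex.Re (w - z)).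
    have := ler_normD (complex.Im (v - w)) (complex.Im (w - z)).
    by move: vr vi wr wi; rewrite /d; clear => *; split; lra.
  have vsq v : square w d v -> square z s v.
    by move=> /ddv vd; apply/squareP; have /ddP[] := vd; move=> *; split; lra.
  have mFz := holo_measurable_powR p Fh (measurable_sq2 z s) (sq2_disc zs).
  have I1 : (\int[mu2]_(v in sq2 w d) (normc (F (cpt v)))%:E <=
      ((M * d `^ (- (2 / p))) `^ (1 - p) * j)%:E)%E.
    set k := (M * _) `^ _; have k0 : 0 <= k by exact: powR_ge0.
    apply: (@le_trans _ _ (\int[mu2]_(v in sq2 z s) (k%:E * (normc (F (cpt v)) `^ p)%:E))%E).
      apply: le_integral_ge0 => //.
      - by move=> v /sq2P/vsq/sq2P.
      - by move=> v _; rewrite lee_fin normc_ge0.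
      - by move=> v _; rewrite -EFinM lee_fin mulr_ge0 ?powR_ge0.
      - move=> v /sq2P vd; rewrite -EFinM lee_fin.
        set x := normc _; have : 0 <= x by exact: normc_ge0.
        rewrite le_eqVlt => /predU1P[<-|x0]; first by rewrite mulr_ge0 ?powR_ge0.
        have E : x = x `^ (1 - p) * x `^ p.
          by rewrite -gt0_powRD// subrK powRr1// ltW.
        rewrite [leLHS]E ler_wpM2r ?powR_ge0//.
        apply: ge0_ler_powR; rewrite ?nnegrE ?subr_ge0 ?(ltW p1) ?(ltW x0)//.
          by rewrite mulr_ge0 ?powR_ge0.
        rewrite powRN ler_pdivlMr ?powR_gt0// mulrC.
        apply: le_trans (MS _ (vsq _ vd)); rewrite ler_wpM2r ?(ltW x0)//.
        by apply: ge0_ler_powR; rewrite ?nnegrE ?ddsq ?(ltW d0) ?ddv//; exact: vsq.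
    rewrite ge0_integralZl//; try solve
    [ exact: measurable_sq2 | exact/measurable_EFinP | by rewrite lee_fin powR_ge0
    | by move=> w' _; rewrite lee_fin powR_ge0].
    by rewrite -/(pmean F z s p) JE.
  have H : normc (F w) <= 64 / d ^+ 2 * ((M * d `^ (- (2 / p))) `^ (1 - p) * j).
    rewrite -lee_fin; apply: le_trans (submean1 Fh d0 wd) _.
    by rewrite (EFinM (64 / d ^+ 2)) lee_wpmul2l// lee_fin divr_ge0// exprn_ge0// ltW.
  have -> : dd w = 2 * d by rewrite /d; field.
  rewrite powRM ?(ltW d0)// -!mulrA ler_wpM2l ?powR_ge0//.
  apply: le_trans (ler_wpM2l (powR_ge0 _ _) H) _.
  rewrite (@powRM _ M (d `^ (- (2 / p)))) ?powR_ge0// -powRrM.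
  (* The exponents [2 / p], [-2] and [-(2 / p) * (1 - p)] add up to zero; this is what singles out
     the weight [dd^(2 / p)]. *)
  have dE : d `^ (2 / p) * (d ^- 2 * d `^ (- (2 / p) * (1 - p))) = 1.
    rewrite -(powR_mulrn 2 (ltW d0)) -powRN -!gt0_powRD//.
    rewrite (_ : _ + _ = 0) ?powRr0//.
    by field; rewrite gt_eqF.
  rewrite [leLHS](_ : _ = (d `^ (2 / p) * (d ^- 2 * d `^ (- (2 / p) * (1 - p)))) *
      (64 * (M `^ (1 - p) * j))); last by ring.
  by rewrite dE mul1r.
have MM : M <= 2 `^ (2 / p) * 64 * (M `^ (1 - p) * j).
  by apply: ge_sup; [case: hS|move=> _ [w wsq <-]; exact: main].
have Mp : M `^ p <= 2 `^ (2 / p) * 64 * j.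
  move: M0; rewrite le_eqVlt => /predU1P[<-|M0].
    by rewrite powR0 ?gt_eqF// mulr_ge0// mulr_ge0 ?powR_ge0.
  rewrite -(ler_pM2r (x := M `^ (1 - p))) ?powR_gt0//.
  rewrite -gt0_powRD// subrKC powRr1 ?(ltW M0)//.
  by apply: le_trans MM _; rewrite le_eqVlt; apply/orP; left; apply/eqP; ring.
rewrite JE -EFinM lee_fin mulrAC ler_pdivlMr ?exprn_gt0//.
apply: le_trans Mp.
have := ge0_ler_powR (ltW p0) _ M0 Mz.
rewrite nnegrE mulr_ge0 ?powR_ge0 ?normc_ge0// => /(_ isT).
rewrite powRM ?powR_ge0 ?normc_ge0// -powRrM divfK ?gt_eqF//.
by rewrite powR_mulrn ?(ltW s0)// mulrC.
Qed.

Lemma submean p : 0 < p -> exists2 K, 0 < K & forall F z s, holo_disc F -> 0 < s ->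
  normc z + 2 * s < 1 ->
  ((normc (F z) `^ p)%:E <= (K / s ^+ 2)%:E * pmean F z s p)%E.
Proof.
move=> p0; have [p1|p1] := leP 1 p.
  by exists ((8 * 64) `^ p); [exact: powR_gt0|move=> *; exact: submean_ge1].
exists (2 `^ (2 / p) * 64); first by rewrite mulr_gt0 ?powR_gt0.
by move=> *; apply: submean_lt1 => //; rewrite p0.
Qed.

End SubmeanPower.

(** * Kernel integrals over the disc *)

Section PowerKernel.
Context {R : realType}.
Local Notation C := R[i].
Local Notation mu := (@lebesgue_measure R).
Local Notation mu2 := (mu \x mu)%E.
Local Notation R2 := (measurableTypeR R * measurableTypeR R)%type.
Implicit Types (k b c L : R).

Lemma integral_cover d (T : measurableType d) (nu : {measure set T -> \bar R})
    (S A B : set T) (f : T -> \bar R) : measurable A -> measurable B ->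
  measurable_fun setT f -> (forall x, 0 <= f x)%E -> S `<=` A `|` B ->
  (\int[nu]_(x in S) f x <= \int[nu]_(x in A) f x + \int[nu]_(x in B) f x)%E.
Proof.
move=> mA mB mf f0 SAB.
apply: (@le_trans _ _ (\int[nu]_(x in A `|` (B `\` A)) f x)%E).
  by apply: le_integral_ge0 => //; rewrite setUDr setDv setD0 //.
rewrite ge0_integral_setU//.
- by rewrite leeD2l//; apply: le_integral_ge0 => // x [].
- exact: measurableD.
- exact: measurable_funTS.
- by rewrite disj_set2E; apply/eqP; rewrite setDE setIC -setIA setICl setI0.
Qed.

(** For integrands singular at an end of the interval: the fundamental theorem on growing compact
    intervals, followed by monotone convergence. *)
Lemma integral_improper_le (f F : R -> R) (l r : nat -> R) (B : R) (S : set (measurableTypeR R)) :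
  nonincreasing_seq l -> nondecreasing_seq r -> (forall x, 0 <= f x) ->
  measurable_fun setT f ->
  (forall i t, l i <= t <= r i -> {for t, continuous f}) ->
  (forall i t, l i <= t <= r i -> is_derive t 1 F (f t)) ->
  (forall i, l i <= r i -> F (r i) - F (l i) <= B) -> 0 <= B ->
  S `<=` \bigcup_i `[l i, r i]%classic ->
  (\int[mu]_(x in S) (f x)%:E <= B%:E)%E.
Proof.
move=> ld rd f0 mf fc Fd FB B0 SU.
apply: (@le_trans _ _ (\int[mu]_(x in \bigcup_i `[l i, r i]%classic) (f x)%:E)%E).
  by apply: le_integral_ge0 => // x _; rewrite lee_fin.
have H : (\int[mu]_(x in `[l i, r i]) (f x)%:E)%E @[i --> \oo] -->
    (\int[mu]_(x in \bigcup_i `[l i, r i]%classic) (f x)%:E)%E.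
  apply: (@ge0_nondecreasing_set_cvg_integral _ (measurableTypeR R) R (fun i => `[l i, r i]%classic) (EFin \o f) mu).
  - move=> i j ij; apply/subsetPset => x /=; rewrite !in_itv/= => /andP[lx xr].
    by rewrite (le_trans (ld _ _ ij) lx) (le_trans xr (rd _ _ ij)).
  - by move=> i; exact: measurable_itv.
  - by move=> i; apply/measurable_EFinP; exact: measurable_funTS.
  - by move=> i x _; rewrite lee_fin.
rewrite -(cvg_lim _ H)//; apply: lime_le; first by apply/cvg_ex; eexists; exact: H.
apply: nearW => i; have [lr|rl] := leP (l i) (r i); last first.
  by rewrite set_itv_ge ?integral_set0 ?lee_fin// bnd_simp -ltNge.
have iN : mu.-integrable `[l i, r i] (EFin \o f).
  by apply: continuous_segment_integrable => t; exact: fc.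
rewrite -(@fineK _ (\int[mu]_(t in `[l i, r i]) _)%E); last exact: integrable_fin_num.
rewrite lee_fin; apply: le_trans (FB _ lr).
by rewrite -(Rintegral_ftc lr (fc i) (Fd i)).
Qed.

(** For nonzero [k] the value at [x = b] is the default 0 and not infinity, so pointwise bounds by
    [rpow] are asserted away from one point. *)
Definition rpow k b (x : R) := `|x - b| `^ (- k).

Lemma measurable_rpow k b : measurable_fun setT (rpow k b).
Proof.
apply: (measurableT_comp (measurable_powR (- k))).
apply: measurableT_comp => //.
exact: measurable_funB.
Qed.

Lemma rpow_continuous k b t : t != b -> {for t, continuous (rpow k b)}.
Proof.
move=> tb; have tb0 : 0 < `|t - b| by rewrite normr_gt0 subr_eq0.
apply: (@continuous_comp _ _ _ (fun x => `|x - b|) (fun y => y `^ (- k)) t).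
  apply: continuous_comp; last exact: norm_continuous.
  by apply: continuousB; [exact: cvg_id|exact: cst_continuous].
have [+ _] := is_derive1_powR (- k) tb0.
by move=> /derivable1_diffP/differentiable_continuous.
Qed.

Lemma rpow_right k b L : 0 <= k < 1 -> 0 < L ->
  (\int[mu]_(x in `]b, (b + L)%R]) (rpow k b x)%:E <= (L `^ (1 - k) / (1 - k))%:E)%E.
Proof.
move=> /andP[k0 k1] L0; have k1' : 0 < 1 - k by lra.
apply: (@integral_improper_le _ (fun x => (x - b) `^ (1 - k) / (1 - k))
  (fun i => b + i.+1%:R^-1) (fun=> b + L)).
- by move=> i j ij; rewrite lerD2l lef_pV2 ?posrE// ler_nat.
- by [].
- by move=> x; exact: powR_ge0.
- exact: measurable_rpow.
- move=> i t /= /andP[lt _]; apply: rpow_continuous.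
  by rewrite gt_eqF// (lt_le_trans _ lt)// ltrDl.
- move=> i t /= /andP[lt _].
  have tb : 0 < t - b by rewrite subr_gt0 (lt_le_trans _ lt)// ltrDl.
  have D : is_derive t 1 (fun x => x - b) 1.
    by apply: is_derive_eq; rewrite subr0.
  have := is_deriveZ (1 - k)^-1 (@is_derive1_comp _ (fun y : R => y `^ (1 - k)) (fun x => x - b) t _ _
    (is_derive1_powR (1 - k) tb) D).
  have -> : (1 - k)^-1 \*: ((fun y : R => y `^ (1 - k)) \o (fun x => x - b)) =
    (fun x => (x - b) `^ (1 - k) / (1 - k)).
    by apply/funext => x /=; rewrite mulrC.
  move=> DH; apply: (is_derive_eq DH); rewrite /GRing.scale /= /rpow gtr0_norm// mulr1.
  by rewrite (_ : 1 - k - 1 = - k); [field; rewrite gt_eqF|ring].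
- move=> i _ /=; rewrite lerBlDr (addrC b L) addrK lerDl.
  by rewrite divr_ge0 ?powR_ge0// ltW.
- by rewrite divr_ge0 ?powR_ge0// ltW.
- move=> x /=; rewrite in_itv/= => /andP[bx xL].
  have xb : 0 < x - b by rewrite subr_gt0.
  exists (Num.truncn (x - b)^-1) => //=; rewrite in_itv/= xL andbT.
  rewrite -lerBrDl -[leRHS]invrK lef_pV2 ?posrE ?invr_gt0//.
  exact/ltW/truncnS_gt.
Qed.

Lemma rpow_left k b L : 0 <= k < 1 -> 0 < L ->
  (\int[mu]_(x in `[(b - L)%R, b[) (rpow k b x)%:E <= (L `^ (1 - k) / (1 - k))%:E)%E.
Proof.
move=> /andP[k0 k1] L0; have k1' : 0 < 1 - k by lra.
apply: (@integral_improper_le _ (fun x => - ((b - x) `^ (1 - k) / (1 - k)))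
  (fun=> b - L) (fun i => b - i.+1%:R^-1)).
- by [].
- by move=> i j ij; rewrite lerD2l lerN2 lef_pV2 ?posrE// ler_nat.
- by move=> x; exact: powR_ge0.
- exact: measurable_rpow.
- move=> i t /= /andP[_ lt]; apply: rpow_continuous.
  by rewrite lt_eqF// (le_lt_trans lt)// gtrDl oppr_lt0.
- move=> i t /= /andP[_ lt].
  have tb : 0 < b - t by rewrite subr_gt0 (le_lt_trans lt)// gtrDl oppr_lt0.
  have D : is_derive t 1 (fun x => b - x) (-1).
    by apply: is_derive_eq; ring.
  have := is_deriveZ (- (1 - k)^-1) (@is_derive1_comp _ (fun y : R => y `^ (1 - k)) (fun x => b - x) t _ _
    (is_derive1_powR (1 - k) tb) D).
  have -> : (- (1 - k)^-1) \*: ((fun y : R => y `^ (1 - k)) \o (fun x => b - x)) =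
    (fun x => - ((b - x) `^ (1 - k) / (1 - k))).
    by apply/funext => x /=; rewrite /GRing.scale /= mulNr mulrC.
  move=> DH; apply: (is_derive_eq DH); rewrite /GRing.scale /= /rpow distrC gtr0_norm//.
  by rewrite (_ : 1 - k - 1 = - k); [field; rewrite gt_eqF|ring].
- move=> i _ /=; rewrite opprK (_ : b - (b - L) = L); last by ring.
  rewrite addrC gerDl oppr_le0.
  by rewrite divr_ge0 ?powR_ge0// ltW.
- by rewrite divr_ge0 ?powR_ge0// ltW.
- move=> x /=; rewrite in_itv/= => /andP[xL bx].
  have xb : 0 < b - x by rewrite subr_gt0.
  exists (Num.truncn (b - x)^-1) => //=; rewrite in_itv/= xL /=.
  rewrite lerBrDl addrC -lerBrDl -[leRHS]invrK lef_pV2 ?posrE ?invr_gt0//.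
  exact/ltW/truncnS_gt.
Qed.

Lemma rpow_center k b L : 0 <= k < 1 -> 0 < L ->
  (\int[mu]_(x in `[(b - L)%R, (b + L)%R]) (rpow k b x)%:E <= (2 / (1 - k) * L `^ (1 - k))%:E)%E.
Proof.
move=> k01 L0.
have mf : measurable_fun setT (EFin \o rpow k b) by apply/measurable_EFinP; exact: measurable_rpow.
have f0 x : (0 <= (rpow k b x)%:E)%E by rewrite lee_fin powR_ge0.
have mD : measurable (`[(b - L)%R, (b + L)%R]%classic `\ b : set (measurableTypeR R)).
  by apply: measurableD; [exact: measurable_itv|exact: measurable_set1].
rewrite -(integral_setD1 mD); last exact: measurable_funTS.
apply: (@le_trans _ _ (\int[mu]_(x in `[(b - L)%R, b[) (rpow k b x)%:E +
  \int[mu]_(x in `]b, (b + L)%R]) (rpow k b x)%:E)%E).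
  apply: integral_cover => //.
  move=> x [/=]; rewrite !in_itv/= => /andP[-> ->] /eqP; rewrite andbT.
  by case: ltgtP => // _ _; [left|right].
apply: le_trans (leeD (rpow_left b k01 L0) (rpow_right b k01 L0)) _.
rewrite -EFinD lee_fin le_eqVlt; apply/orP; left; apply/eqP.
by field; case/andP: k01 => _ k1; rewrite subr_eq0 gt_eqF.
Qed.

(** Within distance [L] of [b] the centred estimate applies; elsewhere the integrand is at most
    [L^(-k)]. The bound depends neither on the interval's centre nor on the singularity. *)
Lemma rpow_integral k b c L : 0 <= k < 1 -> 0 < L ->
  (\int[mu]_(x in `[(c - L)%R, (c + L)%R]) (rpow k b x)%:E <=
   ((2 / (1 - k) + 2) * L `^ (1 - k))%:E)%E.
Proof.
move=> k01 L0; have /andP[k0 k1] := k01.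
have mf : measurable_fun setT (EFin \o rpow k b) by apply/measurable_EFinP; exact: measurable_rpow.
have f0 x : (0 <= (rpow k b x)%:E)%E by rewrite lee_fin powR_ge0.
apply: (@le_trans _ _ (\int[mu]_(x in `[(b - L)%R, (b + L)%R]) (rpow k b x)%:E +
  \int[mu]_(x in `[(c - L)%R, (c + L)%R] `\` `[(b - L)%R, (b + L)%R]) (rpow k b x)%:E)%E).
  apply: integral_cover => //.
    by apply: measurableD; exact: measurable_itv.
  by move=> x Sx; have [|] := pselect (`[(b - L)%R, (b + L)%R]%classic x); [left|right].
rewrite mulrDl EFinD; apply: leeD; first exact: rpow_center.
apply: (@le_trans _ _ (\int[mu]_(x in `[(c - L)%R, (c + L)%R]) (L `^ (- k))%:E)%E).
  apply: le_integral_ge0 => [x []//|x _|x _|x [_ /=]].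
  - by rewrite lee_fin powR_ge0.
  - by rewrite lee_fin powR_ge0.
  - rewrite in_itv/= => nx; rewrite lee_fin /rpow !powRN.
    have Lx : L <= `|x - b|.
      by rewrite leNgt; apply/negP; rewrite ltr_norml => /andP[? ?]; apply: nx; apply/andP; split; lra.
    rewrite lef_pV2 ?posrE ?powR_gt0//; last exact: lt_le_trans Lx.
    by apply: ge0_ler_powR; rewrite ?nnegrE// ltW.
rewrite integral_cst//= lebesgue_itvcc; last by lra.
rewrite -EFinM lee_fin le_eqVlt; apply/orP; left; apply/eqP.
rewrite (_ : c + L - (c - L) = 2 * L); last by ring.
by rewrite addrC gt0_powRD// powRr1 ?(ltW L0)//; ring.
Qed.

End PowerKernel.

Lemma ge0_integral_sum4 d (T : measurableType d) (R : realType)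
    (nu : {measure set T -> \bar R}) (D : set T) (f1 f2 f3 f4 : T -> R) (c : R) :
  measurable D -> 0 <= c ->
  [/\ forall w, 0 <= f1 w, forall w, 0 <= f2 w, forall w, 0 <= f3 w & forall w, 0 <= f4 w] ->
  [/\ measurable_fun D f1, measurable_fun D f2, measurable_fun D f3 & measurable_fun D f4] ->
  (\int[nu]_(w in D) (c * (f1 w + f2 w + f3 w + f4 w))%:E =
   c%:E * (\int[nu]_(w in D) (f1 w)%:E + \int[nu]_(w in D) (f2 w)%:E +
           \int[nu]_(w in D) (f3 w)%:E + \int[nu]_(w in D) (f4 w)%:E))%E.
Proof.
move=> mD c0 [p1 p2 p3 p4] [m1 m2 m3 m4].
have intD (f g : T -> R) : (forall w, 0 <= f w) -> (forall w, 0 <= g w) ->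
    measurable_fun D f -> measurable_fun D g ->
    (\int[nu]_(w in D) (f w + g w)%:E = \int[nu]_(w in D) (f w)%:E + \int[nu]_(w in D) (g w)%:E)%E.
  move=> f0 g0 mf mg; rewrite -ge0_integralD//;
    by [move=> w _; rewrite lee_fin|apply/measurable_EFinP].
transitivity (\int[nu]_(w in D) (c%:E * (f1 w + f2 w + f3 w + f4 w)%:E))%E.
  by apply: eq_integral => w _; rewrite EFinM.
have p12 w : 0 <= f1 w + f2 w by rewrite addr_ge0.
have p123 w : 0 <= f1 w + f2 w + f3 w by rewrite addr_ge0.
have m12 : measurable_fun D (fun w => f1 w + f2 w) by exact: measurable_funD.
have m123 : measurable_fun D (fun w => f1 w + f2 w + f3 w) by exact: measurable_funD.
rewrite ge0_integralZl//.
- by rewrite (intD _ f4)// (intD _ f3)// intD.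
- by apply/measurable_EFinP; exact: measurable_funD.
- by move=> w _; rewrite lee_fin addr_ge0.
Qed.

(** * Reduction of boundary weights to singularities on lines *)

Section BoundaryTensor.
Context {R : realType}.
Local Notation C := R[i].
Local Notation mu := (@lebesgue_measure R).
Local Notation mu2 := (mu \x mu)%E.
Local Notation R2 := (measurableTypeR R * measurableTypeR R)%type.
Implicit Types (k b c L : R) (w : R2).

(** The unit circle meets the line at height [y] in the abscissas [X y] and [- X y]. For [|y| > 1]
    the square root takes its default value 0. *)
Let X (y : R) := Num.sqrt (1 - y ^+ 2).

(** Here [(X y - x) (X y + x) = 1 - n^2], and the second factor is at least 1 once [x >= 1 / 2]. *)
Lemma boundary_gap (x y n : R) : 0 <= n < 1 -> x ^+ 2 + y ^+ 2 = n ^+ 2 ->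
  [/\ `|x| < X y, X y <= 1 & (1 / 2 <= x -> X y - x <= 2 * (1 - n))].
Proof.
move=> /andP[n0 n1] xy.
have n2 : n ^+ 2 < 1 by rewrite expr_lt1.
have x2 := sqr_ge0 x; have y2 := sqr_ge0 y.
have X2 : X y ^+ 2 = 1 - y ^+ 2 by rewrite sqr_sqrtr//; lra.
have X0 : 0 <= X y by exact: sqrtr_ge0.
have xX : `|x| < X y.
  by rewrite -(ltr_pXn2r (n := 2)) ?nnegrE// real_normK ?num_real// X2; lra.
split=> //.
  by rewrite -(ler_pXn2r (n := 2)) ?nnegrE// X2 expr1n; lra.
move=> hx; move: xX; rewrite ltr_norml => /andP[_ xX].
nra.
Qed.

(* [1 - |w|] is comparable to the distance from [w] to the circle along one of the
   coordinate axes; this reduces planar integrals to products of integrals over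
   lines. *)
Lemma boundary_singularity w : D2 w -> exists2 b, 0 < b <= 8 * (1 - normc (cpt w)) &
  [\/ b = `|w.1 - X w.2|, b = `|w.1 - - X w.2|, b = `|w.2 - X w.1| | b = `|w.2 - - X w.1| ].
Proof.
rewrite /D2 /disc /=; set n := normc _ => n1.
have n01 : 0 <= n < 1 by rewrite normc_ge0.
have n0 : 0 <= n by exact: normc_ge0.
have xy : w.1 ^+ 2 + w.2 ^+ 2 = n ^+ 2 by rewrite -normc_sqr.
have n0' : 0 <= n by case/andP: n01.
case: w @n n1 n01 n0 xy n0' => x y n n1 n01 n0 /= xy n0'.
have yx : y ^+ 2 + x ^+ 2 = n ^+ 2 by rewrite addrC.
have xy' : (- x) ^+ 2 + y ^+ 2 = n ^+ 2 by rewrite sqrrN.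
have yx' : (- y) ^+ 2 + x ^+ 2 = n ^+ 2 by rewrite sqrrN.
have [x1 _ x3] := boundary_gap n01 xy.
have [_ X1 x3'] := boundary_gap n01 xy'.
have [y1 _ y3] := boundary_gap n01 yx.
have [_ _ y3'] := boundary_gap n01 yx'.
clearbody n; move: x1 y1; rewrite !ltr_norml => /andP[x1 x2] /andP[y1 y2].
have [hx|hx] := leP (1 / 2) x.
  exists (X y - x); first by have := x3 hx; move=> ?; apply/andP; split; lra.
  by apply: Or41; rewrite distrC gtr0_norm// subr_gt0.
have [hx'|hx'] := leP (1 / 2) (- x).
  exists (x + X y); first by have := x3' hx'; move=> ?; apply/andP; split; lra.
  by apply: Or42; rewrite opprK gtr0_norm//; lra.
have [hy|hy] := leP (1 / 2) y.
  exists (X x - y); first by have := y3 hy; move=> ?; apply/andP; split; lra.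
  by apply: Or43; rewrite distrC gtr0_norm// subr_gt0.
have [hy'|hy'] := leP (1 / 2) (- y).
  exists (y + X x); first by have := y3' hy'; move=> ?; apply/andP; split; lra.
  by apply: Or44; rewrite opprK gtr0_norm//; lra.
(* Near the centre all distances in play are comparable to 1: [1 - n >= 1 / 4], while [X y - x < 2].
   This case is responsible for the constant 8. *)
have n4 : 1 / 4 <= 1 - n by nra.
exists (X y - x); first by apply/andP; split; lra.
by apply: Or41; rewrite distrC gtr0_norm// subr_gt0.
Qed.

Lemma le_sum4 (a1 a2 a3 a4 : R) : 0 <= a1 -> 0 <= a2 -> 0 <= a3 -> 0 <= a4 ->
  [/\ a1 <= a1 + a2 + a3 + a4, a2 <= a1 + a2 + a3 + a4,
    a3 <= a1 + a2 + a3 + a4 & a4 <= a1 + a2 + a3 + a4].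
Proof. by move=> *; split; lra. Qed.

(** Adding all four possibilities avoids dividing the disc into regions. *)
Lemma boundary_rpow_le k w : 0 <= k -> D2 w ->
  (1 - normc (cpt w)) `^ (- k) <= 8 `^ k * (rpow k (X w.2) w.1 + rpow k (- X w.2) w.1
    + rpow k (X w.1) w.2 + rpow k (- X w.1) w.2).
Proof.
move=> k0 Dw; have [b /andP[b0 b8] bE] := boundary_singularity Dw.
have n0 : 0 < 1 - normc (cpt w) by rewrite subr_gt0.
have H : (1 - normc (cpt w)) `^ (- k) <= 8 `^ k * b `^ (- k).
  rewrite !powRN ler_pdivlMr ?powR_gt0// ler_pdivrMl ?powR_gt0//.
  rewrite mulrC -powRM ?(ltW n0)//.
  by apply: ge0_ler_powR; rewrite ?nnegrE ?(ltW b0) ?mulr_ge0// ltW.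
apply: le_trans H _; rewrite ler_wpM2l ?powR_ge0//.
have p1 := powR_ge0 `|w.1 - X w.2| (- k).
have p2 := powR_ge0 `|w.1 - - X w.2| (- k).
have p3 := powR_ge0 `|w.2 - X w.1| (- k).
have p4 := powR_ge0 `|w.2 - - X w.1| (- k).
have [s1 s2 s3 s4] := le_sum4 p1 p2 p3 p4.
by case: bE => ->; [exact: s1|exact: s2|exact: s3|exact: s4].
Qed.

Lemma measurable_X : measurable_fun setT X.
Proof.
apply: continuous_measurable_fun => y; apply: continuous_comp; last exact: sqrt_continuous.
by apply: continuousB; [exact: cst_continuous|exact: exprn_continuous].
Qed.

Lemma measurable_rpow2 d (T : measurableType d) k (f g : T -> R) :
  measurable_fun setT f -> measurable_fun setT g ->
  measurable_fun setT (fun v => rpow k (f v) (g v)).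
Proof.
move=> mf mg; apply: (measurableT_comp (measurable_powR (- k))).
apply: measurableT_comp => //.
exact: measurable_funB.
Qed.

Section TensorBound.
Variables (k : R) (P Q : set (measurableTypeR R)) (m1 m2 : R -> R) (B1 B2 B1' B2' : R).
Hypotheses (k0 : 0 <= k) (mP : measurable P) (mQ : measurable Q).
Hypotheses (mm1 : measurable_fun setT m1) (mm2 : measurable_fun setT m2).
Hypotheses (m10 : forall x, 0 <= m1 x) (m20 : forall x, 0 <= m2 x).
Hypotheses (B10 : 0 <= B1) (B20 : 0 <= B2).
Hypotheses (H1 : forall b, (\int[mu]_(x in P) (rpow k b x * m1 x)%:E <= B1%:E)%E)
  (H2 : forall b, (\int[mu]_(y in Q) (rpow k b y * m2 y)%:E <= B2%:E)%E)
  (H1' : (\int[mu]_(x in P) (m1 x)%:E <= B1'%:E)%E)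
  (H2' : (\int[mu]_(y in Q) (m2 y)%:E <= B2'%:E)%E).

Lemma mfst : measurable_fun setT (fun w : R2 => w.1).
Proof. exact: measurable_fst. Qed.
Lemma msnd : measurable_fun setT (fun w : R2 => w.2).
Proof. exact: measurable_snd. Qed.

Lemma tensor_measurable (f g : R2 -> R) : measurable_fun setT f -> measurable_fun setT g ->
  measurable_fun setT (fun w : R2 => rpow k (f w) (g w) * (m1 w.1 * m2 w.2)).
Proof.
move=> mf mg; apply: measurable_funM; first exact: measurable_rpow2.
apply: measurable_funM.
  exact: (measurableT_comp mm1 mfst).
exact: (measurableT_comp mm2 msnd).
Qed.

Lemma rpow_m_ge0 b x (t : R) : 0 <= t -> 0 <= rpow k b x * t.
Proof. by move=> t0; rewrite mulr_ge0 ?powR_ge0. Qed.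

Lemma tensor1 (beta : R -> R) : measurable_fun setT beta ->
  (\int[mu2]_(w in P `*` Q) (rpow k (beta w.2) w.1 * (m1 w.1 * m2 w.2))%:E <=
   (B1 * B2')%:E)%E.
Proof.
move=> mbeta.
rewrite integral_setX2//; last 2 first.
- apply/measurable_EFinP/measurable_funTS; apply: (@tensor_measurable (fun w => beta w.2) (fun w => w.1));
    [exact: (measurableT_comp mbeta msnd)|exact: mfst].
- by move=> w _; rewrite lee_fin rpow_m_ge0// mulr_ge0.
apply: (@le_trans _ _ (\int[mu]_(y in Q) (B1%:E * (m2 y)%:E))%E).
  apply: le_integral_ge0 => //.
  - by move=> y _; apply: integral_ge0 => x _; rewrite lee_fin rpow_m_ge0// mulr_ge0.
  - by move=> y _; rewrite -EFinM lee_fin mulr_ge0.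
  - move=> y _ /=.
    have -> : (\int[mu]_(x in P) (rpow k (beta y) x * (m1 x * m2 y))%:E =
        \int[mu]_(x in P) ((m2 y)%:E * (rpow k (beta y) x * m1 x)%:E))%E.
      by apply: eq_integral => x _; rewrite -EFinM; congr EFin; ring.
    rewrite ge0_integralZl//; try solve [by rewrite lee_fin | by move=> x _; rewrite lee_fin rpow_m_ge0].
      by rewrite muleC lee_wpmul2r ?lee_fin.
    apply/measurable_EFinP/measurable_funTS/measurable_funM => //.
    exact: measurable_rpow.
rewrite ge0_integralZl//; try solve [by rewrite lee_fin | by move=> y _; rewrite lee_fin].
  by rewrite EFinM lee_wpmul2l ?lee_fin.
by apply/measurable_EFinP/measurable_funTS.
Qed.

Lemma tensor2 (beta : R -> R) : measurable_fun setT beta ->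
  (\int[mu2]_(w in P `*` Q) (rpow k (beta w.1) w.2 * (m1 w.1 * m2 w.2))%:E <=
   (B2 * B1')%:E)%E.
Proof.
move=> mbeta.
rewrite integral_setX1//; last 2 first.
- apply/measurable_EFinP/measurable_funTS; apply: (@tensor_measurable (fun w => beta w.1) (fun w => w.2));
    [exact: (measurableT_comp mbeta mfst)|exact: msnd].
- by move=> w _; rewrite lee_fin rpow_m_ge0// mulr_ge0.
apply: (@le_trans _ _ (\int[mu]_(x in P) (B2%:E * (m1 x)%:E))%E).
  apply: le_integral_ge0 => //.
  - by move=> y _; apply: integral_ge0 => x _; rewrite lee_fin rpow_m_ge0// mulr_ge0.
  - by move=> y _; rewrite -EFinM lee_fin mulr_ge0.
  - move=> x _ /=.
    have -> : (\int[mu]_(y in Q) (rpow k (beta x) y * (m1 x * m2 y))%:E =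
        \int[mu]_(y in Q) ((m1 x)%:E * (rpow k (beta x) y * m2 y)%:E))%E.
      by apply: eq_integral => y _; rewrite -EFinM; congr EFin; ring.
    rewrite ge0_integralZl//; try solve [by rewrite lee_fin | by move=> y _; rewrite lee_fin rpow_m_ge0].
      by rewrite muleC lee_wpmul2r ?lee_fin.
    apply/measurable_EFinP/measurable_funTS/measurable_funM => //.
    exact: measurable_rpow.
rewrite ge0_integralZl//; try solve [by rewrite lee_fin | by move=> y _; rewrite lee_fin].
  by rewrite EFinM lee_wpmul2l ?lee_fin.
by apply/measurable_EFinP/measurable_funTS.
Qed.

(** In each of the four terms the singularity concerns a single variable once the other is fixed.
    That variable is integrated first, with a bound uniform in the position of the singularity; the
    position [X] therefore disappears, and a one-variable weight remains. *)
Lemma boundary_tensor_integral :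
  (\int[mu2]_(w in D2 `&` P `*` Q) ((1 - normc (cpt w)) `^ (- k) * (m1 w.1 * m2 w.2))%:E <=
    (8 `^ k * (B1 * B2' + B1 * B2' + B2 * B1' + B2 * B1'))%:E)%E.
Proof.
have mXN : measurable_fun setT (fun y => - X y).
  by apply: measurableT_comp => //; exact: measurable_X.
pose g1 w := rpow k (X w.2) w.1 * (m1 w.1 * m2 w.2).
pose g2 w := rpow k (- X w.2) w.1 * (m1 w.1 * m2 w.2).
pose g3 w := rpow k (X w.1) w.2 * (m1 w.1 * m2 w.2).
pose g4 w := rpow k (- X w.1) w.2 * (m1 w.1 * m2 w.2).
have g0 : [/\ forall w, 0 <= g1 w, forall w, 0 <= g2 w, forall w, 0 <= g3 w & forall w, 0 <= g4 w].
  by split=> w; rewrite rpow_m_ge0// mulr_ge0.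
case: g0 => g10 g20 g30 g40.
have mPQ : measurable (P `*` Q) by exact: measurableX.
have mg1 : measurable_fun setT g1.
  by apply: (@tensor_measurable (fun w => X w.2) (fun w => w.1));
    [exact: (measurableT_comp measurable_X msnd)|exact: mfst].
have mg2 : measurable_fun setT g2.
  by apply: (@tensor_measurable (fun w => - X w.2) (fun w => w.1));
    [exact: (measurableT_comp mXN msnd)|exact: mfst].
have mg3 : measurable_fun setT g3.
  by apply: (@tensor_measurable (fun w => X w.1) (fun w => w.2));
    [exact: (measurableT_comp measurable_X mfst)|exact: msnd].
have mg4 : measurable_fun setT g4.
  by apply: (@tensor_measurable (fun w => - X w.1) (fun w => w.2));
    [exact: (measurableT_comp mXN mfst)|exact: msnd].
apply: (@le_trans _ _ (\int[mu2]_(w in P `*` Q) (8 `^ k * (g1 w + g2 w + g3 w + g4 w))%:E)%E).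
  apply: le_integral_ge0.
  - by move=> w [].
  - by move=> w _; rewrite lee_fin mulr_ge0 ?powR_ge0// mulr_ge0.
  - by move=> w _; rewrite lee_fin mulr_ge0 ?powR_ge0// !addr_ge0.
  - move=> w [Dw _]; rewrite lee_fin /g1 /g2 /g3 /g4.
    rewrite [leRHS](_ : _ = 8 `^ k * (rpow k (X w.2) w.1 + rpow k (- X w.2) w.1
      + rpow k (X w.1) w.2 + rpow k (- X w.1) w.2) * (m1 w.1 * m2 w.2)); last by ring.
    by rewrite ler_wpM2r ?mulr_ge0// boundary_rpow_le.
have G0 : [/\ forall w, 0 <= g1 w, forall w, 0 <= g2 w, forall w, 0 <= g3 w & forall w, 0 <= g4 w].
  by split.
have MG : [/\ measurable_fun (P `*` Q) g1, measurable_fun (P `*` Q) g2,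
    measurable_fun (P `*` Q) g3 & measurable_fun (P `*` Q) g4].
  exact: (And4 (measurable_funTS mg1) (measurable_funTS mg2) (measurable_funTS mg3) (measurable_funTS mg4)).
rewrite (ge0_integral_sum4 _ mPQ (powR_ge0 8 k) G0 MG).
rewrite (EFinM (8 `^ k)) lee_wpmul2l ?lee_fin ?powR_ge0//.
rewrite !EFinD; apply: leeD; first apply: leeD; first apply: leeD.
- exact: (@tensor1 X measurable_X).
- exact: (@tensor1 (fun y => - X y) mXN).
- exact: (@tensor2 X measurable_X).
- exact: (@tensor2 (fun y => - X y) mXN).
Qed.

End TensorBound.

End BoundaryTensor.

(** * Estimates for the kernel 1 / |1 - conj a z| *)

Section KernelEstimates.
Context {R : realType}.
Local Notation C := R[i].
Local Notation mu := (@lebesgue_measure R).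
Local Notation mu2 := (mu \x mu)%E.
Local Notation R2 := (measurableTypeR R * measurableTypeR R)%type.
Implicit Types (k b c e L : R) (a z : C) (w : R2).

Definition den a z : R := normc (1 - (a^*)%C * z).

(** This classical identity underlies both [den_dist] and the formula for [1 - |sigma_a(z)|^2]. *)
Lemma den_sqr a z : den a z ^+ 2 = normc (a - z) ^+ 2 + (1 - normc a ^+ 2) * (1 - normc z ^+ 2).
Proof.
case: a z => [a1 a2] [z1 z2]; rewrite /den.
have -> : 1 - ((a1 +i* a2)^*)%C * (z1 +i* z2) =
    (1 - (a1 * z1 + a2 * z2)) +i* (- (a1 * z2 - a2 * z1)).
  by apply/eqP; rewrite eq_complex /=; apply/andP; split; apply/eqP; ring.
have -> : (a1 +i* a2) - (z1 +i* z2) = (a1 - z1) +i* (a2 - z2) by [].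
by rewrite !normc_sqr; ring.
Qed.

Lemma den_dist a z : disc a -> disc z -> normc (a - z) <= den a z.
Proof.
rewrite /disc /= => a1 z1.
rewrite -(ler_pXn2r (n := 2)) ?nnegrE ?normc_ge0// den_sqr lerDl.
by rewrite mulr_ge0// subr_ge0 expr_le1 ?normc_ge0// ltW.
Qed.

Lemma den_ge a z : disc a -> disc z -> 1 - normc a <= den a z /\ 1 - normc z <= den a z.
Proof.
rewrite /disc /= => a1 z1.
have H : 1 - normc a * normc z <= den a z.
  have := ler_normcB 1 ((a^*)%C * z); rewrite normc1 normcM normc_conj.
  exact.
have := normc_ge0 a; have := normc_ge0 z; split; nra.
Qed.

Lemma den_gt0 a z : disc a -> disc z -> 0 < den a z.
Proof.
move=> a1 z1; have [h _] := den_ge a1 z1; apply: lt_le_trans h.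
by rewrite subr_gt0.
Qed.

(** A point is a null set; this disposes of the points where a negative power has its default value
    0. *)
Lemma integral_le_off_point (S : set (measurableTypeR R)) (f g : R -> R) (r : R) :
  measurable S -> measurable_fun setT f -> (forall x, 0 <= f x) -> (forall x, 0 <= g x) ->
  (forall x, x != r -> f x <= g x) ->
  (\int[mu]_(x in S) (f x)%:E <= \int[mu]_(x in S) (g x)%:E)%E.
Proof.
move=> mS mf f0 g0 fg.
have mD : measurable (S `\ r) by apply: measurableD => //; exact: measurable_set1.
have mfE : measurable_fun (S `\ r) (fun x => (f x)%:E).
  by apply/measurable_EFinP; exact: measurable_funTS.
rewrite -(integral_setD1 mD mfE).
apply: le_integral_ge0 => [x []//|x _|x _|x [_ /= /eqP xr]]; rewrite lee_fin//.
exact: fg.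
Qed.

(** One coordinate's share of [1 / den a z]. The cutoff, used with [e = 1 - |a|], keeps the base
    positive at [x = r], so that the bound on [den] holds at every point; the integral bounds do not
    depend on [e]. *)
Definition trunc e r (x : R) := Num.max `|x - r| e `^ (- (1 / 2)).

Lemma measurable_trunc e r : measurable_fun setT (trunc e r).
Proof.
apply: (measurableT_comp (measurable_powR (- (1 / 2)))).
apply: measurable_maxr => //; apply: measurableT_comp => //.
exact: measurable_funB.
Qed.

Lemma trunc_integral e r c L : 0 < e -> 0 < L ->
  (\int[mu]_(x in `[(c - L)%R, (c + L)%R]) (trunc e r x)%:E <= (6 * L `^ (1 / 2))%:E)%E.
Proof.
move=> e0 L0.
have k01 : 0 <= (1 / 2 : R) < 1 by apply/andP; split; lra.
have := rpow_integral r c k01 L0.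
rewrite (_ : 2 / (1 - 1 / 2) + 2 = 6); last by field.
rewrite (_ : 1 - 1 / 2 = 1 / 2); last by field.
apply: le_trans; apply: (@integral_le_off_point _ _ _ r) => //.
- exact: measurable_trunc.
- by move=> x; exact: powR_ge0.
- by move=> x; exact: powR_ge0.
- move=> x xr; rewrite /trunc /rpow !powRN.
  have h : 0 < `|x - r| by rewrite normr_gt0 subr_eq0.
  have h2 : 0 < Num.max `|x - r| e by rewrite lt_max h.
  rewrite lef_pV2 ?posrE ?powR_gt0//.
  by apply: ge0_ler_powR; rewrite ?nnegrE ?(ltW h2)// le_max lexx.
Qed.

(** A product of singularities of exponents 1/4 and 1/2 is dominated, according to which singular
    point is nearer, by a singularity of exponent 3/4 at one of the two. *)
Lemma rpow_trunc_integral e r b c L : 0 < e -> 0 < L ->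
  (\int[mu]_(x in `[(c - L)%R, (c + L)%R]) (rpow (1 / 4) b x * trunc e r x)%:E <=
    (20 * L `^ (1 / 4))%:E)%E.
Proof.
move=> e0 L0.
have k01 : 0 <= (3 / 4 : R) < 1 by apply/andP; split; lra.
have I (b' : R) := rpow_integral b' c k01 L0.
apply: (@le_trans _ _ (\int[mu]_(x in `[(c - L)%R, (c + L)%R])
    (rpow (3 / 4) b x + rpow (3 / 4) r x)%:E)%E).
  apply: (@integral_le_off_point _ _ _ r) => //.
  - by apply: measurable_funM; [exact: measurable_rpow|exact: measurable_trunc].
  - by move=> x; rewrite mulr_ge0 ?powR_ge0.
  - by move=> x; rewrite addr_ge0 ?powR_ge0.
  - move=> x xr; have [->|xb] := eqVneq x b.
      have n4 : - (1 / 4) != 0 :> R by rewrite lt_eqF//; lra.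
      by rewrite {1}/rpow subrr normr0 (powR0 n4) mul0r addr_ge0 ?powR_ge0.
    set u := `|x - b|; set v := `|x - r|.
    have u0 : 0 < u by rewrite normr_gt0 subr_eq0.
    have v0 : 0 < v by rewrite normr_gt0 subr_eq0.
    have tv : trunc e r x <= v `^ (- (1 / 2)).
      have h2 : 0 < Num.max v e by rewrite lt_max v0.
      rewrite /trunc !powRN lef_pV2 ?posrE ?powR_gt0//.
      by apply: ge0_ler_powR; rewrite ?nnegrE ?(ltW h2) ?(ltW v0)// le_max lexx.
    rewrite /rpow -/u -/v; apply: le_trans (ler_wpM2l (powR_ge0 _ _) tv) _.
    have E (y : R) : 0 < y -> y `^ (- (3 / 4)) = y `^ (- (1 / 4)) * y `^ (- (1 / 2)).
      by move=> y0; rewrite -gt0_powRD//; congr powR; field.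
    have [uv|vu] := leP u v.
      rewrite ler_wpDr ?powR_ge0// E// ler_wpM2l ?powR_ge0//.
      by rewrite !powRN lef_pV2 ?posrE ?powR_gt0// ge0_ler_powR ?nnegrE// ltW.
    rewrite ler_wpDl ?powR_ge0// E// ler_wpM2r ?powR_ge0//.
    by rewrite !powRN lef_pV2 ?posrE ?powR_gt0// ge0_ler_powR ?nnegrE// ltW.
under eq_integral do rewrite EFinD.
rewrite ge0_integralD//; try solve [by move=> x _; rewrite lee_fin powR_ge0
  | by apply/measurable_EFinP/measurable_funTS; exact: measurable_rpow].
apply: le_trans (leeD (I b) (I r)) _.
rewrite -EFinD lee_fin le_eqVlt; apply/orP; left; apply/eqP.
by rewrite (_ : 1 - 3 / 4 = 1 / 4); [field|field].
Qed.

(** [den] dominates both coordinate distances to [a] as well as [1 - |a|], so its inverse is at most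
    a product of two functions [trunc]. The exponent 3/4 is 2 - 1/4 - 1, as scaling dictates. *)
Lemma carleson_kernel a (c : C) L : disc a -> 0 < L ->
  (\int[mu2]_(w in D2 `&` sq2 c L)
      ((1 - normc (cpt w)) `^ (- (1 / 4)) * (den a (cpt w))^-1)%:E <=
   (8 `^ (1 / 4) * (20 * 24) * L `^ (3 / 4))%:E)%E.
Proof.
move=> ad L0; pose e := 1 - normc a.
have e0 : 0 < e by rewrite subr_gt0.
pose m1 := trunc e (complex.Re a); pose m2 := trunc e (complex.Im a).
have pos k x : 0 <= trunc e k x by exact: powR_ge0.
apply: (@le_trans _ _ (\int[mu2]_(w in D2 `&` sq2 c L)
      ((1 - normc (cpt w)) `^ (- (1 / 4)) * (m1 w.1 * m2 w.2))%:E)%E).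
  apply: le_integral_ge0 => //.
  - by move=> w _; rewrite lee_fin mulr_ge0 ?powR_ge0// invr_ge0 normc_ge0.
  - by move=> w _; rewrite lee_fin mulr_ge0 ?powR_ge0// mulr_ge0 ?pos.
  - move=> w [Dw _]; rewrite lee_fin ler_wpM2l ?powR_ge0//.
    have d0 := den_gt0 ad Dw; have [ed _] := den_ge ad Dw.
    have dd := den_dist ad Dw.
    have -> : (den a (cpt w))^-1 = den a (cpt w) `^ (- (1 / 2)) * den a (cpt w) `^ (- (1 / 2)).
      by rewrite -gt0_powRD// -(powR_inv1 (ltW d0)); congr powR; field.
    have le (x r : R) : `|x - r| <= normc (a - cpt w) ->
        den a (cpt w) `^ (- (1 / 2)) <= trunc e r x.
      move=> h; have h2 : 0 < Num.max `|x - r| e by rewrite lt_max e0 orbT.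
      rewrite /trunc !powRN lef_pV2 ?posrE ?powR_gt0//.
      apply: ge0_ler_powR; rewrite ?nnegrE ?(ltW h2) ?(ltW d0)// ge_max.
      by rewrite (le_trans h dd).
    apply: ler_pM; rewrite ?powR_ge0//; apply: le.
      by have := normc_Re (a - cpt w); rewrite raddfB /= distrC.
    by have := normc_Im (a - cpt w); rewrite raddfB /= distrC.
have k0 : 0 <= (1 / 4 : R) by lra.
have B0 : 0 <= 20 * L `^ (1 / 4) by rewrite mulr_ge0// powR_ge0.
apply: le_trans (boundary_tensor_integral k0 (measurable_itv _) (measurable_itv _)
  (measurable_trunc e (complex.Re a)) (measurable_trunc e (complex.Im a)) (pos _) (pos _) B0 B0
  (fun b => rpow_trunc_integral (complex.Re a) b (complex.Re c) e0 L0)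
  (fun b => rpow_trunc_integral (complex.Im a) b (complex.Im c) e0 L0)
  (trunc_integral (complex.Re a) (complex.Re c) e0 L0)
  (trunc_integral (complex.Im a) (complex.Im c) e0 L0)) _.
rewrite lee_fin le_eqVlt; apply/orP; left; apply/eqP.
rewrite (_ : 3 / 4 = 1 / 4 + 1 / 2); last by field.
by rewrite gt0_powRD//; ring.
Qed.

(** The Poisson kernel of a half-plane scaled to have maximum 1; its mass is then of order [e]. *)
Definition poisson e r (x : R) := e ^+ 2 / ((x - r) ^+ 2 + e ^+ 2).

Lemma poisson_ge0 e r x : 0 <= poisson e r x.
Proof. by rewrite divr_ge0 ?sqr_ge0// addr_ge0 ?sqr_ge0. Qed.

Lemma poisson_le1 e r x : 0 < e -> poisson e r x <= 1.
Proof.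
move=> e0; rewrite ler_pdivrMr ?mul1r ?lerDr ?sqr_ge0//.
by rewrite ltr_wpDl ?sqr_ge0// exprn_gt0.
Qed.

Lemma poisson_continuous e r x : 0 < e -> {for x, continuous (poisson e r)}.
Proof.
move=> e0; apply: continuousM; first exact: cst_continuous.
apply: continuousV; first by rewrite gt_eqF// ltr_wpDl ?sqr_ge0// exprn_gt0.
by apply: differentiable_continuous; apply/derivable1_diffP.
Qed.

Lemma measurable_poisson e r : 0 < e -> measurable_fun setT (poisson e r).
Proof. by move=> e0; apply: continuous_measurable_fun => x; exact: poisson_continuous. Qed.

Lemma poisson_integral e r : 0 < e ->
  (\int[mu]_(x in `[(-1)%R, 1%R]) (poisson e r x)%:E <= (pi * e)%:E)%E.
Proof.
move=> e0; have iN : mu.-integrable `[(-1)%R, 1%R] (EFin \o poisson e r).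
  by apply: continuous_segment_integrable => t _; exact: poisson_continuous.
rewrite -(@fineK _ (\int[mu]_(t in `[(-1)%R, 1%R]) _)%E); last exact: integrable_fin_num.
rewrite lee_fin -/(Rintegral _ _ _).
have -> : \int[mu]_(x in `[(-1)%R, 1%R]) poisson e r x =
    e * (atan ((1 - r) / e) - atan ((-1 - r) / e)).
  have m11 : (-1 : R) <= 1 by lra.
  rewrite -(Rintegral_poisson r e0 m11) -RintegralZl//.
    by apply: eq_Rintegral => x _; rewrite /poisson mulrA.
  apply: (@continuous_segment_integrable _ (fun t => e / ((t - r) ^+ 2 + e ^+ 2))) => t _.
  apply: continuousM; first exact: cst_continuous.
  apply: continuousV; first by rewrite gt_eqF// ltr_wpDl ?sqr_ge0// exprn_gt0.
  by apply: differentiable_continuous; apply/derivable1_diffP.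
rewrite mulrC ler_wpM2r ?(ltW e0)//.
have := atan_ltpi2 ((1 - r) / e); have := atan_gtNpi2 ((-1 - r) / e).
lra.
Qed.

(** Within [e] of [b] the factor [poisson] is replaced by 1, and farther away [rpow] by [e^(-k)]. *)
Lemma rpow_poisson_integral k b e r : 0 <= k < 1 -> 0 < e ->
  (\int[mu]_(x in `[(-1)%R, 1%R]) (rpow k b x * poisson e r x)%:E <=
    ((2 / (1 - k) + pi) * e `^ (1 - k))%:E)%E.
Proof.
move=> k01 e0.
have mf : measurable_fun setT (fun x => (rpow k b x * poisson e r x)%:E).
  by apply/measurable_EFinP/measurable_funM; [exact: measurable_rpow|exact: measurable_poisson].
have f0 x : (0 <= (rpow k b x * poisson e r x)%:E)%E.
  by rewrite lee_fin mulr_ge0 ?powR_ge0 ?poisson_ge0.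
apply: (@le_trans _ _ (\int[mu]_(x in `[(b - e)%R, (b + e)%R]) (rpow k b x * poisson e r x)%:E +
  \int[mu]_(x in `[(-1)%R, 1%R] `\` `[(b - e)%R, (b + e)%R]) (rpow k b x * poisson e r x)%:E)%E).
  apply: integral_cover => //.
    by apply: measurableD; exact: measurable_itv.
  by move=> x Sx; have [|] := pselect (`[(b - e)%R, (b + e)%R]%classic x); [left|right].
rewrite mulrDl EFinD; apply: leeD.
  apply: le_trans (rpow_center b k01 e0).
  apply: le_integral_ge0 => // x _; rewrite lee_fin ?powR_ge0//.
  by rewrite ler_piMr ?powR_ge0 ?poisson_le1.
apply: (@le_trans _ _ (\int[mu]_(x in `[(-1)%R, 1%R]) ((e `^ (- k))%:E * (poisson e r x)%:E))%E).
  apply: le_integral_ge0 => [x []//|x _|x _|x [_ /=]] //.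
    by rewrite -EFinM lee_fin mulr_ge0 ?powR_ge0 ?poisson_ge0.
  rewrite in_itv/= => nx; rewrite -EFinM lee_fin ler_wpM2r ?poisson_ge0//.
  have ex : e <= `|x - b|.
    by rewrite leNgt; apply/negP; rewrite ltr_norml => /andP[? ?]; apply: nx; apply/andP; split; lra.
  rewrite /rpow !powRN lef_pV2 ?posrE ?powR_gt0//; last exact: lt_le_trans ex.
  by case/andP: k01 => k0 _; apply: ge0_ler_powR; rewrite ?nnegrE// ltW.
have mp : measurable_fun (`[(-1)%R, 1%R]%classic : set (measurableTypeR R)) (fun x => (poisson e r x)%:E).
  by apply/measurable_EFinP; exact: measurable_funTS (measurable_poisson r e0).
rewrite ge0_integralZl//; try solve [exact: mp | by rewrite lee_fin powR_ge0
  | by move=> x _; rewrite lee_fin poisson_ge0].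
have ek0 : (0 <= (e `^ (- k))%:E :> \bar R)%E by rewrite lee_fin powR_ge0.
apply: le_trans (lee_wpmul2l ek0 (poisson_integral r e0)) _.
rewrite -EFinM lee_fin le_eqVlt; apply/orP; left; apply/eqP.
by rewrite addrC gt0_powRD// powRr1 ?(ltW e0)//; ring.
Qed.

End KernelEstimates.

(** * A Forelli-Rudin estimate *)

Section ForelliRudin.
Context {R : realType}.
Local Notation C := R[i].
Local Notation mu := (@lebesgue_measure R).
Local Notation mu2 := (mu \x mu)%E.
Local Notation R2 := (measurableTypeR R * measurableTypeR R)%type.
Implicit Types (a z : C) (w : R2).

(** Each coordinate uses two of the four powers: [den^2] dominates both [e^2] and the squared
    coordinate distance, hence half their sum. *)
Lemma den_quartic a z : disc a -> disc z ->
  ((1 - normc a) / den a z) ^+ 4 <=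
  4 * (poisson (1 - normc a) (complex.Re a) (complex.Re z) *
       poisson (1 - normc a) (complex.Im a) (complex.Im z)).
Proof.
move=> ad zd; set e := 1 - normc a.
have e0 : 0 < e by rewrite subr_gt0.
have d0 := den_gt0 ad zd; have [ed _] := den_ge ad zd; have dd := den_dist ad zd.
have half (x r : R) : `|x - r| <= den a z -> (e / den a z) ^+ 2 <= 2 * poisson e r x.
  move=> h; rewrite /poisson mulrA exprMn exprVn ler_pdivlMr; last first.
    by rewrite ltr_wpDl ?sqr_ge0// exprn_gt0.
  rewrite -mulrA mulrC -mulrA ler_pdivrMl ?exprn_gt0//.
  have h1 : (x - r) ^+ 2 <= den a z ^+ 2.
    by rewrite -[leLHS]real_normK ?num_real// lerXn2r ?nnegrE ?(ltW d0).
  have h2 : e ^+ 2 <= den a z ^+ 2 by rewrite lerXn2r ?nnegrE ?(ltW d0) ?(ltW e0).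
  by nra.
have p1 := half (complex.Re z) (complex.Re a).
have p2 := half (complex.Im z) (complex.Im a).
have -> : ((e / den a z) ^+ 4) = (e / den a z) ^+ 2 * (e / den a z) ^+ 2 by rewrite -exprD.
rewrite [leRHS](_ : _ = (2 * poisson e (complex.Re a) (complex.Re z)) *
  (2 * poisson e (complex.Im a) (complex.Im z))); last by ring.
apply: ler_pM; rewrite ?sqr_ge0//.
  apply: p1; apply: le_trans dd.
  by have := normc_Re (a - z); rewrite raddfB /= distrC.
apply: p2; apply: le_trans dd.
by have := normc_Im (a - z); rewrite raddfB /= distrC.
Qed.

Lemma powR_antitone (x y k : R) : 0 <= k -> 0 < x -> x <= y -> y `^ (- k) <= x `^ (- k).
Proof.
move=> k0 x0 xy; have y0 := lt_le_trans x0 xy.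
by rewrite !powRN lef_pV2 ?posrE ?powR_gt0// ge0_ler_powR ?nnegrE// ltW.
Qed.

Lemma powR_comparable (x y c q : R) : 1 <= c -> 0 < x -> 0 < y -> x <= c * y -> y <= c * x ->
  x `^ q <= c `^ `|q| * y `^ q.
Proof.
move=> c1 x0 y0 xy yx; have c0 : 0 < c by lra.
have [q0|q0] := leP 0 q.
  rewrite ger0_norm// -powRM ?(ltW c0) ?(ltW y0)//.
  by rewrite ge0_ler_powR ?nnegrE ?mulr_ge0 ?(ltW c0) ?(ltW y0) ?(ltW x0).
rewrite ltr0_norm// -[in x `^ q](opprK q) -[in y `^ q](opprK q).
have H := @powR_antitone y (c * x) (- q) ltac:(lra) y0 yx.
move: H; rewrite powRM ?(ltW c0) ?(ltW x0)// [X in X * _ <= _]powRN ler_pdivrMl ?powR_gt0//.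
Qed.

(** The factor [(1 - |a|)^(N p - 1)] normalises the classical integral so that the bound is uniform
    in [a]. It bounds the Dirichlet energy of the test functions. *)
Lemma forelli_rudin (p N : R) : 0 < p -> 4 <= N * p ->
  exists2 A, 0 < A & forall a, disc a ->
  (\int[mu2]_(w in D2) ((1 - normc (cpt w) ^+ 2) `^ (p - 1) *
     ((1 - normc a) `^ (N * p - 1) * den a (cpt w) `^ (- (N * p + p))))%:E <= A%:E)%E.
Proof.
move=> p0 Np.
(* The singular part of the weight [(1 - |w|)^(p - 1)]: what is left has the nonnegative exponent
   [p - 1 + k], and [k < 1] because [p > 0]. *)
pose k := Num.max (1 - p) 0.
have k01 : 0 <= k < 1 by rewrite /k le_max lexx orbT gt_max ltr01 andbT; lra.
have [k0 k1] := andP k01.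
have pk : 0 <= p - 1 + k by rewrite /k -lerBlDl maxElt; case: ifP; lra.
clearbody k.
pose K := 2 `^ `|p - 1| * 4.
have K0 : 0 < K by rewrite mulr_gt0 ?powR_gt0.
pose B := 2 / (1 - k) + pi.
have B0 : 0 < B by rewrite /B addr_gt0 ?pi_gt0// divr_gt0// subr_gt0.
exists (K * (8 `^ k * (4 * (B * pi)))).
  by rewrite !mulr_gt0 ?powR_gt0 ?pi_gt0.
move=> a ad; set e := 1 - normc a.
have e0 : 0 < e by rewrite subr_gt0.
pose m1 := poisson e (complex.Re a); pose m2 := poisson e (complex.Im a).
have mm1 := measurable_poisson (complex.Re a) e0.
have mm2 := measurable_poisson (complex.Im a) e0.
pose I : set (measurableTypeR R) := `[(-1)%R, 1%R]%classic.
have mI : measurable I by exact: measurable_itv.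
have main w : D2 w -> (1 - normc (cpt w) ^+ 2) `^ (p - 1) *
     (e `^ (N * p - 1) * den a (cpt w) `^ (- (N * p + p))) <=
   K * e `^ (k - 2) * ((1 - normc (cpt w)) `^ (- k) * (m1 w.1 * m2 w.2)).
  move=> Dw; set n := normc (cpt w); set Y := den a (cpt w).
  have Y0 : 0 < Y by exact: den_gt0.
  have [eY nY] := den_ge ad Dw; rewrite -/e -/n -/Y in eY nY.
  have n1 : 0 < 1 - n by rewrite subr_gt0.
  have n0 : 0 <= n by exact: normc_ge0.
  have q4 := den_quartic ad Dw; rewrite -/e -/Y in q4.
  have s1 : (1 - n ^+ 2) `^ (p - 1) <= 2 `^ `|p - 1| * (1 - n) `^ (p - 1).
    by apply: powR_comparable => //; clear -n0 n1; nra.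
  have s2 : (1 - n) `^ (p - 1) * (e `^ (N * p - 1) * Y `^ (- (N * p + p))) <=
      e `^ (k - 2) * (1 - n) `^ (- k) * (e / Y) ^+ 4.
    have -> : (e / Y) ^+ 4 = e `^ 4 * Y `^ (- 4).
      by rewrite exprMn exprVn powRN !powR_mulrn ?(ltW e0) ?(ltW Y0).
    have -> : e `^ (k - 2) * (1 - n) `^ (- k) * (e `^ 4 * Y `^ (- 4)) =
        (1 - n) `^ (- k) * (e `^ (k + 2) * Y `^ (- 4)).
      rewrite (_ : k + 2 = (k - 2) + 4); last by ring.
      by rewrite (@gt0_powRD _ e (k - 2) 4)//; ring.
    (* [(1 - n) ^ (p - 1 + k) <= Y ^ (p - 1 + k)], as [p - 1 + k >= 0] *)
    have -> : (1 - n) `^ (p - 1) = (1 - n) `^ (- k) * (1 - n) `^ (p - 1 + k).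
      by rewrite -gt0_powRD//; congr powR; ring.
    rewrite -mulrA ler_wpM2l ?powR_ge0//.
    have t1 : (1 - n) `^ (p - 1 + k) <= Y `^ (p - 1 + k).
      by rewrite ge0_ler_powR ?nnegrE ?(ltW n1) ?(ltW Y0).
    apply: le_trans (ler_wpM2r _ t1) _; first by rewrite mulr_ge0 ?powR_ge0.
    (* Four powers of [Y] are kept for the two Poisson kernels. The others form a power of
       [e / Y <= 1] with exponent [N * p - 3 - k], positive because [N * p >= 4] and [k < 1]. *)
    have -> : Y `^ (p - 1 + k) * (e `^ (N * p - 1) * Y `^ (- (N * p + p))) =
       e `^ (k + 2) * (e `^ (N * p - 3 - k) * (Y `^ (- (N * p - 3 - k)) * Y `^ (- 4))).
      rewrite -[in RHS]gt0_powRD// mulrCA -[in LHS]gt0_powRD//.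
      rewrite [in RHS]mulrA -gt0_powRD//.
      by congr (_ `^ _ * _ `^ _); ring.
    rewrite ler_wpM2l ?powR_ge0// mulrA ler_piMl ?powR_ge0//.
    rewrite powRN ler_pdivrMr ?powR_gt0// mul1r.
    by rewrite ge0_ler_powR ?nnegrE ?(ltW e0) ?(ltW Y0)//; lra.
  apply: le_trans (ler_wpM2r _ s1) _; first by rewrite mulr_ge0 ?powR_ge0.
  rewrite -[leLHS]mulrA; apply: le_trans (ler_wpM2l (powR_ge0 _ _) s2) _.
  rewrite [leRHS](_ : _ = 2 `^ `|p - 1| * (e `^ (k - 2) * (1 - n) `^ (- k) *
    (4 * (m1 w.1 * m2 w.2)))); last by rewrite /K; ring.
  by rewrite ler_wpM2l ?powR_ge0// ler_wpM2l ?mulr_ge0 ?powR_ge0.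
have P0 w : 0 <= (1 - normc (cpt w)) `^ (- k) * (m1 w.1 * m2 w.2).
  apply: mulr_ge0; first exact: powR_ge0.
  by apply: mulr_ge0; exact: poisson_ge0.
have D2I : D2 `<=` D2 `&` I `*` I.
  move=> w Dw; split => //; rewrite /I /=.
  have := normc_Re (cpt w); have := normc_Im (cpt w); rewrite !in_itv/= /D2 /disc /= in Dw *.
  by rewrite !ler_norml => /andP[? ?] /andP[? ?]; split; apply/andP; split; lra.
have c0 : 0 <= K * e `^ (k - 2) by rewrite mulr_ge0 ?powR_ge0// ltW.
apply: (@le_trans _ _ (\int[mu2]_(w in D2 `&` I `*` I) ((K * e `^ (k - 2))%:E *
   ((1 - normc (cpt w)) `^ (- k) * (m1 w.1 * m2 w.2))%:E))%E).
  apply: le_integral_ge0 => [//|w _|w _|w Dw].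
  - by rewrite lee_fin !mulr_ge0 ?powR_ge0.
  - by rewrite -EFinM lee_fin; apply: mulr_ge0.
  - by rewrite -(EFinM (K * _)) lee_fin; exact: main.
have mG : measurable_fun (D2 `&` I `*` I) (fun w =>
    ((1 - normc (cpt w)) `^ (- k) * (m1 w.1 * m2 w.2))%:E).
  apply/measurable_EFinP; apply: measurable_funS (measurable_D2) _ _.
    by move=> w [].
  apply: measurable_funM.
    apply: (measurableT_comp (measurable_powR (- k))).
    apply: measurable_funB => //.
    apply: (@disc_cont_measurable _ (fun z => normc z)) => //; first exact: measurable_D2.
    by move=> z _; apply: (@ccont_normc _ (fun z => z)); exact: (cdiff_ccont (cdiff_id z)).
  apply: measurable_funM; apply: measurable_funTS.
    exact: (measurableT_comp mm1 mfst).
  exact: (measurableT_comp mm2 msnd).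
have mDI : measurable (D2 `&` I `*` I).
  by apply: measurableI; [exact: measurable_D2|exact: measurableX].
rewrite (ge0_integralZl _ mDI mG); [|by move=> w _; rewrite lee_fin; exact: P0|by rewrite lee_fin].
have Bk0 : 0 <= B * e `^ (1 - k) by rewrite mulr_ge0 ?powR_ge0// ltW.
have T := boundary_tensor_integral k0 mI mI mm1 mm2
  (poisson_ge0 e (complex.Re a)) (poisson_ge0 e (complex.Im a)) Bk0 Bk0
  (fun b => rpow_poisson_integral b (complex.Re a) k01 e0)
  (fun b => rpow_poisson_integral b (complex.Im a) k01 e0)
  (poisson_integral (complex.Re a) e0) (poisson_integral (complex.Im a) e0).
apply: le_trans (lee_wpmul2l _ T) _; first by rewrite lee_fin.
rewrite -EFinM lee_fin le_eqVlt; apply/orP; left; apply/eqP.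
(* The powers of [e] cancel, so nothing depends on [a] any longer. *)
have E : e `^ (k - 2) * (e `^ (1 - k) * e) = 1.
  rewrite -{3}(powRr1 (ltW e0)) -!gt0_powRD//.
  by rewrite (_ : k - 2 + (1 - k + 1) = 0) ?powRr0//; ring.
rewrite [LHS](_ : _ = K * (8 `^ k * (4 * (B * pi))) * (e `^ (k - 2) * (e `^ (1 - k) * e))).
  by rewrite E mulr1.
by ring.
Qed.

End ForelliRudin.

Lemma tonelli_swap d (T : measurableType d) (R : realType)
    (m : {sigma_finite_measure set T -> \bar R}) (k h : T -> R) (c : T * T -> R) :
  measurable_fun setT k -> measurable_fun setT h -> measurable_fun setT c ->
  (forall x, 0 <= k x) -> (forall x, 0 <= h x) -> (forall x, 0 <= c x) ->
  (\int[m]_v ((k v)%:E * \int[m]_w (h w * c (v, w))%:E) =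
   \int[m]_w ((h w)%:E * \int[m]_v (k v * c (v, w))%:E))%E.
Proof.
move=> mk mh mc k0 h0 c0.
pose f (vw : T * T) := (k vw.1 * (h vw.2 * c vw))%:E.
have mf : measurable_fun setT f.
  apply/measurable_EFinP; apply: measurable_funM.
    exact: (measurableT_comp mk measurable_fst).
  apply: measurable_funM => //.
  exact: (measurableT_comp mh measurable_snd).
have mcl v : measurable_fun setT (fun w => c (v, w)).
  exact: (measurableT_comp mc (measurable_pair1 v)).
have mcr w : measurable_fun setT (fun v => c (v, w)).
  exact: (measurableT_comp mc (measurable_pair2 w)).
have f0 x : (0 <= f x)%E by rewrite lee_fin !mulr_ge0.
have F : (\int[m]_v \int[m]_w f (v, w) = \int[m]_w \int[m]_v f (v, w))%E.
  exact: fubini_tonelli.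
have mL v : measurable_fun setT (fun w => (h w * c (v, w))%:E).
  by apply/measurable_EFinP; exact: measurable_funM.
have mR w : measurable_fun setT (fun v => (k v * c (v, w))%:E).
  by apply/measurable_EFinP; exact: measurable_funM.
have L0 v w : setT w -> (0 <= (h w * c (v, w))%:E)%E by rewrite lee_fin mulr_ge0.
have R0 w v : setT v -> (0 <= (k v * c (v, w))%:E)%E by rewrite lee_fin mulr_ge0.
have k0E v : (0 <= (k v)%:E)%E by rewrite lee_fin.
have h0E v : (0 <= (h v)%:E)%E by rewrite lee_fin.
transitivity (\int[m]_v \int[m]_w f (v, w))%E.
  apply: eq_integral => v _.
  rewrite -(ge0_integralZl m measurableT (mL v) (L0 v) (k0E v)).
  by apply: eq_integral => w _; rewrite -EFinM.
rewrite F; apply: eq_integral => w _.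
rewrite -(ge0_integralZl m measurableT (mR w) (R0 w) (h0E w)).
by apply: eq_integral => v _; rewrite /f /= -EFinM mulrCA.
Qed.

Lemma measurable_kernel_integral d (T : measurableType d) (R : realType)
    (m : {sigma_finite_measure set T -> \bar R}) (k h : T -> R) (c : T * T -> R) :
  measurable_fun setT k -> measurable_fun setT h -> measurable_fun setT c ->
  (forall x, 0 <= h x) -> (forall x, 0 <= c x) ->
  measurable_fun setT (fun v => ((k v)%:E * \int[m]_w (h w * c (v, w))%:E)%E).
Proof.
move=> mk mh mc h0 c0; apply: emeasurable_funM; first exact/measurable_EFinP.
have mf : measurable_fun setT (fun x : T * T => (h x.2 * c x)%:E).
  apply/measurable_EFinP; apply: measurable_funM => //.
  exact: (measurableT_comp mh measurable_snd).
have f0 (x : T * T) : (0 <= (h x.2 * c x)%:E)%E by rewrite lee_fin mulr_ge0.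
exact: (measurable_fun_fubini_tonelli_F (m2 := m) _ mf f0).
Qed.

(** * Carleson embedding *)

Section PlaneMeasure.
Context {R : realType}.
Local Notation mu := (@lebesgue_measure R).
Local Notation R2 := (measurableTypeR R * measurableTypeR R)%type.

(* The library registers a sigma-finite structure on [m1 \x m2] only for
   subprobabilities, hence this alias of [mu \x mu]. *)
Definition plane_measure : set R2 -> \bar R := (mu \x mu)%E.

HB.instance Definition _ := Measure.on plane_measure.

Lemma plane_measure_sigma_finite : sigma_finite setT plane_measure.
Proof.
exists (fun n => sq2 0 n%:R).
  apply/seteqP; split=> // w _.
  pose M := Num.max `|w.1| `|w.2|.
  exists (Num.truncn M).+1 => //; apply/sq2P/squareP; rewrite subr0 /=.
  have /ltW := truncnS_gt M; rewrite ge_max => /andP[h1 h2].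
  by split.
move=> n; split; first exact: measurable_sq2.
rewrite /plane_measure; have -> := mu2_sq2 (0 : R[i]) (ler0n R n).
by rewrite ltry.
Qed.

HB.instance Definition _ := Measure_isSigmaFinite.Build _ _ _ plane_measure
  plane_measure_sigma_finite.

End PlaneMeasure.

Section Cones.
Context {R : realType}.
Local Notation C := R[i].
Local Notation mu := (@lebesgue_measure R).
Local Notation mu2 := (mu \x mu)%E.
Local Notation R2 := (measurableTypeR R * measurableTypeR R)%type.
Implicit Types (f : C -> C) (a z : C) (v w : R2) (p : R).

Let gap w : R := 1 - normc (cpt w).

(** A substitute for a Stolz region with vertex [z], wide enough to contain squares about all points
    of the radius to [z]. It is phrased as a condition on [z] for given [w], so that exchanging the
    integrals leaves a square about [w]. *)
Definition cone z : set R2 := [set w | D2 w /\ square (cpt w) (3 * (1 - normc (cpt w))) z].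

(** The submean inequality is applied at [tz] on a square of half-side [(1 - t|z|) / 4]. On it
    [gap w] is comparable to [1 - t|z|]; the [- 2] in the exponent compensates for the area of the
    square. *)
Lemma cone_bound p : 0 < p -> exists2 A, 0 < A & forall f z, holo_disc f -> disc z ->
  ((normc (f z - f 0) `^ p)%:E <= (A * (1 - normc z) `^ (- (1 / 4)))%:E *
    \int[mu2]_(w in cone z) (normc (cderiv f (cpt w)) `^ p * gap w `^ (p + 1 / 4 - 2))%:E)%E.
Proof.
move=> p0; have [K K0 HK] := @submean R p p0.
pose q := p + 1 / 4 - 2.
pose eta := (4 * p)^-1.
have eta0 : 0 < eta by rewrite invr_gt0 mulr_gt0.
pose B := 16 * K * 2 `^ `|q|.
have B0 : 0 < B by rewrite !mulr_gt0 ?powR_gt0.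
pose A := (2 / eta) `^ p * B.
have A0 : 0 < A by rewrite mulr_gt0 ?powR_gt0 ?divr_gt0.
exists A => // f z fh zd; have fd := holo_cderiv fh.
have gz : 0 < 1 - normc z by rewrite subr_gt0.
have Az : 0 < A * (1 - normc z) `^ (- (1 / 4)) by rewrite mulr_gt0 ?powR_gt0.
set J := (\int[mu2]_(_ in _) _)%E.
have J0 : (0 <= J)%E by apply: integral_ge0 => w _; rewrite lee_fin mulr_ge0 ?powR_ge0.
have [Jy|Jfin] := eqVneq J +oo%E.
  by rewrite Jy gt0_muley ?lte_fin// leey.
have {}Jfin : J \is a fin_num by rewrite ge0_fin_numE// ltey.
set j := fine J; have JE : J = j%:E by rewrite /j fineK.
have j0 : 0 <= j by rewrite -lee_fin -JE.
have main t : 0 <= t <= 1 ->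
    normc (cderiv f (t%:C * z)) `^ p * (1 - t * normc z) `^ (p + 1 / 4) <= B * j.
  move=> t01; pose y := t%:C * z; pose n := normc y.
  have yd : disc y by exact: disc_scale_lt.
  have tn : t * normc z = n.
    by rewrite /n /y normcM normc_real ger0_norm//; case/andP: t01.
  rewrite tn -/y; have n1 : 0 < 1 - n by rewrite subr_gt0.
  pose s := (1 - n) / 4; have s0 : 0 < s by rewrite divr_gt0.
  have ys : normc y + 2 * s < 1 by rewrite -/n /s; lra.
  pose c := 2 `^ `|q| * (1 - n) `^ (- q).
  have c0 : 0 < c by rewrite mulr_gt0 ?powR_gt0.
  have mF := holo_measurable_powR p fd (measurable_sq2 y s) (sq2_disc ys).
  have I1 : (pmean (cderiv f) y s p <= (c * j)%:E)%E.
    have -> : pmean (cderiv f) y s p =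
        (c%:E * \int[mu2]_(w in sq2 y s) (c^-1 * normc (cderiv f (cpt w)) `^ p)%:E)%E.
      rewrite -ge0_integralZl//.
      - apply: eq_integral => w _; rewrite -EFinM mulrA divff ?mul1r// gt_eqF//.
      - exact: measurable_sq2.
      - by apply/measurable_EFinP; exact: measurable_funM.
      - by move=> w _; rewrite lee_fin mulr_ge0 ?powR_ge0// invr_ge0 ltW.
      - by rewrite lee_fin ltW.
    rewrite (EFinM c j) lee_wpmul2l ?lee_fin ?(ltW c0)// -JE; apply: le_integral_ge0.
    (* From [|w - tz| <= (1 - n) / 2] and [|tz - z| <= 1 - n] follow [gap w >= (1 - n) / 2] and
       [|w - z| <= 3 * gap w], which explains the factor 3 in [cone]. *)
    - move=> w wsq; have wsq' := wsq; move/sq2P/square_normc: wsq' => wy.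
      have Dw := sq2_disc ys wsq; split=> //.
      have h1 := ler_normcB (cpt w) y; have h2 : normc (y - z) <= 1 - n.
        have -> : y - z = - ((1 - t)%:C * z) by rewrite /y rmorphB /= rmorph1; ring.
        have /andP[t0 t1] := t01.
        rewrite normcN normcM normc_real ger0_norm ?subr_ge0// -tn.
        by move: gz; nra.
      have h3 := le_normcD (cpt w - y) (y - z).
      rewrite subrKA in h3.
      apply/squareP; rewrite -(opprB (cpt w)) !raddfN !normrN.
      have h4 := normc_Re (cpt w - z); have h5 := normc_Im (cpt w - z).
      by split; [apply: le_trans h4 _|apply: le_trans h5 _]; rewrite /s -/n in wy h1; lra.
    - by move=> w _; rewrite lee_fin mulr_ge0 ?powR_ge0// invr_ge0 ltW.
    - by move=> w _; rewrite lee_fin mulr_ge0 ?powR_ge0.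
    - move=> w wsq; have wsq' := wsq; move/sq2P/square_normc: wsq' => wy.
      have Dw : 0 < gap w by rewrite subr_gt0; exact: (sq2_disc ys wsq).
      have h1 := ler_normcB (cpt w) y; have h2 := ler_normcB y (cpt w).
      rewrite (normcB y) in h2; rewrite -/n in h1 h2.
      rewrite lee_fin mulrC ler_wpM2l ?powR_ge0//.
      rewrite (_ : c^-1 = (1 - n) `^ q / 2 `^ `|q|); last first.
        by rewrite /c (powRN (1 - n)) invfM invrK mulrC.
      rewrite ler_pdivrMr ?powR_gt0// mulrC.
      apply: powR_comparable => //; rewrite /gap in Dw *; rewrite /s in wy; lra.
  have H : normc (cderiv f y) `^ p <= 16 * K / (1 - n) ^+ 2 * (c * j).
    rewrite -lee_fin; apply: le_trans (HK _ _ _ fd s0 ys) _.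
    rewrite (EFinM _ (c * j)) (_ : 16 * K / (1 - n) ^+ 2 = K / s ^+ 2); last first.
      by rewrite /s; field; rewrite gt_eqF.
    by rewrite lee_wpmul2l// lee_fin divr_ge0 ?sqr_ge0// ltW.
  apply: le_trans (ler_wpM2r (powR_ge0 _ _) H) _.
  have E : (1 - n) ^- 2 * ((1 - n) `^ (- q) * (1 - n) `^ (p + 1 / 4)) = 1.
    rewrite -(powR_mulrn 2 (ltW n1)) -powRN -!gt0_powRD//.
    by rewrite (_ : - 2 + (- q + (p + 1 / 4)) = 0) ?powRr0//; rewrite /q; ring.
  rewrite [leLHS](_ : _ = B * j * ((1 - n) ^- 2 * ((1 - n) `^ (- q) * (1 - n) `^ (p + 1 / 4)))).
    by rewrite E mulr1.
  by rewrite /B /c; ring.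
clearbody B.
(* The [p]-th root of [main] has exponent [(p + 1 / 4) / p = 1 + eta], the hypothesis of
   [radial_growth]; taking the power [p] afterwards turns [eta] into 1/4. *)
have RG : normc (f z - f 0) <= 2 * (B * j) `^ p^-1 / eta * (1 - normc z) `^ (- eta).
  apply: radial_growth => // t t01.
  have t1 : 0 < 1 - t * normc z.
    rewrite subr_gt0; have := disc_scale_lt t01 zd.
    by rewrite /disc /= normcM normc_real ger0_norm//; case/andP: t01.
  have := ge0_ler_powR (r := p^-1) _ _ _ (main t t01).
  rewrite !nnegrE invr_ge0 (ltW p0) !mulr_ge0 ?powR_ge0 ?(ltW B0)// => /(_ isT isT isT).
  rewrite powRM ?powR_ge0// -!powRrM divff ?gt_eqF// powRr1 ?normc_ge0//.
  by rewrite (_ : (p + 1 / 4) / p = 1 + eta)// /eta; field; rewrite gt_eqF.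
rewrite JE -EFinM lee_fin.
have etaV : 0 <= eta^-1 by rewrite invr_ge0 ltW.
have := ge0_ler_powR (r := p) _ _ _ RG.
rewrite !nnegrE (ltW p0) normc_ge0 !mulr_ge0 ?powR_ge0// => /(_ isT isT isT).
move/le_trans; apply.
rewrite (_ : 2 * (B * j) `^ p^-1 / eta = (2 / eta) * (B * j) `^ p^-1); last by ring.
rewrite powRM ?mulr_ge0 ?powR_ge0//.
rewrite powRM ?powR_ge0 ?mulr_ge0// -!powRrM mulVf ?gt_eqF//.
rewrite powRr1 ?mulr_ge0 ?(ltW B0)//.
rewrite (_ : - eta * p = - (1 / 4)); last by rewrite /eta; field; rewrite gt_eqF.
by rewrite le_eqVlt; apply/orP; left; apply/eqP; rewrite /A; ring.
Qed.

End Cones.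

Section CarlesonEmbedding.
Context {R : realType}.
Local Notation C := R[i].
Local Notation mu := (@lebesgue_measure R).
Local Notation mu2 := (mu \x mu)%E.
Local Notation R2 := (measurableTypeR R * measurableTypeR R)%type.
Implicit Types (f : C -> C) (a z : C) (v w : R2) (p : R).

Let gap w : R := 1 - normc (cpt w).

Lemma measurable_normc_cpt : measurable_fun setT (fun w : R2 => normc (cpt w)).
Proof.
have -> : (fun w : R2 => normc (cpt w)) = (fun w => Num.sqrt (w.1 ^+ 2 + w.2 ^+ 2)) by [].
apply: (measurableT_comp (f := fun x : R => Num.sqrt x)).
  by apply: continuous_measurable_fun; exact: sqrt_continuous.
by apply: measurable_funD; apply: measurable_funX; [exact: measurable_fst|exact: measurable_snd].
Qed.

Lemma measurable_den a : measurable_fun setT (fun w : R2 => den a (cpt w)).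
Proof.
have -> : (fun w : R2 => den a (cpt w)) = (fun w => Num.sqrt ((complex.Re a - w.1) ^+ 2 +
    (complex.Im a - w.2) ^+ 2 + (1 - normc a ^+ 2) * (1 - normc (cpt w) ^+ 2))).
  apply/funext => w; rewrite -[LHS]ger0_norm ?normc_ge0// -sqrtr_sqr den_sqr.
  have -> : a - cpt w = (complex.Re a - w.1) +i* (complex.Im a - w.2) by case: a.
  by rewrite normc_sqr.
apply: (measurableT_comp (f := fun x : R => Num.sqrt x)).
  by apply: continuous_measurable_fun; exact: sqrt_continuous.
apply: measurable_funD.
  by apply: measurable_funD; apply: measurable_funX; apply: measurable_funB => //.
apply: measurable_funM => //; apply: measurable_funB => //.
by apply: measurable_funX; exact: measurable_normc_cpt.
Qed.

Lemma measurable_gap_powR q : measurable_fun setT (fun w : R2 => gap w `^ q).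
Proof.
apply: (measurableT_comp (measurable_powR q)).
by apply: measurable_funB => //; exact: measurable_normc_cpt.
Qed.

Lemma measurable_dirichlet_density f p : holo_disc f ->
  measurable_fun D2 (fun w : R2 => normc (cderiv f (cpt w)) `^ p * (1 - normc (cpt w) ^+ 2) `^ (p - 1)).
Proof.
move=> fh; apply: measurable_funM.
  exact: (holo_measurable_powR p (holo_cderiv fh) measurable_D2 (fun w Dw => Dw)).
apply: measurable_funTS; apply: (measurableT_comp (measurable_powR (p - 1))).
by apply: measurable_funB => //; apply: measurable_funX; exact: measurable_normc_cpt.
Qed.

Definition dirichlet_int f p : \bar R := (\int[mu2]_(w in D2)
  (normc (cderiv f (cpt w)) `^ p * (1 - normc (cpt w) ^+ 2) `^ (p - 1))%:E)%E.

Lemma gap_gt0 w : D2 w -> 0 < gap w.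
Proof. by move=> Dw; rewrite subr_gt0. Qed.

Lemma carleson_embedding_centered p : 0 < p -> exists2 A, 0 < A & forall f a, holo_disc f -> disc a ->
  (\int[mu2]_(v in D2) (normc (f (cpt v) - f 0) `^ p * (den a (cpt v))^-1)%:E <=
   A%:E * dirichlet_int f p)%E.
Proof.
move=> p0; have [A1 A10 HA1] := @cone_bound R p p0.
pose AK : R := 8 `^ (1 / 4) * (20 * 24) * 3 `^ (3 / 4).
have AK0 : 0 < AK by rewrite !mulr_gt0 ?powR_gt0.
pose c : R := 2 `^ `|p - 1|.
have c0 : 0 < c by rewrite powR_gt0.
exists (A1 * (AK * c)); first by rewrite !mulr_gt0.
move=> f a fh ad; have fd := holo_cderiv fh.
pose q := p + 1 / 4 - 2.
pose k0 v := gap v `^ (- (1 / 4)) * (den a (cpt v))^-1.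
pose h0 w := normc (cderiv f (cpt w)) `^ p * gap w `^ q.
(* Extension by zero and the indicator [chi] of the relation between [v] and [w] bring both
   integrals to the whole plane, where they can be exchanged. *)
pose k := k0 \_ D2; pose h := h0 \_ D2.
pose S : set (R2 * R2) := [set x | `|x.1.1 - x.2.1| <= 3 * gap x.2] `&`
  [set x | `|x.1.2 - x.2.2| <= 3 * gap x.2].
pose chi : R2 * R2 -> R := \1_S.
have mgap2 : measurable_fun setT (fun x : R2 * R2 => 3 * gap x.2).
  apply: measurable_funM => //; apply: measurable_funB => //.
  exact: (measurableT_comp measurable_normc_cpt measurable_snd).
have mS : measurable S.
  apply: measurableI; rewrite -[X in measurable X]setTI; apply: measurable_fun_le => //.
    apply: measurableT_comp => //; apply: measurable_funB.
      exact: (measurableT_comp measurable_fst measurable_fst).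
    exact: (measurableT_comp measurable_fst measurable_snd).
  apply: measurableT_comp => //; apply: measurable_funB.
    exact: (measurableT_comp measurable_snd measurable_fst).
  exact: (measurableT_comp measurable_snd measurable_snd).
have mk0 : measurable_fun setT k0.
  apply: measurable_funM; first exact: measurable_gap_powR.
  have -> : (fun v => (den a (cpt v))^-1) = (fun v => den a (cpt v) `^ (-1)).
    by apply/funext => v; rewrite powR_inv1// normc_ge0.
  exact: (measurableT_comp (measurable_powR (-1)) (measurable_den a)).
have mk : measurable_fun setT k.
  by apply/(measurable_restrictT _ measurable_D2); exact: measurable_funTS.
have mh0 : measurable_fun D2 h0.
  apply: measurable_funM; last exact: measurable_funTS (measurable_gap_powR q).
  exact: (holo_measurable_powR p fd measurable_D2 (fun w Dw => Dw)).
have mh : measurable_fun setT h by apply/(measurable_restrictT _ measurable_D2).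
have mchi : measurable_fun setT chi by exact: measurable_indic.
have k0_ge0 v : 0 <= k0 v by rewrite mulr_ge0 ?powR_ge0 ?invr_ge0 ?normc_ge0.
have h0_ge0 v : 0 <= h0 v by rewrite mulr_ge0 ?powR_ge0.
have k_ge0 v : 0 <= k v by rewrite /k patchE; case: ifP.
have h_ge0 v : 0 <= h v by rewrite /h patchE; case: ifP.
have chi_ge0 x : 0 <= chi x by rewrite /chi indicE ler0n.
have kD v : D2 v -> k v = k0 v by move=> Dv; rewrite /k patchE mem_set.
have hD v : D2 v -> h v = h0 v by move=> Dv; rewrite /h patchE mem_set.
have SE v w : S (v, w) <-> square (cpt w) (3 * gap w) (cpt v).
  by rewrite squareP /S /cpt /=.
have coneE v : D2 v -> (\int[mu2]_(w in cone (cpt v)) (h0 w)%:E <=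
    \int[mu2]_w (h w * chi (v, w))%:E)%E.
  move=> Dv; apply: le_integral_ge0 => [//|w _|w _|w [Dw sw]].
  - by rewrite lee_fin.
  - by rewrite lee_fin mulr_ge0.
  - rewrite lee_fin hD// /chi indicE mem_set ?mulr1//.
    exact/SE.
have kchiE w : D2 w -> (\int[mu2]_v (k v * chi (v, w))%:E <= (AK * gap w `^ (3 / 4))%:E)%E.
  move=> Dw; have gw := gap_gt0 Dw.
  have g3 : 0 < 3 * gap w by rewrite mulr_gt0.
  have := carleson_kernel (cpt w) ad g3.
  rewrite powRM ?(ltW gw)// mulrA; apply: le_trans.
  rewrite [leRHS]integral_mkcond; apply: le_integral_ge0 => [//|v _|v _|v _].
  - by rewrite lee_fin mulr_ge0.
  - by apply: erestrict_ge0 => x _; rewrite lee_fin; exact: k0_ge0.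
  - rewrite patchE; case: ifPn => [|nv].
      rewrite inE => -[Dv sv]; rewrite lee_fin kD//.
      by rewrite ler_piMr ?k0_ge0// /chi indicE lern1 leq_b1.
    rewrite lee_fin /chi indicE; case: (boolP ((v, w) \in S)) => [|_]; last by rewrite mulr0.
    rewrite inE => /SE sv; rewrite mulr1 /k patchE; case: ifPn => // /[!inE] Dv.
    by move: nv; rewrite notin_setE => -[]; split => //; exact/sq2P.
apply: (@le_trans _ _ (\int[mu2]_v (A1%:E * ((k v)%:E * \int[mu2]_w (h w * chi (v, w))%:E)))%E).
  apply: le_integral_ge0 => [//|v _|v _|v Dv].
  - by rewrite lee_fin mulr_ge0 ?powR_ge0// invr_ge0 normc_ge0.
  - rewrite !mule_ge0 ?lee_fin ?(ltW A10)//.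
    by apply: integral_ge0 => w _; rewrite lee_fin mulr_ge0.
  - have Hc := HA1 _ _ fh Dv.
    have d0 : 0 <= (den a (cpt v))^-1 by rewrite invr_ge0 normc_ge0.
    rewrite muleA -EFinM kD// (mulrC (normc _ `^ p)) (EFinM (den a (cpt v))^-1).
    have -> : A1 * k0 v = (den a (cpt v))^-1 * (A1 * gap v `^ (- (1 / 4))) by rewrite /k0; ring.
    rewrite (EFinM (den a (cpt v))^-1 (A1 * _)) -muleA lee_wpmul2l ?lee_fin//.
    apply: le_trans Hc _; rewrite lee_wpmul2l ?lee_fin ?mulr_ge0 ?powR_ge0 ?(ltW A10)//.
    exact: coneE.
have mU : measurable_fun setT (fun v => ((k v)%:E * \int[mu2]_w (h w * chi (v, w))%:E)%E).
  exact: (measurable_kernel_integral (@plane_measure R) mk mh mchi h_ge0 chi_ge0).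
have U0 v : setT v -> (0 <= (k v)%:E * \int[mu2]_w (h w * chi (v, w))%:E)%E.
  move=> _; rewrite mule_ge0 ?lee_fin//.
  by apply: integral_ge0 => w _; rewrite lee_fin mulr_ge0.
have A1E : (0 <= A1%:E :> \bar R)%E by rewrite lee_fin ltW.
rewrite (ge0_integralZl mu2 measurableT mU U0 A1E).
rewrite (EFinM A1) -muleA lee_wpmul2l//.
have -> : (\int[mu2]_v ((k v)%:E * \int[mu2]_w (h w * chi (v, w))%:E) =
    \int[mu2]_w ((h w)%:E * \int[mu2]_v (k v * chi (v, w))%:E))%E.
  exact: (tonelli_swap (@plane_measure R) mk mh mchi k_ge0 h_ge0 chi_ge0).
have mden := measurable_dirichlet_density p fh.
have AcE : (0 <= (AK * c)%:E :> \bar R)%E by rewrite lee_fin mulr_ge0 ?ltW.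
have den0 w : D2 w -> (0 <= (normc (cderiv f (cpt w)) `^ p * (1 - normc (cpt w) ^+ 2) `^ (p - 1))%:E)%E.
  by move=> _; rewrite lee_fin mulr_ge0 ?powR_ge0.
have mdenE : measurable_fun D2 (fun w => (normc (cderiv f (cpt w)) `^ p * (1 - normc (cpt w) ^+ 2) `^ (p - 1))%:E).
  exact/measurable_EFinP.
rewrite /dirichlet_int -(ge0_integralZl mu2 measurable_D2 mdenE den0 AcE).
rewrite [leRHS]integral_mkcond; apply: le_integral_ge0 => [//|w _|w _|w _].
- rewrite mule_ge0 ?lee_fin//.
  by apply: integral_ge0 => v _; rewrite lee_fin mulr_ge0.
- by apply: erestrict_ge0 => x Dx; rewrite mule_ge0// den0.
- rewrite patchE; case: ifPn => [|nw]; last by rewrite /h patchE (negbTE nw) mul0e.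
  rewrite inE => Dw; rewrite hD//.
  apply: le_trans (lee_wpmul2l _ (kchiE _ Dw)) _; first by rewrite lee_fin.
  have gw := gap_gt0 Dw.
  rewrite -!EFinM lee_fin /h0.
  have n0 : 0 <= normc (cpt w) by exact: normc_ge0.
  (* The weight [p + 1/4 - 2] of the cone and the gain 3/4 of [carleson_kernel] add up to the
     Dirichlet weight [p - 1]. *)
  have gE : gap w `^ q * gap w `^ (3 / 4) = gap w `^ (p - 1).
    by rewrite -gt0_powRD//; congr powR; rewrite /q; field.
  have gc : gap w `^ (p - 1) <= c * (1 - normc (cpt w) ^+ 2) `^ (p - 1).
    by apply: powR_comparable => //; rewrite /gap in gw *; clear -n0 gw; nra.
  rewrite [leLHS](_ : _ = AK * normc (cderiv f (cpt w)) `^ p * (gap w `^ q * gap w `^ (3 / 4))); last by ring.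
  rewrite [leRHS](_ : _ = AK * normc (cderiv f (cpt w)) `^ p * (c * (1 - normc (cpt w) ^+ 2) `^ (p - 1))); last by ring.
  by rewrite gE ler_wpM2l ?mulr_ge0 ?powR_ge0 ?(ltW AK0).
Qed.

End CarlesonEmbedding.

(** * Norm bounds *)

Section UpperBound.
Context {R : realType}.
Local Notation C := R[i].
Local Notation mu := (@lebesgue_measure R).
Local Notation mu2 := (mu \x mu)%E.
Local Notation R2 := (measurableTypeR R * measurableTypeR R)%type.
Implicit Types (f g : C -> C) (a z : C) (v w : R2) (p : R).

Lemma holo_sub_cst f (c : C) : holo_disc f -> holo_disc (fun z => f z - c).
Proof.
move=> fh z zd; apply: (@cdiff_derivable _ _ _ (cderiv f z)) => e e0.
have [d d0 Hd] := holo_discP fh zd e0; exists d => // h /Hd.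
by rewrite (_ : f (z + h) - c - (f z - c) = f (z + h) - f z)//; ring.
Qed.

Lemma measurable_denV a : measurable_fun setT (fun w : R2 => (den a (cpt w))^-1).
Proof.
have -> : (fun v => (den a (cpt v))^-1) = (fun v => den a (cpt v) `^ (-1)).
  by apply/funext => v; rewrite powR_inv1// normc_ge0.
exact: (measurableT_comp (measurable_powR (-1)) (measurable_den a)).
Qed.

(** The disc lies in the square of half-side 1, where [carleson_kernel] applies, and the factor
    [(1 - |w|)^(-1/4)] is at least 1. This handles the constant [f 0]. *)
Lemma denV_integral a : disc a ->
  (\int[mu2]_(w in D2) ((den a (cpt w))^-1)%:E <= (8 `^ (1 / 4) * (20 * 24))%:E)%E.
Proof.
move=> ad; have := carleson_kernel 0 ad ltr01; rewrite powR1 mulr1; apply: le_trans.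
apply: le_integral_ge0 => [w Dw|w _|w _|w Dw].
- split=> //; apply/sq2P/squareP; rewrite subr0; move: Dw; rewrite /D2 /disc /= => Dw.
  by split; apply/ltW; [apply: le_lt_trans (normc_Re _) Dw|apply: le_lt_trans (normc_Im _) Dw].
- by rewrite lee_fin invr_ge0 normc_ge0.
- by rewrite lee_fin mulr_ge0 ?powR_ge0// invr_ge0 normc_ge0.
- rewrite lee_fin ler_peMl ?invr_ge0 ?normc_ge0// powRN.
  have g0 : 0 < 1 - normc (cpt w) by rewrite subr_gt0.
  rewrite invf_ge1 ?powR_gt0//.
  have := @ge0_ler_powR R (1 / 4) ltac:(lra) (1 - normc (cpt w)) 1.
  rewrite !nnegrE powR1; apply => //; first exact: ltW.
  by rewrite gerBl normc_ge0.
Qed.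

(** A substitute for Minkowski's inequality valid for all positive [p]: [t] is at most twice the
    larger of [x] and [y]. *)
Lemma powR_add_le (x y t p : R) : 0 < p -> 0 <= x -> 0 <= y -> 0 <= t -> t <= x + y ->
  t `^ p <= 2 `^ p * (x `^ p + y `^ p).
Proof.
move=> p0 x0 y0 t0 txy.
have H (u : R) : 0 <= u -> t <= 2 * u -> t `^ p <= 2 `^ p * u `^ p.
  move=> u0 tu; rewrite -powRM//; apply: ge0_ler_powR; rewrite ?nnegrE ?mulr_ge0//.
  exact: ltW.
have [xy|yx] := leP x y.
  apply: (le_trans (H y y0 _)); first by lra.
  by rewrite ler_wpM2l ?powR_ge0// lerDr powR_ge0.
apply: (le_trans (H x x0 _)); first by lra.
by rewrite ler_wpM2l ?powR_ge0// lerDl powR_ge0.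
Qed.

Lemma carleson_embedding p : 0 < p -> exists2 A, 0 < A & forall f a, holo_disc f -> disc a ->
  (\int[mu2]_(v in D2) (normc (f (cpt v)) `^ p * (den a (cpt v))^-1)%:E <=
   A%:E * ((normc (f 0) `^ p)%:E + dirichlet_int f p))%E.
Proof.
move=> p0; have [A0 A00 HA0] := @carleson_embedding_centered R p p0.
pose AK : R := 8 `^ (1 / 4) * (20 * 24).
have AK0 : 0 < AK by rewrite mulr_gt0 ?powR_gt0// mulr_gt0.
exists (2 `^ p * (A0 + AK)); first by rewrite mulr_gt0 ?powR_gt0// addr_gt0.
move=> f a fh ad.
have fh0 := @holo_sub_cst f (f 0) fh.
pose u v := normc (f (cpt v) - f 0) `^ p * (den a (cpt v))^-1.
pose d v := (den a (cpt v))^-1.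
have d0 v : 0 <= d v by rewrite invr_ge0 normc_ge0.
have u0 v : 0 <= u v by apply: mulr_ge0; [exact: powR_ge0|exact: d0].
have mu_ : measurable_fun D2 u.
  apply: measurable_funM; last exact: measurable_funTS (measurable_denV a).
  exact: (holo_measurable_powR p fh0 measurable_D2 (fun w Dw => Dw)).
have md : measurable_fun D2 d by exact: measurable_funTS (measurable_denV a).
have c0 : 0 <= normc (f 0) `^ p by exact: powR_ge0.
set c := normc (f 0) `^ p in c0 *.
have E2 : (0 <= (2 `^ p)%:E :> \bar R)%E by rewrite lee_fin powR_ge0.
apply: (@le_trans _ _ (\int[mu2]_(v in D2) ((2 `^ p)%:E * ((u v)%:E + c%:E * (d v)%:E)))%E).
  apply: le_integral_ge0 => [//|v _|v _|v Dv].
  - by rewrite lee_fin; apply: mulr_ge0; [exact: powR_ge0|exact: d0].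
  - apply: mule_ge0 => //; apply: adde_ge0; first by rewrite lee_fin.
    by apply: mule_ge0; rewrite lee_fin.
  - rewrite -(EFinM c) -(EFinD (u v)) -(EFinM (2 `^ p)) lee_fin /u -/(d v) -mulrDl mulrA ler_wpM2r//.
    apply: powR_add_le; rewrite ?normc_ge0//.
    by have := le_normcD (f (cpt v) - f 0) (f 0); rewrite subrK.
have muE : measurable_fun D2 (fun v => (u v)%:E) by exact/measurable_EFinP.
have mdE : measurable_fun D2 (fun v => (d v)%:E) by exact/measurable_EFinP.
have mcd : measurable_fun D2 (fun v => (c%:E * (d v)%:E)%E) by exact: measurable_funeM.
have cd0 v : D2 v -> (0 <= c%:E * (d v)%:E)%E by move=> _; rewrite mule_ge0 ?lee_fin.
have uE0 v : D2 v -> (0 <= (u v)%:E)%E by move=> _; rewrite lee_fin.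
have dE0 v : D2 v -> (0 <= (d v)%:E)%E by move=> _; rewrite lee_fin.
have cE0 : (0 <= c%:E :> \bar R)%E by rewrite lee_fin.
have msum : measurable_fun D2 (fun v => ((u v)%:E + c%:E * (d v)%:E)%E) by exact: emeasurable_funD.
have sum0 v : D2 v -> (0 <= (u v)%:E + c%:E * (d v)%:E)%E by move=> Dv; rewrite adde_ge0 ?uE0 ?cd0.
rewrite (ge0_integralZl mu2 measurable_D2 msum sum0 E2).
rewrite (ge0_integralD mu2 measurable_D2 uE0 muE cd0 mcd).
rewrite (ge0_integralZl mu2 measurable_D2 mdE dE0 cE0).
rewrite (EFinM (2 `^ p)) -muleA lee_wpmul2l//.
have D0 : (0 <= dirichlet_int f p)%E.
  by apply: integral_ge0 => w _; rewrite lee_fin mulr_ge0 ?powR_ge0.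
rewrite EFinD ge0_muleDl ?lee_fin ?(ltW A00) ?(ltW AK0)//.
apply: leeD.
  apply: le_trans (HA0 _ _ fh ad) _.
  by rewrite lee_wpmul2l ?lee_fin ?(ltW A00)// leeDr.
rewrite muleC; apply: (@le_trans _ _ (AK%:E * c%:E)%E).
  by rewrite lee_wpmul2r//; exact: denV_integral.
by rewrite lee_wpmul2l ?lee_fin ?(ltW AK0)// leeDl.
Qed.

Lemma integral_dAE (F : C -> R) : (forall z, 0 <= F z) ->
  measurable_fun D2 (fun w : R2 => F (cpt w)) ->
  integral_dA F = (pi^-1%:E * \int[mu2]_(w in D2) (F (cpt w))%:E)%E.
Proof.
move=> F0 mF.
have mFE : measurable_fun D2 (fun w : R2 => (F (cpt w))%:E) by exact/measurable_EFinP.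
have FE0 w : D2 w -> (0 <= (F (cpt w))%:E)%E by move=> _; rewrite lee_fin.
have pE0 : (0 <= (pi^-1 : R)%:E)%E by rewrite lee_fin invr_ge0 pi_ge0.
by rewrite -(ge0_integralZl mu2 measurable_D2 mFE FE0 pE0).
Qed.

Lemma dirichlet_energyE f p : holo_disc f ->
  integral_dA (fun z => normc (cderiv f z) `^ p * (1 - normc z ^+ 2) `^ (p - 1)) =
  (pi^-1%:E * dirichlet_int f p)%E.
Proof.
move=> fh; apply: integral_dAE; last exact: measurable_dirichlet_density.
by move=> z; rewrite mulr_ge0 ?powR_ge0.
Qed.

Lemma dirichlet_int_ge0 f p : (0 <= dirichlet_int f p)%E.
Proof. by apply: integral_ge0 => w _; rewrite lee_fin mulr_ge0 ?powR_ge0. Qed.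

Lemma mobius_gap a z : disc a -> disc z ->
  1 - normc (mobius a z) ^+ 2 = (1 - normc a ^+ 2) * (1 - normc z ^+ 2) / den a z ^+ 2.
Proof.
move=> ad zd; have d0 := den_gt0 ad zd.
rewrite /mobius normcM normcV -/(den a z) exprMn exprVn.
have -> : (1 - normc a ^+ 2) * (1 - normc z ^+ 2) = den a z ^+ 2 - normc (a - z) ^+ 2.
  by rewrite den_sqr; ring.
by rewrite mulrBl divff// expf_neq0// gt_eqF.
Qed.

Lemma disc_sqr z : disc z -> 0 < 1 - normc z ^+ 2.
Proof. by rewrite /disc /= => z1; rewrite subr_gt0 expr_lt1// normc_ge0. Qed.

(** The weight exponent [p - 1] and the exponent 1 supplied by the Moebius factor add up to [p],
    exactly what the Bloch bound on [g'] absorbs. *)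
Lemma F_density_le p f g a z b : 0 < p -> holo_disc f -> holo_disc g -> disc a -> disc z ->
  0 <= b -> (1 - normc z ^+ 2) * normc (cderiv g z) <= b ->
  normc (cderiv (volterra g f) z) `^ p * (1 - normc z ^+ 2) `^ (p - 1) *
    (1 - normc (mobius a z) ^+ 2) `^ 1 <=
  2 * b `^ p * (normc (f z) `^ p * (den a z)^-1).
Proof.
move=> p0 fh gh ad zd b0 gb.
have z2 := disc_sqr zd; have a2 := disc_sqr ad; have d0 := den_gt0 ad zd.
rewrite (cdiff_cderiv (volterra_cdiff fh gh zd)) mobius_gap// powRr1; last first.
  by rewrite divr_ge0 ?mulr_ge0 ?sqr_ge0// ltW.
set x := 1 - normc z ^+ 2 in z2 gb *; set y := 1 - normc a ^+ 2 in a2 *.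
set d := den a z in d0 *; set F := normc (f z); set G := normc (cderiv g z) in gb *.
have F0 : 0 <= F by exact: normc_ge0.
have G0 : 0 <= G by exact: normc_ge0.
have xE : x `^ (p - 1) * x = x `^ p.
  by rewrite -{2}(powRr1 (ltW z2)) -gt0_powRD// subrK.
rewrite normcM -/F -/G powRM//.
have -> : F `^ p * G `^ p * x `^ (p - 1) * (y * x / d ^+ 2) =
   F `^ p * ((G `^ p * (x `^ (p - 1) * x)) * (y / d ^+ 2)) by ring.
have -> : 2 * b `^ p * (F `^ p * d^-1) = F `^ p * (b `^ p * (2 * d^-1)) by ring.
rewrite ler_wpM2l ?powR_ge0// xE -powRM ?(ltW z2)//.
apply: ler_pM; rewrite ?powR_ge0 ?divr_ge0 ?sqr_ge0 ?(ltW a2)//.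
  apply: ge0_ler_powR; rewrite ?nnegrE ?mulr_ge0 ?(ltW z2) ?(ltW p0)//.
  by rewrite mulrC.
rewrite expr2 invfM mulrA ler_wpM2r ?invr_ge0 ?(ltW d0)// ler_pdivrMr//.
have [ed _] := den_ge ad zd; rewrite -/d in ed.
rewrite /y; nra.
Qed.

Lemma F_norm_upper p : 0 < p -> exists2 A, 0 < A & forall f g b, holo_disc f -> holo_disc g ->
  0 <= b -> (forall z, disc z -> (1 - normc z ^+ 2) * normc (cderiv g z) <= b) ->
  (F_norm p (p - 1) 1 (volterra g f) <= (A * b)%:E * dirichlet_norm p f)%E.
Proof.
move=> p0; have [A A0 HA] := @carleson_embedding p p0.
have pV0 : 0 <= p^-1 by rewrite invr_ge0 ltW.
exists ((2 * A) `^ p^-1); first by rewrite powR_gt0// mulr_gt0.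
move=> f g b fh gh b0 gb.
rewrite /F_norm /dirichlet_norm dirichlet_energyE// volterra0 normc0 powR0 ?gt_eqF// add0e.
set E := ((normc (f 0) `^ p)%:E + _)%E.
have E0 : (0 <= E)%E.
  by rewrite adde_ge0 ?lee_fin ?powR_ge0// mule_ge0 ?dirichlet_int_ge0// lee_fin invr_ge0 pi_ge0.
have Ab0 : 0 <= 2 * A * b `^ p by rewrite mulr_ge0 ?powR_ge0// mulr_ge0// ltW.
have -> : ((2 * A) `^ p^-1 * b)%:E = ((2 * A * b `^ p)%:E `^ p^-1)%E.
  rewrite poweR_EFin; congr EFin.
  rewrite (@powRM _ (2 * A) (b `^ p)) ?powR_ge0 ?mulr_ge0 ?(ltW A0)// -powRrM divff ?gt_eqF//.
  by rewrite powRr1.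
rewrite -poweRM ?lee_fin//.
set S := ereal_sup _.
suff HS : (S <= (2 * A * b `^ p)%:E * E)%E.
  apply: gt0_ler_poweR => //.
    rewrite in_itv/= leey andbT; apply: le_trans (ereal_sup_ubound _); last first.
      by exists 0 => //; rewrite /disc /= normc0.
    apply: integral_ge0 => w _; rewrite lee_fin mulr_ge0 ?invr_ge0 ?pi_ge0//.
    by rewrite !mulr_ge0 ?powR_ge0.
  by rewrite in_itv/= leey andbT mule_ge0 ?lee_fin.
apply: ge_ereal_sup => _ [a ad <-].
have mF : measurable_fun D2 (fun w : R2 => normc (f (cpt w)) `^ p * (den a (cpt w))^-1).
  apply: measurable_funM; last exact: measurable_funTS (measurable_denV a).
  exact: (holo_measurable_powR p fh measurable_D2 (fun w Dw => Dw)).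
have k0 : 0 <= pi^-1 * (2 * b `^ p) by rewrite mulr_ge0 ?invr_ge0 ?pi_ge0// mulr_ge0 ?powR_ge0.
apply: (@le_trans _ _ (\int[mu2]_(w in D2) ((pi^-1 * (2 * b `^ p))%:E *
    (normc (f (cpt w)) `^ p * (den a (cpt w))^-1)%:E))%E).
  apply: le_integral_ge0 => [//|w _|w _|w Dw].
  - by rewrite lee_fin mulr_ge0 ?invr_ge0 ?pi_ge0// !mulr_ge0 ?powR_ge0.
  - by rewrite -EFinM lee_fin mulr_ge0// mulr_ge0 ?powR_ge0 ?invr_ge0 ?normc_ge0.
  - rewrite -EFinM lee_fin -(mulrA pi^-1) ler_wpM2l ?invr_ge0 ?pi_ge0//.
    by apply: F_density_le => //; exact: gb.
have mFE : measurable_fun D2 (fun w : R2 => (normc (f (cpt w)) `^ p * (den a (cpt w))^-1)%:E).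
  exact/measurable_EFinP.
have F0 w : D2 w -> (0 <= (normc (f (cpt w)) `^ p * (den a (cpt w))^-1)%:E)%E.
  by move=> _; rewrite lee_fin mulr_ge0 ?powR_ge0 ?invr_ge0 ?normc_ge0.
have kE : (0 <= (pi^-1 * (2 * b `^ p))%:E)%E by rewrite lee_fin.
rewrite (ge0_integralZl mu2 measurable_D2 mFE F0 kE).
apply: le_trans (lee_wpmul2l kE (HA _ _ fh ad)) _.
have pi1 : 1 <= pi :> R by have := pi_ge2 R; lra.
(* The normalisation [1 / pi] concerns only the integral; since [pi >= 1], the term at 0 may be
   multiplied by [pi] too. *)
have HE : ((normc (f 0) `^ p)%:E + dirichlet_int f p <= pi%:E * E)%E.
  rewrite /E ge0_muleDr ?lee_fin ?powR_ge0//; last first.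
    by rewrite mule_ge0 ?dirichlet_int_ge0// lee_fin invr_ge0 pi_ge0.
  apply: leeD; first by rewrite -EFinM lee_fin ler_peMl ?powR_ge0.
  by rewrite muleA -EFinM divff ?mul1e// gt_eqF// pi_gt0.
have A0E : (0 <= A%:E)%E by rewrite lee_fin ltW.
apply: le_trans (lee_wpmul2l kE (lee_wpmul2l A0E HE)) _.
rewrite !muleA -!EFinM le_eqVlt; apply/orP; left; apply/eqP; congr (_%:E * _)%E.
have : (pi : R) != 0 by rewrite gt_eqF ?pi_gt0.
by move: (pi : R) => q q0; field.
Qed.

End UpperBound.

(** * Test functions and the lower bound *)

Section LowerBound.
Context {R : realType}.
Local Notation C := R[i].
Local Notation mu := (@lebesgue_measure R).
Local Notation mu2 := (mu \x mu)%E.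
Local Notation R2 := (measurableTypeR R * measurableTypeR R)%type.
Implicit Types (f g : C -> C) (a z : C) (p : R).

Lemma cdiff_szego_pow a z n : disc a -> disc z ->
  cdiff (fun w => ((1 - (a^*)%C * w)^-1) ^+ n) z
    (n%:R * (a^*)%C * ((1 - (a^*)%C * z)^-1) ^+ n.+1).
Proof.
move=> ad zd; set b := (a^*)%C; pose s (w : C) : C := (1 - b * w)^-1.
have nz : 1 - b * z != 0 by rewrite -normc_gt0; exact: den_gt0.
have ds : cdiff s z (b * s z ^+ 2).
  have b1 : normc b < 1 by rewrite normc_conj.
  have q0 : 0 < normc (1 - b * z) by rewrite normc_gt0.
  apply: (@cdiff_quad _ _ _ _ (normc (1 - b * z) / 2) (2 / normc (1 - b * z) ^+ 3)).
    by rewrite divr_gt0.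
  move=> k kd; have bk : normc (b * k) <= normc k.
    by rewrite normcM ler_piMl ?normc_ge0// ltW.
  have lo : normc (1 - b * z) / 2 <= normc (1 - b * (z + k)).
    have := ler_normcB (1 - b * z) (b * k).
    by rewrite (_ : 1 - b * z - b * k = 1 - b * (z + k)); [lra|ring].
  have nk : 1 - b * (z + k) != 0 by rewrite -normc_gt0 (lt_le_trans _ lo)// divr_gt0.
  have -> : s (z + k) - s z - b * s z ^+ 2 * k =
      b ^+ 2 * (k ^+ 2 * ((1 - b * (z + k))^-1 * (1 - b * z) ^- 2)).
    by rewrite /s; field; rewrite nk nz.
  rewrite normcM normcX; apply: (@le_trans _ _ (1 * (2 / normc (1 - b * z) ^+ 3 * normc k ^+ 2))); last by rewrite mul1r.
  apply: ler_pM; rewrite ?exprn_ge0 ?normc_ge0//.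
    by rewrite expr_le1 ?normc_ge0// ltW.
  rewrite normcM normcX mulrC ler_wpM2r ?sqr_ge0// normcM !normcV normcX.
  have -> : 2 / normc (1 - b * z) ^+ 3 = (normc (1 - b * z) / 2)^-1 * normc (1 - b * z) ^- 2.
    by field; rewrite gt_eqF.
  by rewrite ler_wpM2r ?invr_ge0 ?sqr_ge0// lef_pV2 ?posrE ?divr_gt0// normc_gt0.
elim: n => [|n IH].
  by rewrite mul0r mul0r; exact: cdiff_cst.
have := cdiffM ds IH; rewrite -/(s z).
have -> : (fun w => s w * ((1 - b * w)^-1) ^+ n) = (fun w => ((1 - b * w)^-1) ^+ n.+1).
  by apply/funext => w; rewrite exprS.
congr cdiff; rewrite /s !exprS -natr1; ring.
Qed.

(** A power of the Szegoe kernel. The exponent is a natural number, so no branch of a complex power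
    has to be chosen. *)
Definition test_fun a (c : R) n z : C := c%:C * ((1 - (a^*)%C * z)^-1) ^+ n.

Lemma test_fun_cdiff a c n z : disc a -> disc z -> cdiff (test_fun a c n) z
  (c%:C * (n%:R * (a^*)%C * ((1 - (a^*)%C * z)^-1) ^+ n.+1)).
Proof.
move=> ad zd; have := cdiffM (cdiff_cst c%:C z) (cdiff_szego_pow n ad zd).
by rewrite mul0r addr0.
Qed.

Lemma normc_test_fun a c n z : 0 <= c -> normc (test_fun a c n z) = c * den a z ^- n.
Proof. by move=> c0; rewrite normcM normc_real ger0_norm// normcX normcV exprVn. Qed.

Lemma normc_natr (n : nat) : normc (n%:R : C) = n%:R.
Proof. by rewrite -(rmorph_nat (real_complex R)) normc_real ger0_norm. Qed.

Lemma normc_cderiv_test_fun_le a c n z : disc a -> disc z -> 0 <= c ->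
  normc (cderiv (test_fun a c n) z) <= c * (n%:R * den a z ^- n.+1).
Proof.
move=> ad zd c0; rewrite (cdiff_cderiv (test_fun_cdiff c n ad zd)).
rewrite !normcM normc_real ger0_norm// normcX normcV exprVn normc_natr normc_conj.
rewrite ler_wpM2l// ler_wpM2r ?invr_ge0 ?exprn_ge0 ?normc_ge0//.
by rewrite ler_piMr// ltW.
Qed.

Lemma powR_exprV (x p : R) n : 0 < x -> (x ^- n) `^ p = x `^ (- (n%:R * p)).
Proof.
by move=> x0; rewrite -(powR_invn n (ltW x0)) -powRrM mulNr.
Qed.

(** The real-variable content of [near_diagonal_bounds], with [e = 1 - |a|], [r = |z|],
    [u = |z - a|] and [d = den a z]. The product in the last numerator is at least [e^2 / 2] and
    [d^2 <= 9 e^2], whence 18. *)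
Lemma near_diagonal_real (e r u d : R) : 0 < e -> e <= 1 -> 0 <= r -> 0 <= u -> 0 < d ->
  r - (1 - e) <= u -> 1 - e - r <= u -> u <= e / 2 ->
  d ^+ 2 = u ^+ 2 + (1 - (1 - e) ^+ 2) * (1 - r ^+ 2) ->
  [/\ e / 2 <= 1 - r ^+ 2, 1 - r ^+ 2 <= 3 * e, d <= 3 * e &
      18^-1 <= (1 - (1 - e) ^+ 2) * (1 - r ^+ 2) / d ^+ 2].
Proof.
move=> e0 e1 r0 u0 d0 h1 h2 ue dsq.
have r1 : r <= 1 - e / 2 by lra.
have r2 : 1 - 3 / 2 * e <= r by lra.
clear h1 h2.
have x0 : e / 2 <= 1 - r ^+ 2 by clear dsq ue; nra.
have x1 : 1 - r ^+ 2 <= 3 * e by clear dsq ue x0; nra.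
have y0 : e <= 1 - (1 - e) ^+ 2 by clear -e0 e1; nra.
have y1 : 1 - (1 - e) ^+ 2 <= 2 * e by clear -e0 e1; nra.
clear r1 r2 r0.
move: (1 - r ^+ 2) (1 - (1 - e) ^+ 2) x0 x1 y0 y1 dsq => x y x0 x1 y0 y1 dsq.
have e20 : 0 <= e / 2 by rewrite divr_ge0// ltW.
have u2 : u ^+ 2 <= (e / 2) ^+ 2 by rewrite lerXn2r ?nnegrE.
have xx : 0 <= x by apply: le_trans x0.
have yy : 0 <= y by apply: le_trans y0; exact: ltW.
have yx : y * x <= (2 * e) * (3 * e) by exact: ler_pM.
have xy : e * (e / 2) <= y * x by apply: ler_pM => //; exact: ltW.
have e2 : 0 < e ^+ 2 by rewrite exprn_gt0.
have d3 : d ^+ 2 <= 9 * e ^+ 2 by clear -u2 yx e2 dsq; lra.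
split=> //.
  rewrite -(ler_pXn2r (n := 2)) ?nnegrE ?(ltW d0) ?mulr_ge0 ?(ltW e0)//.
  by apply: le_trans d3 _; rewrite exprMn; clear -e2; lra.
by rewrite ler_pdivlMr ?exprn_gt0//; clear -xy d3 e2; lra.
Qed.

Lemma near_diagonal_bounds a z : disc a -> disc z -> normc (z - a) <= (1 - normc a) / 2 ->
  [/\ (1 - normc a) / 2 <= 1 - normc z ^+ 2, 1 - normc z ^+ 2 <= 3 * (1 - normc a),
      den a z <= 3 * (1 - normc a) &
      18^-1 <= (1 - normc a ^+ 2) * (1 - normc z ^+ 2) / den a z ^+ 2].
Proof.
move=> ad zd wa; have h2 := ler_normcB a z; rewrite (normcB a) in h2.
have aE : normc a = 1 - (1 - normc a) by ring.
rewrite [X in (1 - X ^+ 2) * _]aE.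
apply: (near_diagonal_real (u := normc (z - a))) => //; rewrite -?aE ?normc_ge0//.
- by rewrite subr_gt0.
- by rewrite gerBl normc_ge0.
- exact: den_gt0.
- exact: ler_normcB.
- by rewrite den_sqr normcB.
Qed.

Lemma F_norm_lower p : 0 < p -> exists2 A, 0 < A & forall g a, holo_disc g -> disc a ->
  exists f, [/\ dirichlet p f, (dirichlet_norm p f <= 1)%E &
    (((1 - normc a ^+ 2) * normc (cderiv g a))%:E <=
      A%:E * F_norm p (p - 1) 1 (volterra g f))%E].
Proof.
move=> p0; pose n := (Num.truncn (4 / p)).+1.
have np : 4 <= n%:R * p.
  by rewrite -ler_pdivrMr//; exact/ltW/truncnS_gt.
have [AF AF0 HF] := forelli_rudin p0 np.
have [K K0 HK] := @submean R p p0.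
have pV0 : 0 <= p^-1 by rewrite invr_ge0 ltW.
(* [t] collects the value at 0 and the energy of the test function, both relative to [c^p]; with
   [c^p = 1 / t] the norm is at most 1 for every [a]. *)
pose t := 1 + n%:R `^ p * AF.
have t0 : 0 < t by rewrite addr_gt0// mulr_gt0 ?powR_gt0.
pose c := t `^ (- p^-1).
have c0 : 0 < c by rewrite powR_gt0.
have cp : c `^ p = t^-1.
  by rewrite /c -powRrM mulNr mulVf ?gt_eqF// powR_inv1// ltW.
clearbody c.
(* The lower bounds near [a]: [3^(-n p)] from [den <= 3 e], [4^(-|p - 1|)] from comparing
   [1 - |w|^2] with [e], and 1/18 from the Moebius factor. *)
pose m := c `^ p * 3 `^ (- (n%:R * p)) * 4 `^ (- `|p - 1|) * 18^-1.
have m0 : 0 < m by rewrite !mulr_gt0 ?powR_gt0 ?invr_gt0.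
pose W := 16 * K * (pi * m^-1).
have W0 : 0 < W by rewrite !mulr_gt0 ?invr_gt0 ?pi_gt0.
exists (2 * W `^ p^-1); first by rewrite mulr_gt0 ?powR_gt0.
move=> g a gh ad; pose e := 1 - normc a.
have e0 : 0 < e by rewrite subr_gt0.
have e1 : e <= 1 by rewrite gerBl normc_ge0.
pose k := c * e `^ (n%:R - p^-1).
have k0 : 0 < k by rewrite mulr_gt0 ?powR_gt0.
have kp : k `^ p = c `^ p * e `^ (n%:R * p - 1).
  rewrite /k powRM ?powR_ge0 ?(ltW c0)// -powRrM mulrBl mulVf ?gt_eqF//.
clearbody k.
pose f := test_fun a k n.
have fh : holo_disc f by move=> z zd; exact: cdiff_derivable (test_fun_cdiff k n ad zd).
have gd := holo_cderiv gh.
have ep1 : e `^ (n%:R * p - 1) <= 1.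
  have np1 : 0 <= n%:R * p - 1 by rewrite subr_ge0 (le_trans _ np)// ler1n.
  have := @ge0_ler_powR R (n%:R * p - 1) np1 e 1.
  by rewrite !nnegrE powR1; apply => //; exact: ltW.
have f0 : normc (f 0) `^ p <= c `^ p.
  rewrite normc_test_fun ?(ltW k0)// /den mulr0 subr0 normc1 expr1n invr1 mulr1 kp.
  by rewrite ler_piMr ?powR_ge0.
have fI : (dirichlet_int f p <= (c `^ p * (n%:R `^ p * AF))%:E)%E.
  pose F (w : R2) := (1 - normc (cpt w) ^+ 2) `^ (p - 1) * (e `^ (n%:R * p - 1) * den a (cpt w) `^ (- (n%:R * p + p))).
  have F0 w : 0 <= F w by rewrite !mulr_ge0 ?powR_ge0.
  have mF : measurable_fun D2 (fun w => (F w)%:E).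
    apply/measurable_EFinP; apply: measurable_funTS; apply: measurable_funM.
      apply: (measurableT_comp (measurable_powR (p - 1))).
      by apply: measurable_funB => //; apply: measurable_funX; exact: measurable_normc_cpt.
    apply: measurable_funM => //.
    exact: (measurableT_comp (measurable_powR _) (measurable_den a)).
  have q0 : 0 <= c `^ p * n%:R `^ p by rewrite mulr_ge0 ?powR_ge0.
  apply: (@le_trans _ _ (\int[mu2]_(w in D2) ((c `^ p * n%:R `^ p)%:E * (F w)%:E))%E).
    apply: le_integral_ge0 => [//|w _|w _|w Dw].
    - by rewrite lee_fin mulr_ge0 ?powR_ge0.
    - by rewrite -EFinM lee_fin mulr_ge0.
    - have d0 := den_gt0 ad Dw.
      have := @ge0_ler_powR R p (ltW p0) _ _ _ _ (normc_cderiv_test_fun_le n ad Dw (ltW k0)).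
      rewrite !nnegrE normc_ge0 !mulr_ge0 ?(ltW k0) ?invr_ge0 ?exprn_ge0 ?(ltW d0)// => /(_ isT isT).
      rewrite powRM ?mulr_ge0 ?(ltW k0) ?invr_ge0 ?exprn_ge0 ?(ltW d0)//.
      rewrite powRM ?invr_ge0 ?exprn_ge0 ?(ltW d0)// powR_exprV// kp => H.
      rewrite -EFinM lee_fin /F.
      apply: le_trans (ler_wpM2r (powR_ge0 _ _) H) _.
      rewrite (_ : n.+1%:R * p = n%:R * p + p); last by rewrite -natr1; ring.
      by rewrite le_eqVlt; apply/orP; left; apply/eqP; ring.
  have FE0 w : D2 w -> (0 <= (F w)%:E)%E by move=> _; rewrite lee_fin.
  have qE : (0 <= (c `^ p * n%:R `^ p)%:E :> \bar R)%E by rewrite lee_fin.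
  rewrite (ge0_integralZl mu2 measurable_D2 mF FE0 qE).
  by rewrite (mulrA (c `^ p)) (EFinM (c `^ p * _)) lee_wpmul2l//; exact: HF.
have pi1 : pi^-1 <= 1 :> R.
  by rewrite invf_le1 ?pi_gt0//; have := pi_ge2 R; lra.
have piV0 : 0 <= pi^-1 :> R by rewrite invr_ge0 pi_ge0.
have norm1 : (dirichlet_norm p f <= 1)%E.
  rewrite /dirichlet_norm dirichlet_energyE//; set E := (_ + _)%E.
  have E1 : (E <= 1)%E.
    apply: (@le_trans _ _ ((c `^ p)%:E + (c `^ p * (n%:R `^ p * AF))%:E)%E).
      apply: leeD; first by rewrite lee_fin.
      apply: le_trans fI; rewrite -[leRHS]mul1e lee_wpmul2r ?dirichlet_int_ge0//.
    rewrite -EFinD lee_fin le_eqVlt; apply/orP; left; apply/eqP.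
    by rewrite -[X in X + _]mulr1 -mulrDr cp mulVf// gt_eqF.
  have E0 : (0 <= E)%E.
    by rewrite adde_ge0 ?lee_fin ?powR_ge0// mule_ge0 ?dirichlet_int_ge0 ?lee_fin.
  rewrite -(poweR1r p^-1); apply: gt0_ler_poweR => //; rewrite in_itv/= leey andbT//.
exists f; split=> //.
  by split=> //; apply: le_lt_trans norm1 _; rewrite ltry.
rewrite /F_norm volterra0 normc0 powR0 ?gt_eqF// add0e.
set S := ereal_sup _.
pose s := e / 4; have s0 : 0 < s by rewrite divr_gt0.
have as1 : normc a + 2 * s < 1 by have := ad : normc a < 1; rewrite /s /e; lra.
have sub := sq2_disc as1.
have mG := holo_measurable_powR p gd (measurable_sq2 a s) sub.
have GE0 w : sq2 a s w -> (0 <= (normc (cderiv g (cpt w)) `^ p)%:E)%E.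
  by move=> _; rewrite lee_fin powR_ge0.
have mGE : measurable_fun (sq2 a s) (fun w => (normc (cderiv g (cpt w)) `^ p)%:E).
  exact/measurable_EFinP.
have q0 : 0 <= pi^-1 * (m * e `^ (p - 2)) by rewrite !mulr_ge0 ?powR_ge0// ltW.
have qE : (0 <= (pi^-1 * (m * e `^ (p - 2)))%:E)%E by rewrite lee_fin.
(* The supremum is tested at the same point [a], and the integral restricted to the square about
   [a], where every factor except [g'] is comparable to a power of [e]. *)
have SI : ((pi^-1 * (m * e `^ (p - 2)))%:E * pmean (cderiv g) a s p <= S)%E.
  apply: le_trans (ereal_sup_ubound _); last by exists a.
  rewrite /pmean -(ge0_integralZl mu2 (measurable_sq2 a s) mGE GE0 qE).
  apply: le_integral_ge0 => [//|w _|w _|w wsq].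
  - by rewrite -EFinM lee_fin mulr_ge0 ?powR_ge0.
  - by rewrite lee_fin mulr_ge0// !mulr_ge0 ?powR_ge0.
  - have Dw : disc (cpt w) := sub _ wsq.
    have wa : normc (cpt w - a) <= e / 2.
      by move/sq2P/square_normc: wsq; rewrite /s; lra.
    rewrite -EFinM lee_fin -[leLHS]mulrA; move: piV0 => /ler_wpM2l; apply.
    rewrite (cdiff_cderiv (volterra_cdiff fh gh Dw)) mobius_gap// powRr1; last first.
      by rewrite divr_ge0 ?sqr_ge0// ltW// mulr_gt0 ?disc_sqr.
    have d0 := den_gt0 ad Dw.
    rewrite normcM powRM ?normc_ge0//.
    rewrite /f normc_test_fun ?(ltW k0)// powRM ?(ltW k0) ?invr_ge0 ?exprn_ge0 ?(ltW d0)//.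
    rewrite powR_exprV// kp.
    set d := den a (cpt w) in d0 *; set x := 1 - normc (cpt w) ^+ 2.
    set y := 1 - normc a ^+ 2; set G := normc (cderiv g (cpt w)).
    have [] := near_diagonal_bounds ad Dw wa; rewrite -/e -/d -/x -/y => x0 x1 dle sP.
    have x00 : 0 < x by apply: lt_le_trans x0; rewrite divr_gt0.
    have dP : 3 `^ (- (n%:R * p)) * e `^ (- (n%:R * p)) <= d `^ (- (n%:R * p)).
      rewrite -powRM ?(ltW e0)//; apply: powR_antitone => //.
      by rewrite mulr_ge0// ltW.
    have xP : 4 `^ (- `|p - 1|) * e `^ (p - 1) <= x `^ (p - 1).
      rewrite powRN ler_pdivrMl ?powR_gt0//; apply: powR_comparable => //.
        by rewrite ler1n.
        by rewrite -ler_pdivrMl// (le_trans _ x0)// mulrC ler_wpM2l ?(ltW e0)// lef_pV2 ?posrE// ler_nat.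
      by rewrite (le_trans x1)// ler_wpM2r ?(ltW e0)// ler_nat.
    have eE : e `^ (p - 2) = e `^ (n%:R * p - 1) * (e `^ (- (n%:R * p)) * e `^ (p - 1)).
      by rewrite -!gt0_powRD//; congr powR; ring.
    rewrite [leLHS](_ : _ = c `^ p * e `^ (n%:R * p - 1) * G `^ p *
       ((3 `^ (- (n%:R * p)) * e `^ (- (n%:R * p))) * (4 `^ (- `|p - 1|) * e `^ (p - 1)) * 18^-1)); last first.
      by rewrite eE /m; ring.
    rewrite [leRHS](_ : _ = c `^ p * e `^ (n%:R * p - 1) * G `^ p *
       (d `^ (- (n%:R * p)) * x `^ (p - 1) * (y * x / d ^+ 2))); last by ring.
    rewrite ler_wpM2l ?mulr_ge0 ?powR_ge0//.
    by apply: ler_pM => //; rewrite ?mulr_ge0 ?powR_ge0// ler_pM ?mulr_ge0 ?powR_ge0.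
have GS : (((e * normc (cderiv g a)) `^ p)%:E <= W%:E * S)%E.
  have ms : (0 <= (16 * K * (pi * m^-1))%:E)%E by rewrite lee_fin ltW.
  apply: le_trans (lee_wpmul2l ms SI).
  rewrite muleA -EFinM powRM ?(ltW e0) ?normc_ge0// EFinM.
  have eP : (0 <= (e `^ p)%:E)%E by rewrite lee_fin powR_ge0.
  apply: le_trans (lee_wpmul2l eP (HK _ _ _ gd s0 as1)) _.
  rewrite muleA -EFinM le_eqVlt; apply/orP; left; apply/eqP; congr (_%:E * _)%E.
  have eE : e `^ p = e `^ (p - 2) * e ^+ 2.
    by rewrite -(powR_mulrn 2 (ltW e0)) -gt0_powRD// subrK.
  have pin0 : (pi : R) != 0 by rewrite gt_eqF ?pi_gt0.
  have mn0 : m != 0 by rewrite gt_eqF.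
  have en0 : e != 0 by rewrite gt_eqF.
  rewrite eE /s; move: (pi : R) pin0 (e `^ (p - 2)) (m) mn0 => q1 q10 q2 q3 q30.
  by field; rewrite q10 q30 en0.
have S0 : (0 <= S)%E.
  apply: le_trans SI; apply: mule_ge0 => //.
  by apply: integral_ge0 => w _; rewrite lee_fin powR_ge0.
have GP : ((e * normc (cderiv g a))%:E <= (W `^ p^-1)%:E * S `^ p^-1)%E.
  have -> : (e * normc (cderiv g a))%:E = (((e * normc (cderiv g a)) `^ p)%:E `^ p^-1)%E.
    rewrite poweR_EFin -powRrM divff ?gt_eqF// powRr1//.
    by rewrite mulr_ge0 ?normc_ge0// ltW.
  rewrite -(poweR_EFin W) -poweRM ?lee_fin ?(ltW W0)//.
  apply: gt0_ler_poweR => //; rewrite in_itv/= leey andbT.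
    by rewrite lee_fin powR_ge0.
  by rewrite mule_ge0 ?lee_fin ?(ltW W0).
(* The Bloch quantity has [1 - |a|^2 <= 2 (1 - |a|)], which accounts for the factor 2 in the
   constant. *)
apply: (@le_trans _ _ (2%:E * (e * normc (cderiv g a))%:E)%E).
  rewrite -EFinM lee_fin mulrA ler_wpM2r ?normc_ge0//.
  by rewrite /e; have := normc_ge0 a; move: (ad : normc a < 1); nra.
by rewrite (EFinM 2) -muleA lee_wpmul2l.
Qed.

End LowerBound.

Section Main.
Context {R : realType}.

Lemma bloch_norm_ge0 (g : R[i] -> R[i]) : (0 <= bloch_norm g)%E.
Proof.
have d0 : disc (0 : R[i]) by rewrite /disc /= normc0.
apply: le_trans (ereal_sup_ubound _); last by exists 0.
by rewrite lee_fin mulr_ge0 ?normc_ge0// ltW// disc_sqr.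
Qed.

End Main.

Theorem theorem3 (R : realType) (p : R) (hp : 0 < p) :
  exists C : R, 0 < C /\
    forall g : R[i] -> R[i], holo_disc g ->
      (bounded_operator (dirichlet p) (dirichlet_norm p)
         (F_space p (p - 1) 1) (F_norm p (p - 1) 1) (volterra g)
       <-> bloch g) /\
      (C^-1%:E * bloch_norm g
         <= operator_norm (dirichlet p) (dirichlet_norm p)
              (F_norm p (p - 1) 1) (volterra g))%E /\
      (operator_norm (dirichlet p) (dirichlet_norm p)
         (F_norm p (p - 1) 1) (volterra g)
         <= C%:E * bloch_norm g)%E.
Proof.
have [A1 A10 HU] := @F_norm_upper R p hp.
have [A2 A20 HL] := @F_norm_lower R p hp.
have C0 : 0 < A1 + A2 by rewrite addr_gt0.
(* One constant dominates both [A1], for the upper bound, and [A2], for the lower. *)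
exists (A1 + A2); split=> [|g gh]; first exact: C0.
set op := operator_norm _ _ _ _.
have b0 := bloch_norm_ge0 g.
have bop : (bloch_norm g <= A2%:E * op)%E.
  apply: ge_ereal_sup => _ [a ad <-].
  have [f [fD f1 Hf]] := HL g a gh ad.
  apply: le_trans Hf _; rewrite lee_wpmul2l ?lee_fin ?(ltW A20)//.
  by apply: ereal_sup_ubound; exists f.
(* A negative supremum would force a negative Bloch norm through [bop]. *)
have op0 : (0 <= op)%E.
  rewrite leNgt; apply/negP => opn; move: bop; rewrite leNgt => /negP; apply.
  apply: lt_le_trans b0.
  by rewrite mule_gt0_lt0 ?lte_fin.
have bfin : (bloch_norm g < +oo)%E -> exists2 b : R, 0 <= b & bloch_norm g = b%:E /\
    forall z, disc z -> (1 - normc z ^+ 2) * normc (cderiv g z) <= b.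
  move=> bl; have bn : bloch_norm g \is a fin_num by rewrite ge0_fin_numE.
  exists (fine (bloch_norm g)); first by rewrite fine_ge0.
  split; first by rewrite fineK.
  move=> z zd; rewrite -lee_fin fineK//.
  by apply: ereal_sup_ubound; exists z.
split; last split.
- split=> [[_ [M HM]]|[_ /bfin[b bb [_ Hb]]]].
    split=> //; apply: le_lt_trans bop _.
    (* The constant [M] of a bounded operator may have any sign, hence the absolute value. *)
    have opM : (op <= `|M|%:E)%E.
      apply: ge_ereal_sup => _ [f [fD f1] <-].
      apply: le_trans (HM f fD) _.
      apply: (@le_trans _ _ (`|M|%:E * dirichlet_norm p f)%E).
        by rewrite lee_wpmul2r ?poweR_ge0// lee_fin ler_norm.
      by rewrite -[leRHS]mule1 lee_wpmul2l// lee_fin.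
    apply: (@le_lt_trans _ _ (A2%:E * `|M|%:E)%E).
      by rewrite lee_wpmul2l// lee_fin ltW.
    by rewrite -EFinM ltry.
  split.
    move=> f [fh fn]; split; first exact: volterra_holo.
    apply: le_lt_trans (HU f g b fh gh bb Hb) _.
    have fin : dirichlet_norm p f \is a fin_num by rewrite ge0_fin_numE ?poweR_ge0.
    by rewrite -(fineK fin) -EFinM ltry.
  by exists (A1 * b) => f [fh _]; exact: HU.
- rewrite lee_pdivrMl//; apply: le_trans bop _.
  by rewrite lee_wpmul2r// lee_fin lerDr ltW.
(* If the Bloch norm is infinite, so is the right-hand side, since the constant is positive. *)
- have [by_|bn] := eqVneq (bloch_norm g) +oo%E.
    by rewrite by_ gt0_muley ?lte_fin// leey.
  have /bfin[b bb [bE Hb]] : (bloch_norm g < +oo)%E by rewrite ltey.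
  apply: ge_ereal_sup => _ [f [[fh _] f1] <-].
  apply: le_trans (HU f g b fh gh bb Hb) _.
  rewrite bE -[leRHS]mule1; apply: (@le_trans _ _ ((A1 * b)%:E * 1)%E).
    by rewrite lee_wpmul2l// lee_fin mulr_ge0// ltW.
  by rewrite !mule1 -EFinM lee_fin ler_wpM2r// lerDl ltW.
Qed.
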